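(* Let $a,b,d,e\in\mathbb{C}$, $r\in\mathbb{N}$, $\mathbf{m}=(m_1,\dots,m_r)\in\mathbb{N}^r$, $m=m_1+\cdots+m_r$, $\mathbf{f}=(f_1,\dots,f_r)\in\mathbb{C}^r$. Suppose $q\in\{0,\ldots,m-1\}$, $a+m-q\notin-\mathbb{N}_0$, $a-b\notin\{q+1-m,\ldots,q\}$, and $f_j-a\notin\{m-q-m_j,m-q-m_j+1,\ldots,0\}$ for every index $1\le j\le r$ such that $m-q-m_j\le0$. Then $${}_{r+3}F_{r+2}\left(\begin{matrix}a,b,d,\mathbf{f}+\mathbf{m}\\ a+m-q,e,\mathbf{f}\end{matrix}\right)=\frac{\Gamma(e)\Gamma(e-b-d-q)}{\Gamma(e-d)\Gamma(e-b-q)}\sum_{j=0}^{q}\frac{(-q)_j(a-b-q)_j(d)_j\hat{Q}^0_m(-j)}{(a+m-q)_{j}(e-b-q)_{j}\,j!}$$ $$+\frac{\Gamma(e)\Gamma(e-b-d-q)(b-a)_{q+1}(d)_{q+1}\hat{R}_{m-q-1}(-q-1)}{\Gamma(e-d)\Gamma(e-b+1)(a+m-q)_{q+1}}\;{}_{m-q+2}F_{m-q+1}\left(\begin{matrix}1,a-b+1,d+q+1,\boldsymbol{\gamma}+q+2\\ a+m+1,e-b+1,\boldsymbol{\gamma}+q+1\end{matrix}\right),$$ where $\boldsymbol{\gamma}=(\gamma_1,\dots,\gamma_{m-q-1})$ are the roots of the polynomial $\hat{R}_{m-q-1}(t)$ and the values $\hat Q_m^0(-j)$, $0\le j\le q$,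 are as defined in the context, and $$\hat{R}_{m-q-1}(-q-1)=\frac{(b)_{q+1}}{(b-a)_{q+1}}\sum_{k=0}^{q+1}\frac{(-m+k)_{q+1-k}(a)_kC_{k,r}}{(q+1-k)!}.$$
   Context: $\mathbb{N}=\{1,2,\dots\}$, $\mathbb{N}_0=\mathbb{N}\cup\{0\}$; $(z)_k=z(z+1)\cdots(z+k-1)$, $(z)_0=1$. ${}_pF_q$ with omitted argument is the value at $z=1$ of the generalized hypergeometric series $\sum_{n\ge0}\frac{(a_1)_n\cdots(a_p)_n}{(b_1)_n\cdots(b_q)_n}\frac{z^n}{n!}$. The identity is understood for parameters for which both sides are defined: no bottom parameter is a nonpositive integer (except in terminating series, which are finite sums), the series at unit argument converge (for nonterminating series this means $\Re(e-b-d-q)>0$ on the left and $\Re(e-d)>0$ on the right), and the expressions on the right are defined. A vector in a parameter list stands for the list of its components: $\mathbf{f}+\mathbf{m}$ means $f_1+m_1,\dots,f_r+m_r$; $\boldsymbol{\gamma}+s$ means $\gamma_1+s,\dots,\gamma_{m-q-1}+s$ (an empty list if $m-q-1=0$). The coefficients are $C_{k,r}=\frac{(-1)^k}{k!}\,{}_{r+1}F_r\left(\begin{matrix}-k,\mathbf{f}+\mathbf{m}\\ \mathbf{f}\end{matrix}\right)=\frac{(-1)^k}{k!}\sum_{i=0}^k\frac{(-k)_i}{i!}\prod_{j=1}^r\frac{(f_j+m_j)_i}{(f_j)_i}$ for $0\le k\le m$; in particular $C_{0,r}=1$, $C_{m,r}=1/\prod_{j=1}^r(f_j)_{m_j}$.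 The polynomial $\hat R_{m-q-1}$, regarded as a polynomial of degree $m-q-1$ (so $\hat R_{m-q-1}(t)=\kappa\prod_i(t-\gamma_i)$, $\kappa\neq0$ constant), is $$\hat{R}_{m-q-1}(t)=\frac{(b)_{q+1}}{(b-a)_{q+1}}\sum_{k=0}^{q}\frac{(-m+k)_{q-k+1}(a)_{k}C_{k,r}}{(q-k+1)!}\,{}_{3}F_{2}\left(\begin{matrix}1-m+q,\,t+q+1,\,1-b-k\\ a-b+1,\,2-k+q\end{matrix}\right)$$ $$+\sum_{k=q+1}^{m}\frac{(-1)^k(a)_{k}(b)_{k}C_{k,r}(t+q+1)_{k-q-1}}{(a-b-q)_k(k-q-1)!}\,{}_{3}F_{2}\left(\begin{matrix}-m+k,\,t+k,\,-b-q\\ a-b-q+k,\,k-q\end{matrix}\right).$$ The values $\hat Q_m^0(-l)$ are: $\hat Q_m^0(0)=1$ and, for $l=1,\dots,q$, $$\hat{Q}_m^0(-l)=\sum_{k=0}^{l}\frac{(-1)^k(-l)_{k}(a)_k(b)_kC_{k,r}}{(-q)_k(a-b-q)_k}\,{}_{3}F_{2}\left(\begin{matrix}k-m,\,k-l,\,-b-q\\ k-q,\,a-b-q+k\end{matrix}\right),$$ where the ${}_3F_2$ is the finite sum $\sum_{i=0}^{l-k}\frac{(k-m)_i(k-l)_i(-b-q)_i}{(k-q)_i(a-b-q+k)_i\,i!}$.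
   Formalization: A bottom parameter f_j or γ_i+q+1 may be a nonpositive integer only if a, b or d (resp. a-b+1 or d+q+1) ends the series before its factor vanishes; the identity fails for series cut off only by f_j+m_j or γ_i+q+2 (e.g. r=m=1, q=0, a=1, b=2, d=-2, e=10, f=-1: 1 against 54/55). *)

(* Defs.v *)
From mathcomp Require Export all_boot all_order all_algebra.
From mathcomp Require Export all_classical all_reals all_analysis.
From mathcomp Require Export complex.

Set Implicit Arguments.
Unset Strict Implicit.
Unset Printing Implicit Defensive.

Import Order.TTheory GRing.Theory Num.Theory.
Import numFieldNormedType.Exports.

Local Open Scope ring_scope.

(* Pochhammer symbol (z)_k = z (z + 1) ... (z + k - 1). *)
Definition poch (K : pzRingType) (z : K) (k : nat) : K :=
  \prod_(i < k) (z + i%:R).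

(* Coefficient of z^n in the generalized hypergeometric series.  As x / 0 = 0,
   it vanishes as soon as an upper Pochhammer symbol does, even if a lower one
   vanishes too: a series that terminates before its lower parameters produce
   a zero denominator is the usual finite sum. *)
Definition hyper_coef (K : numFieldType) (us ls : seq K) (n : nat) : K :=
  (\prod_(u <- us) poch u n) / ((\prod_(l <- ls) poch l n) * n`!%:R).

Definition pFq (K : numFieldType) (us ls : seq K) (z : K) : K :=
  limn (series (fun n => hyper_coef us ls n * z ^+ n)).

(* x ^ z for a positive real x and a complex z, with the real logarithm of x. *)
Definition rpowC (R : realType) (x : R) (z : R[i]) : R[i] :=
  Complex (x `^ complex.Re z * cos (complex.Im z * ln x))
          (x `^ complex.Re z * sin (complex.Im z * ln x)).

(* Gamma (z) = lim_n n! n^z / (z (z + 1) ... (z + n)), valid for every z which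
   is not a pole, i.e. not a nonpositive integer. *)
Definition Gamma (R : realType) (z : R[i]) : R[i] :=
  limn ((fun n => n`!%:R * rpowC n%:R z / poch z n.+1)
        : nat -> (R[i] : numFieldType)).

Definition nonposint (K : pzRingType) (z : K) : Prop :=
  exists n : nat, z = - n%:R.

Definition has_nonposint (K : pzRingType) (us : seq K) : Prop :=
  exists2 u, u \in us & nonposint u.

(* The lower parameter l yields no zero denominator up to the point where the
   series is terminated by one of the upper parameters us (never, if none of
   them is a nonpositive integer; then l is not a nonpositive integer). *)
Definition lower_ok (K : pzRingType) (us : seq K) (l : K) : Prop :=
  forall n : nat, (forall u, u \in us -> poch u n != 0) -> poch l n != 0.

Definition Ccoef (K : numFieldType) (r : nat)
    (f : 'I_r -> K) (mm : 'I_r -> nat) (k : nat) : K :=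
  (-1) ^+ k / k`!%:R *
  pFq (- k%:R :: [seq f j + (mm j)%:R | j : 'I_r]) [seq f j | j : 'I_r] 1.

(* In Rhat and Qhat0, C k is meant to be Ccoef f mm k. *)
Definition Rhat (K : numFieldType) (a b : K) (m q : nat) (C : nat -> K)
    (t : K) : K :=
  poch b q.+1 / poch (b - a) q.+1 *
    (\sum_(0 <= k < q.+1)
        poch (- m%:R + k%:R) (q - k).+1 * poch a k * C k / (q - k).+1`!%:R *
        pFq [:: 1 - m%:R + q%:R; t + q%:R + 1; 1 - b - k%:R]
            [:: a - b + 1; 2 - k%:R + q%:R] 1)
  + \sum_(q.+1 <= k < m.+1)
        (-1) ^+ k * poch a k * poch b k * C k * poch (t + q%:R + 1) (k - q.+1) /
        (poch (a - b - q%:R) k * (k - q.+1)`!%:R) *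
        pFq [:: - m%:R + k%:R; t + k%:R; - b - q%:R]
            [:: a - b - q%:R + k%:R; k%:R - q%:R] 1.

(* Qhat0 a b m q C l is the value at the point -l, for 0 <= l <= q. *)
Definition Qhat0 (K : numFieldType) (a b : K) (m q : nat) (C : nat -> K)
    (l : nat) : K :=
  if l == 0%N then 1 else
  \sum_(0 <= k < l.+1)
    (-1) ^+ k * poch (- l%:R) k * poch a k * poch b k * C k /
    (poch (- q%:R) k * poch (a - b - q%:R) k) *
    \sum_(0 <= i < (l - k).+1)
      hyper_coef [:: k%:R - m%:R; k%:R - l%:R; - b - q%:R]
                 [:: k%:R - q%:R; a - b - q%:R + k%:R] i.

(* Main.v *)
(* Write P(n) = prod_j (f_j + n)_{m_j} / (f_j)_{m_j}, a polynomial of degree m, and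
   u_n = (a)_n (b)_n P(n) / ((a + m - q)_n n!).  Both sides of the identity are
   linear in u: if sum_n u_n x^n = (1 - x)^(- b - q) sum_j W_j x^j, the claim is that
     sum_n u_n (d)_n / (e)_n
       = Gamma(e) Gamma(e - b - d - q) / (Gamma(e - d) Gamma(e - b - q))
         * sum_j W_j (d)_j / (e - b - q)_j.
   By partial fractions it is enough to treat u_n = (b + k)_n / n! for k <= q, where
   both sums are given by Gauss's theorem, and u_n = (b)_n / (n! (al + n)).  In the
   latter case the difference D(al, e) of the two sides satisfies
     e D(al, e) = (e - al) D(al, e + 1)  and, for large Re e,
     al (al + 1 - e) D(al, e) = (al + 1 - b) (al + 1 - d) D(al + 1, e),
   so that it vanishes: D(al, e + N) -> 0 and (e - al)_N / (e)_N -> 0 if Re al > 0.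
   (If (a)_{m-q} = 0, then u has a finite support and is a combination of the
   sequences (- N)_n / n!, again covered by Gauss's theorem.)
   Finally W is computed by writing P in the basis of the falling factorials and
   transforming each 2F1(a + k, b + k; a + m - q + k; x) as in Euler's formula; its
   values are those of Qhat0 for j <= q and those of Rhat for j > q. *)
Require Import Defs.
From mathcomp Require Import ring lra zify.
Import Order.TTheory GRing.Theory Num.Theory.
Import numFieldNormedType.Exports.
Local Open Scope ring_scope.
Set Implicit Arguments.
Unset Strict Implicit.
Unset Printing Implicit Defensive.

(** * Pochhammer symbols and convolutions *)

(** With [p = m - q], the quotient (a)_n / (a + p)_n equals (a)_p / (a + n)_p, so u_n is (b)_n / n!
    times a rational function of n whose numerator has degree at most p + q and whose poles are
    simple, at n = - a - i for i < p. This is the origin of the two families of the overview, with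
    al = a + i. The exponent natural to a simple pole is b - 1 and not b + q. It is raised one unit
    at a time: each step multiplies the series of W by 1 - x and sums by parts. The abstract
    argument only yields the existence of W. Since convolution with a sequence starting with 1 is
    injective, W must be the explicit sequence found from Euler's transformation. The roots gamma
    enter only through the ratio of Rhat(- q - 1 - t) to Rhat(- q - 1), which is a quotient of
    Pochhammer symbols of length t. *)

Section Pochhammer.
Variable K : comNzRingType.
Implicit Types (z : K) (m n : nat).

Lemma poch0 z : poch z 0 = 1.
Proof. by rewrite /poch big_ord0. Qed.

Lemma pochS z n : poch z n.+1 = poch z n * (z + n%:R).
Proof. by rewrite /poch big_ord_recr. Qed.

Lemma pochSl z n : poch z n.+1 = z * poch (z + 1) n.
Proof.
rewrite /poch big_ord_recl addr0; congr (_ * _); apply: eq_bigr => i _.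
by rewrite /= /bump /= add1n -addrA -natr1 [_ + 1]addrC.
Qed.

Lemma pochD z m n : poch z (m + n) = poch z m * poch (z + m%:R) n.
Proof.
elim: n => [|n IHn]; first by rewrite addn0 poch0 mulr1.
by rewrite addnS !pochS IHn -mulrA natrD addrA.
Qed.

Lemma poch_natN n m : (n < m)%N -> poch (- n%:R : K) m = 0.
Proof. by move=> ltnm; rewrite /poch (bigD1 (Ordinal ltnm)) //= addNr mul0r. Qed.

Lemma poch_opp z n : poch (- z) n = (-1) ^+ n * poch (z - n%:R + 1) n.
Proof.
elim: n z => [|n IHn] z; first by rewrite !poch0 mulr1.
rewrite pochS IHn exprS; have -> : z - n.+1%:R + 1 = z - n%:R by rewrite -natr1; ring.
by rewrite pochSl; ring.
Qed.

End Pochhammer.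

Lemma poch_eq0 (K : idomainType) (z : K) n :
  (poch z n == 0) = [exists i : 'I_n, z == - i%:R].
Proof.
apply/idP/existsP => [/prodf_eq0[i _]|[i zi]].
  by rewrite addr_eq0; exists i.
by apply/prodf_eq0; exists i => //; rewrite addr_eq0.
Qed.

Lemma poch_neq0 (K : idomainType) (z : K) n : ~ nonposint z -> poch z n != 0.
Proof.
move=> Nz; rewrite poch_eq0; apply/existsP => -[i /eqP zi].
by apply: Nz; exists i.
Qed.

Lemma nonposintD (K : pzRingType) (z : K) n :
  ~ nonposint z -> ~ nonposint (z + n%:R).
Proof.
move=> Nz [k zk]; apply: Nz; exists (k + n)%N.
by rewrite natrD opprD -zk addrK.
Qed.

Lemma nonposint_neq0 (K : pzRingType) (z : K) : ~ nonposint z -> z != 0.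
Proof. by move=> Nz; apply/eqP => z0; apply: Nz; exists 0%N; rewrite oppr0. Qed.

Section Convolution.
Variable K : numFieldType.
Implicit Types (u v w : nat -> K) (b : K).

Definition conv u v n := \sum_(j < n.+1) u j * v (n - j)%N.

(* The coefficients of [(1 - x) w(x)]. *)
Definition dseq w n := w n - (if n is n'.+1 then w n' else 0).

(* The coefficients of [(1 - x) ^ (- b)]. *)
Definition bseq b n := poch b n / n`!%:R.

Lemma factR_neq0 n : n`!%:R != 0 :> K.
Proof. by rewrite pnatr_eq0 -lt0n fact_gt0. Qed.

Lemma bseq0 b : bseq b 0 = 1.
Proof. by rewrite /bseq poch0 divr1. Qed.

Lemma bseqS b n : n.+1%:R * bseq b n.+1 = (b + n%:R) * bseq b n.
Proof.
rewrite /bseq pochS factS natrM; have := factR_neq0 n.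
have : n.+1%:R != 0 :> K by rewrite pnatr_eq0.
by move=> ? ?; field; rewrite nat1r; apply/andP.
Qed.

(** Both sides are coefficients of (1 - x) w(x) v(x). *)
Lemma conv_dseq w v n : conv (dseq w) v n = conv w (dseq v) n.
Proof.
rewrite /conv /dseq.
transitivity (\sum_(j < n.+1) w j * v (n - j)%N - \sum_(j < n) w j * v (n - j.+1)%N).
  under eq_bigr do rewrite mulrBl; rewrite sumrB; congr (_ - _).
  by rewrite big_ord_recl mul0r add0r.
under [RHS]eq_bigr do rewrite mulrBr; rewrite sumrB; congr (_ - _).
rewrite big_ord_recr /= subnn mulr0 addr0; apply: eq_bigr => j _.
by rewrite subnS; case: (n - j)%N (subn_gt0 j n) => //=; rewrite ltn_ord.
Qed.

Lemma dseq_bseq b : dseq (bseq (b + 1)) =1 bseq b.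
Proof.
case=> [|n]; first by rewrite /dseq !bseq0 subr0.
have n1 : n.+1%:R != 0 :> K by rewrite pnatr_eq0.
apply: (mulfI n1); rewrite /dseq mulrBr bseqS.
rewrite -mulrBl /bseq pochSl factS natrM.
have -> : b + 1 + n%:R - n.+1%:R = b by rewrite -natr1; ring.
by field; rewrite nat1r factR_neq0 n1.
Qed.

Lemma eq_conv u u' v v' : u =1 u' -> v =1 v' -> conv u v =1 conv u' v'.
Proof. by move=> eu ev n; apply: eq_bigr => j _; rewrite eu ev. Qed.

Lemma conv_dseq_bseq w b : conv (dseq w) (bseq (b + 1)) =1 conv w (bseq b).
Proof. by move=> n; rewrite conv_dseq; apply: eq_conv => // k; rewrite dseq_bseq. Qed.

Lemma convD w w' v n : conv (fun j => w j + w' j) v n = conv w v n + conv w' v n.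
Proof. by rewrite /conv -big_split; apply: eq_bigr => j _; rewrite mulrDl. Qed.

Lemma convZ c w v n : conv (fun j => c * w j) v n = c * conv w v n.
Proof. by rewrite /conv mulr_sumr; apply: eq_bigr => j _; rewrite mulrA. Qed.

Lemma conv_inj w w' v : v 0%N != 0 -> conv w v =1 conv w' v -> w =1 w'.
Proof.
move=> v0 e n; elim/ltn_ind: n => n IHn.
move: (e n); rewrite /conv !big_ord_recr /= subnn.
have -> : \sum_(i < n) w i * v (n - i)%N = \sum_(i < n) w' i * v (n - i)%N.
  by apply: eq_bigr => i _; rewrite IHn.
by move/addrI/(mulIf v0).
Qed.

(** Chu-Vandermonde. Splitting n + 1 = j + (n + 1 - j) is the product rule for the derivative; by
    [bseqS] the two parts carry the weights a + j and b + n - j, whose sum does not depend on j. *)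
Lemma bseq_conv a b : conv (bseq a) (bseq b) =1 bseq (a + b).
Proof.
elim=> [|n IHn]; first by rewrite /conv big_ord1 !bseq0 mulr1.
have n1 : n.+1%:R != 0 :> K by rewrite pnatr_eq0.
apply: (mulfI n1); rewrite bseqS -IHn /conv.
transitivity (\sum_(j < n.+2) ((j%:R * bseq a j) * bseq b (n.+1 - j) +
   bseq a j * ((n.+1 - j)%:R * bseq b (n.+1 - j)%N))).
  rewrite mulr_sumr; apply: eq_bigr => j _.
  have -> : n.+1%:R = j%:R + (n.+1 - j)%:R :> K by rewrite -natrD subnKC // -ltnS.
  by ring.
rewrite big_split /=  big_ord_recl mul0r mul0r add0r.
rewrite [X in _ + X]big_ord_recr /= subnn mul0r mulr0 addr0 -big_split /= mulr_sumr.
apply: eq_bigr => j _.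
rewrite /bump /= add1n subSS bseqS subSn -1?ltnS // bseqS natrB -1?ltnS //.
by ring.
Qed.

End Convolution.

(** * Euler's transformation, coefficientwise *)

(** The Pfaff-Saalschütz sum with all denominators cleared, hence valid over any commutative ring.
    It is the case [M = 0] of [euler_transf]. *)
Lemma saalschutz (K : comNzRingType) (x y c : K) n :
  \sum_(j < n.+1) 'C(n, j)%:R * poch x j * poch y j *
     poch (c + j%:R) (n - j) * poch (c - x - y) (n - j)
  = poch (c - x) n * poch (c - y) n.
Proof.
elim: n => [|n IHn].
  by rewrite big_ord1 !poch0 bin0 !mulr1.
set s := c - x - y in IHn *.
pose T j := 'C(n, j)%:R * poch x j * poch y j * poch (c + j%:R) (n - j) * poch s (n - j).
(* Wilf-Zeilberger certificate for the recurrence in [n]. *)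
pose G j := j%:R * (s + n%:R - j%:R) * T j.
rewrite !pochS.
transitivity ((c - x + n%:R) * (c - y + n%:R) * (\sum_(j < n.+1) T j)); last first.
  by rewrite IHn; ring.
(* Pascal's rule splits the sum at n + 1: [A j] carries the part of index j, [B j] the part of index
   j + 1 moved down by one. *)
pose A j := 'C(n, j)%:R * poch x j * poch y j *
     poch (c + j%:R) (n.+1 - j) * poch s (n.+1 - j).
pose B j := 'C(n, j)%:R * poch x j.+1 * poch y j.+1 *
     poch (c + j.+1%:R) (n - j) * poch s (n - j).
transitivity (\sum_(j < n.+1) (A j + B j)).
  rewrite big_split /= big_ord_recl /= [in X in _ = X + _]big_ord_recl /= -addrA; congr (_ + _).
    by rewrite /A !bin0.
  under eq_bigr do rewrite /bump /= add1n binS natrD !mulrDl subSS.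
  rewrite big_split /=; congr (_ + _).
  rewrite big_ord_recr /= bin_small // !mul0r addr0.
  by apply: eq_bigr => i _; rewrite /A /bump /= add1n subSS.
rewrite mulr_sumr; apply/eqP; rewrite -subr_eq0 -sumrB.
have -> : \sum_(i < n.+1) (A i + B i - (c - x + n%:R) * (c - y + n%:R) * T i) =
   \sum_(i < n.+1) (G i.+1 - G i).
  apply: eq_bigr => -[j lejn1] _ /=; have lejn : (j <= n)%N by rewrite -ltnS.
  (* The end j = n is apart, because there [n - j] is not a successor and no factor of the middle
     Pochhammer symbols can be split off. *)
  case: (ltnP j n) => [ltjn|]; last first.
    move=> lenj; have -> : j = n by apply/eqP; rewrite eqn_leq lejn lenj.
    rewrite /G /A /B /T (bin_small (ltnSn n)) subSn // subnn !pochS !poch0 !mul0r mulr0 sub0r.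
    by rewrite /s; ring.
  have [k En] : exists k, n = (j + k.+1)%N by exists (n - j.+1)%N; rewrite addnS -addSn subnKC.
  have Cb : j.+1%:R * 'C(n, j.+1)%:R = (n%:R - j%:R) * 'C(n, j)%:R :> K.
    by rewrite -natrB // -!natrM mul_bin_left.
  rewrite /G /A /B /T [j.+1%:R * _]mulrC -!mulrA [j.+1%:R * _]mulrA Cb.
  have -> : (n.+1 - j = k.+2)%N by rewrite En -addnS addKn.
  have -> : (n - j = k.+1)%N by rewrite En addKn.
  have -> : (n - j.+1 = k)%N by rewrite En addnS -addSn addKn.
  have -> : poch (c + j%:R) k.+2 = (c + j%:R) * poch (c + j.+1%:R) k * (c + n%:R).
    rewrite pochSl pochS -addrA natr1 mulrA En addnS -addSn natrD; ring.
  have -> : poch (c + j%:R) k.+1 = (c + j%:R) * poch (c + j.+1%:R) k.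
    by rewrite pochSl -addrA natr1.
  rewrite !pochS -natr1.
  have -> : c + (j%:R + 1) + k%:R = c + n%:R by rewrite En natrD -natr1; ring.
  have -> : n%:R = j%:R + k%:R + 1 :> K by rewrite En natrD -natr1 addrA.
  rewrite -natr1 /s; ring.
rewrite -(big_mkord xpredT (fun i => G i.+1 - G i)) telescope_sumr //.
by rewrite /G /T bin_small // !mul0r mulr0 subrr.
Qed.

Section Euler.
Variable K : numFieldType.
Implicit Types (A B C Q p be : K).

(** For [M = 0] only i = 0 survives, and with p = - be this is (C - A)_j (C - B)_j / j!, the
    numerator in the classical transformation of Euler. A larger [M] accounts for M further factors
    1 - x. *)
Definition eulerS M p Q A j : K :=
  \sum_(i < j.+1) 'C(M, i)%:R * poch p i *
     (poch (i%:R - Q) (j - i) * poch (A + p + i%:R) (j - i) / (j - i)`!%:R).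

(* After Pascal's rule and [M * 'C(M, i) = i * 'C(M, i) + i.+1 * 'C(M, i.+1)], both
   sides agree termwise. *)
Lemma eulerS_rec M p Q A j :
  eulerS M.+1 (p - 1) (Q + 1) A j.+1 =
  eulerS M p Q A j.+1 - (A + M%:R - Q + j%:R) * eulerS M p Q A j.
Proof.
pose F i := poch (p - 1) i *
  (poch (i%:R - (Q + 1)) (j.+1 - i) * poch (A + (p - 1) + i%:R) (j.+1 - i) /
    (j.+1 - i)`!%:R).
pose X i := poch p i *
  (poch (i%:R - Q) (j - i) * poch (A + p + i%:R) (j - i) / (j - i)`!%:R).
pose Y i := i%:R * poch p i.-1 *
  (poch (i%:R - 1 - Q) (j.+1 - i) * poch (A + p + i%:R - 1) (j.+1 - i) /
    (j.+1 - i)`!%:R).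
pose Z i := poch p i *
  (poch (i%:R - Q) (j.+1 - i) * poch (A + p + i%:R) (j.+1 - i) / (j.+1 - i)`!%:R).
have poch_pred i : poch (p - 1) i = poch p i - i%:R * poch p i.-1.
  case: i => [|i]; first by rewrite !poch0 mul0r subr0.
  by rewrite pochSl subrK pochS -natr1 /=; ring.
have -> : eulerS M.+1 (p - 1) (Q + 1) A j.+1 =
    \sum_(i < j.+2) 'C(M, i)%:R * F i + \sum_(i < j.+1) 'C(M, i)%:R * F i.+1.
  rewrite /eulerS.
  rewrite big_ord_recl [X in _ = X + _]big_ord_recl /= -[RHS]addrA; congr (_ + _).
    by rewrite ?bin0 /F /=; ring.
  under eq_bigr do rewrite /bump /= add1n binS natrD mulrDl mulrDl.
  rewrite big_split /=; congr (_ + _); apply: eq_bigr => i _.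
    by rewrite /F /bump /= add1n [RHS]mulrA.
  by rewrite /F [RHS]mulrA.
have -> : eulerS M p Q A j.+1 = \sum_(i < j.+2) 'C(M, i)%:R *
    Z i.
  by apply: eq_bigr => i _; rewrite /Z [RHS]mulrA.
have -> : (A + M%:R - Q + j%:R) * eulerS M p Q A j =
    \sum_(i < j.+1) 'C(M, i)%:R * ((A + i%:R - Q + j%:R) * X i) +
    \sum_(i < j.+2) 'C(M, i)%:R * Y i.
  rewrite [X in _ = _ + X]big_ord_recl /Y mul0r mul0r mulr0 add0r -big_split mulr_sumr.
  apply: eq_bigr => i _; rewrite /= /bump /= add1n subSS.
  have Mi : M%:R * 'C(M, i)%:R = i%:R * 'C(M, i)%:R + 'C(M, i.+1)%:R * i.+1%:R :> K.
    rewrite -!natrM -natrD; congr (_%:R); rewrite [RHS]addnC [('C(M, i.+1) * _)%N]mulnC.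
    rewrite mul_bin_left -mulnDl.
    by case: (leqP i M) => [?|?]; [rewrite subnK | rewrite bin_small // !muln0].
  rewrite (_ : i.+1%:R - 1 - Q = i%:R - Q); last by rewrite -natr1; ring.
  rewrite (_ : A + p + i.+1%:R - 1 = A + p + i%:R); last by rewrite -natr1; ring.
  transitivity ((A - Q + j%:R) * ('C(M, i)%:R * X i) + (M%:R * 'C(M, i)%:R) * X i).
    by rewrite /X; ring.
  rewrite Mi /X; ring.
have H : \sum_(i < j.+1) 'C(M, i)%:R * F i + \sum_(i < j.+1) 'C(M, i)%:R * F i.+1 =
    \sum_(i < j.+1) 'C(M, i)%:R * Z i -
    (\sum_(i < j.+1) 'C(M, i)%:R * ((A + i%:R - Q + j%:R) * X i) +
     \sum_(i < j.+1) 'C(M, i)%:R * Y i).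
  rewrite -!big_split -sumrB; apply: eq_bigr => i _ /=.
  have [k Ek] : exists k, j = (i + k)%N by exists (j - i)%N; rewrite subnKC // -ltnS.
  move: (nat_of_ord i) Ek => {}i Ek.
  rewrite -mulrDr -mulrDr -mulrBr; congr (_ * _).
  rewrite /F /X /Y /Z.
  have -> : (j.+1 - i = k.+1)%N by rewrite Ek -addnS addKn.
  have -> : (j.+1 - i.+1 = k)%N by rewrite subSS Ek addKn.
  have -> : (j - i = k)%N by rewrite Ek addKn.
  rewrite (_ : i.+1%:R - (Q + 1) = i%:R - Q); last by rewrite -natr1; ring.
  rewrite (_ : A + (p - 1) + i.+1%:R = A + p + i%:R); last by rewrite -natr1; ring.
  have -> : j%:R = i%:R + k%:R :> K by rewrite Ek natrD.
  rewrite !poch_pred /= [poch p i.+1]pochS.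
  rewrite [poch (i%:R - (Q + 1)) _]pochSl [poch (A + (p - 1) + _) _]pochSl.
  rewrite [poch (i%:R - 1 - Q) _]pochSl [poch (A + p + i%:R - 1) _]pochSl.
  rewrite [poch (i%:R - Q) k.+1]pochS [poch (A + p + i%:R) k.+1]pochS.
  rewrite (_ : i%:R - (Q + 1) + 1 = i%:R - Q); last by ring.
  rewrite (_ : i%:R - 1 - Q + 1 = i%:R - Q); last by ring.
  rewrite (_ : A + (p - 1) + i%:R + 1 = A + p + i%:R); last by ring.
  rewrite (_ : A + p + i%:R - 1 + 1 = A + p + i%:R); last by ring.
  rewrite factS natrM -natr1.
  have k1 : k%:R + 1 != 0 :> K by rewrite natr1 pnatr_eq0.
  by field; rewrite factR_neq0 k1.
rewrite big_ord_recr [X in _ = X - _]big_ord_recr [X in _ = _ - (_ + X)]big_ord_recr /=.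
rewrite addrAC H.
have Hb : F j.+1 = Z j.+1 - Y j.+1.
  by rewrite /F /Y /Z subnn poch_pred /= !poch0; ring.
rewrite Hb; ring.
Qed.

Definition euler_coef M Q A C be j : K := (poch C j)^-1 * eulerS M (- be) Q A j.

(* Coefficientwise, Euler's transformation
   [2F1(A, B; C; x) = (1 - x)^(- be) w(x)] with [be = C - A + B - M]. *)
Lemma euler_transf M A B C Q be :
    (forall n, poch C n != 0) -> C = A + M%:R - Q -> be = B + Q ->
  conv (euler_coef M Q A C be) (bseq be) =1
    (fun n => poch A n * poch B n / (poch C n * n`!%:R)).
Proof.
(* Raising [M] and [Q] together keeps C and raises be by one, so the induction step multiplies the
   transformed series by 1 - x, which is [eulerS_rec]. The base case is Saalschütz's sum. *)
move=> C0; elim: M Q be => [|M IHM] Q be defC defbe n; last first.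
  have defbe1 : be - 1 = B + (Q - 1) by rewrite defbe; ring.
  have defC1 : C = A + M%:R - (Q - 1) by rewrite defC -natr1; ring.
  have := conv_dseq_bseq (euler_coef M (Q - 1) A C (be - 1)) (be - 1) n.
  rewrite subrK -(IHM _ _ defC1 defbe1 n) => <-; apply: eq_conv => // -[|j].
    rewrite /dseq /euler_coef /eulerS subr0 !big_ord1 !bin0 /=.
    by rewrite !poch0.
  rewrite /dseq /euler_coef.
  have -> : - be = - (be - 1) - 1 by ring.
  rewrite -{1}[Q](subrK 1) eulerS_rec mulrBr; congr (_ - _).
  rewrite pochS -defC1; have := C0 j; have := C0 j.+1; rewrite pochS mulf_eq0 negb_or.
  by move=> /andP[? ?] _; field; apply/andP.
have e1 : A = C - (- Q) by rewrite defC; ring.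
have e2 : B = C - (A - be) by rewrite defC defbe; ring.
have := saalschutz (- Q) (A - be) C n.
rewrite -e1 -e2.
have -> : A - (A - be) = be by ring.
move=> Hs; rewrite -Hs mulr_suml; apply: eq_bigr => -[j ltj] _ /=.
have lejn : (j <= n)%N by rewrite -ltnS.
rewrite /euler_coef /eulerS big_ord_recl.
rewrite big1 => [|i _]; last by rewrite /bump /= ?bin_small // !mul0r.
rewrite bin0 poch0 subn0 /= add0r addr0 /bseq.
have -> : n`!%:R = 'C(n, j)%:R * (j`!%:R * (n - j)`!%:R) :> K.
  by rewrite -!natrM bin_fact.
have -> : poch C n = poch C j * poch (C + j%:R) (n - j) by rewrite -pochD subnKC.
have := C0 n; rewrite -{1}(subnKC lejn) pochD mulf_eq0 negb_or => /andP[? ?].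
have ? : 'C(n, j)%:R != 0 :> K by rewrite pnatr_eq0 -lt0n bin_gt0.
have := factR_neq0 K j; have := factR_neq0 K (n - j) => ? ?.
rewrite (_ : A + - be + 0 = A - be); last by ring.
field; do ?[apply/andP; split => //].
Qed.
End Euler.

(** * Limits and series in R[i] *)

Section ComplexLimits.
Variable R : realType.
Local Notation C := (R[i] : numFieldType).
Local Notation normc := (@Normc.normc R).
Implicit Types (u w : nat -> C) (v : nat -> R) (z l : C) (p s : R).
Local Open Scope classical_set_scope.
Local Open Scope complex_scope.

Lemma normcE z : `|z| = (normc z)%:C. Proof. by []. Qed.

Lemma normc_ge0 z : 0 <= normc z.
Proof. by case: z => a b; exact: sqrtr_ge0. Qed.

Lemma normcB z l : normc (z - l) = normc (l - z).
Proof. by apply: complexI; rewrite -!normcE distrC. Qed.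

Lemma normc_triangle z l : normc (z + l) <= normc z + normc l.
Proof. by rewrite -lecR rmorphD -!normcE ler_normD. Qed.

Lemma normc_real (x : R) : normc x%:C = `|x|.
Proof. by rewrite /Normc.normc /= expr0n addr0 sqrtr_sqr. Qed.

Lemma normc_nat n : normc n%:R = n%:R.
Proof. by rewrite -(rmorph_nat (real_complex R)) normc_real normr_nat. Qed.

Lemma normc_Re z : `|complex.Re z| <= normc z.
Proof.
case: z => a b /=; rewrite -sqrtr_sqr ler_wsqrtr // lerDl; exact: sqr_ge0.
Qed.

Lemma normc_Im z : `|complex.Im z| <= normc z.
Proof.
case: z => a b /=; rewrite -sqrtr_sqr ler_wsqrtr // lerDr; exact: sqr_ge0.
Qed.

Lemma normc_le_ReIm z : normc z <= `|complex.Re z| + `|complex.Im z|.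
Proof.
have {1}-> : z = (complex.Re z)%:C + (0 +i* complex.Im z).
  by case: z => a b; rewrite /GRing.add /= addr0 add0r.
apply: le_trans (normc_triangle _ _) _; rewrite normc_real lerD2l.
by rewrite /= expr0n add0r sqrtr_sqr.
Qed.

Lemma normc_sum (I : Type) (r : seq I) (F : I -> C) :
  normc (\sum_(i <- r) F i) <= \sum_(i <- r) normc (F i).
Proof.
elim/big_ind2 : _ => //; first by rewrite Normc.normc0.
by move=> z1 x1 z2 x2 h1 h2; apply: le_trans (normc_triangle _ _) (lerD h1 h2).
Qed.

(** Radii of balls in R[i] are themselves complex, and 0 < e forces e to be real. This passage to
    real norms makes real analysis applicable. *)
Lemma cvgC_normcP u l :
  u @ \oo --> l <-> (fun n => normc (u n - l)) @ \oo --> (0 : R).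
Proof.
split=> [/cvgrPdist_le ul|/cvgr0Pnorm_le ul].
  apply/cvgr0Pnorm_le => e e0.
  have ec : 0 < e%:C :> C by rewrite ltcR.
  apply: filterS (ul _ ec) => n; rewrite distrC normcE lecR.
  by rewrite ger0_norm // normc_ge0.
apply/cvgrPdist_le => -[e e']; rewrite ltcE /= => /andP[/eqP-> e0].
apply: filterS (ul _ e0) => n; rewrite ger0_norm ?normc_ge0 // => h.
by rewrite distrC normcE lecE /= eqxx.
Qed.

Lemma cvgC_le u l v :
  (forall n, normc (u n - l) <= v n) -> v @ \oo --> (0 : R) -> u @ \oo --> l.
Proof.
move=> uv v0; apply/cvgC_normcP; apply: (@squeeze_cvgr _ _ _ _ (fun=> 0) v) => //.
  by apply: nearW => n; rewrite normc_ge0 uv.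
exact: cvg_cst.
Qed.

Lemma cvgC_unique u l l' : u @ \oo --> l -> u @ \oo --> l' -> l = l'.
Proof. by apply: cvg_unique; exact: norm_hausdorff. Qed.

Lemma cvgC_lim u l : u @ \oo --> l -> limn u = l.
Proof. by apply: cvg_lim; exact: norm_hausdorff. Qed.

Lemma normc_lim_le u l p : (forall n, normc (u n) <= p) -> u @ \oo --> l ->
  normc l <= p.
Proof.
move=> up /cvgC_normcP ul; apply/ler_addgt0Pr => e e0.
have /cvgr0Pnorm_le /(_ e e0) [N _ HN] := ul.
have := HN N (leqnn N); rewrite ger0_norm ?normc_ge0 // => h.
have -> : l = u N - (u N - l) by rewrite subKr.
apply: le_trans (normc_triangle _ _) (lerD (up N) _).
by rewrite -[- _]sub0r normcB subr0.
Qed.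

Lemma cvgC_cst l : (fun=> l : C) @ \oo --> l.
Proof. exact: cvg_cst. Qed.

Lemma cvgCD u w l l' : u @ \oo --> l -> w @ \oo --> l' ->
  (fun n => u n + w n) @ \oo --> (l + l').
Proof. exact: (@cvgD C C nat \oo _ u w). Qed.

Lemma cvgCB u w l l' : u @ \oo --> l -> w @ \oo --> l' ->
  (fun n => u n - w n) @ \oo --> (l - l').
Proof. exact: (@cvgB C C nat \oo _ u w). Qed.

Lemma cvgCM u w l l' : u @ \oo --> l -> w @ \oo --> l' ->
  (fun n => u n * w n) @ \oo --> (l * l').
Proof. exact: (@cvgM C nat \oo _ u w). Qed.

Lemma cvgCV u l : l != 0 -> u @ \oo --> l -> (fun n => (u n)^-1) @ \oo --> l^-1.
Proof. exact: (@cvgV C nat \oo _ u). Qed.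

Arguments cvgC_cst l : clear implicits.
Arguments cvgCD [u w l l'] _ _.
Arguments cvgCB [u w l l'] _ _.
Arguments cvgCM [u w l l'] _ _.
Arguments cvgCV [u l] _ _.

Definition abs_summable u := cvgn (series (fun n => normc (u n))).

Lemma series_ReIm u n :
  series u n = (series (fun k => complex.Re (u k)) n) +i* (series (fun k => complex.Im (u k)) n).
Proof.
elim: n => [|n IHn]; first by rewrite /series /= !big_nil.
rewrite /series /= !big_nat_recr //= -![\sum_(0 <= _ < n) _]/(series _ n) IHn.
by case: (u n).
Qed.

(** The real and imaginary parts are dominated by the norm, so completeness of the reals is
    enough. *)
Lemma abs_summable_cvg u : abs_summable u -> exists l, series u @ \oo --> l.
Proof.
move=> su.
have cvgpart (f : C -> R) : (forall z, `|f z| <= normc z) ->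
    cvgn (series (fun k => f (u k))).
  move=> fle.
  apply: normed_cvg; apply: series_le_cvg su => n //=.
    by rewrite normc_ge0.
have /cvg_ex[a ca] := cvgpart _ normc_Re.
have /cvg_ex[b cb] := cvgpart _ normc_Im.
exists (a +i* b).
apply: (@cvgC_le _ _ (fun n => `|series (fun k => complex.Re (u k)) n - a| +
   `|series (fun k => complex.Im (u k)) n - b|)) => [n|].
  by rewrite series_ReIm; apply: le_trans (normc_le_ReIm _) _.
have cvgpart0 (f : nat -> R) c : f @ \oo --> c -> (fun n => `|f n - c|) @ \oo --> (0 : R).
  by move=> fc; rewrite -(normr0 R) -(subrr c); apply: cvg_norm; apply: cvgB => //; exact: cvg_cst.
by rewrite -[0 : R]addr0; apply: cvgD; exact: cvgpart0.
Qed.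

Lemma abs_summable_le u v :
  (forall n, normc (u n) <= v n) -> cvgn (series v) -> abs_summable u.
Proof.
move=> uv; apply: series_le_cvg => // n; first exact: normc_ge0.
by apply: le_trans (uv n); exact: normc_ge0.
Qed.

Lemma normc_series_le u v l t : (forall n, normc (u n) <= v n) ->
  series u @ \oo --> l -> series v @ \oo --> t -> normc l <= t.
Proof.
move=> uv ul vt; apply: normc_lim_le ul => n.
apply: le_trans (normc_sum _ _) _.
have v0 k : 0 <= v k by apply: le_trans (uv k); exact: normc_ge0.
have -> : t = limn (series v) by apply/esym/cvg_lim.
apply: le_trans (nondecreasing_cvgn_le _ _ n).
- by rewrite /series /=; apply: ler_sum => k _; exact: uv.
- exact: nondecreasing_series.
- by apply/cvg_ex; exists t.
Qed.

Lemma cvg_bounded u l : u @ \oo --> l -> exists M : R, forall n, normc (u n) <= M.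
Proof.
move=> ul; have cu : cvgn u by apply/cvg_ex; exists l.
have [M [Mr HM]] := cvg_seq_bounded cu.
have M1 : M < M + 1 by rewrite ltrDl ltr01.
exists (complex.Re (M + 1)) => n; have := HM _ M1 n I.
by rewrite /= normcE lecE /= => /andP[].
Qed.

(** The source of the recurrences between infinite sums below: a certificate [u] tending to 0 turns
    a termwise identity into a relation between sums, with inhomogeneity [u 0]. *)
Lemma series_telescope u l : u @ \oo --> l ->
  series (fun n => u n - u n.+1) @ \oo --> (u 0%N - l).
Proof.
move=> ul; have -> : series (fun n => u n - u n.+1) = fun n => u 0%N - u n.
  apply/funext => n; rewrite /series /=.
  under eq_bigr do rewrite -opprB.
  by rewrite sumrN telescope_sumr // opprB.
exact: (cvgCB (cvgC_cst _) ul).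
Qed.

Lemma cvg_seriesD u w l l' : series u @ \oo --> l -> series w @ \oo --> l' ->
  series (fun n => u n + w n) @ \oo --> (l + l').
Proof.
move=> ul wl; have -> : series (fun n => u n + w n) = (series u \+ series w).
  by apply/funext => n; rewrite /series /= big_split.
exact: (cvgCD ul wl).
Qed.

Lemma cvg_seriesZ z u l : series u @ \oo --> l ->
  series (fun n => z * u n) @ \oo --> (z * l).
Proof.
move=> ul; have -> : series (fun n => z * u n) = (fun n => z * series u n).
  by apply/funext => n; rewrite /series /= mulr_sumr.
exact: (cvgCM (cvgC_cst z) ul).
Qed.

Lemma cvg_series_shift u l n : series u @ \oo --> l ->
  series (fun k => u (n + k)%N) @ \oo --> (l - \sum_(0 <= k < n) u k).
Proof.
move=> ul.
have -> : series (fun k => u (n + k)%N) =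
    (fun k => series u (k + n)%N - \sum_(0 <= k < n) u k).
  apply/funext => k; rewrite /series /= [X in _ = X - _](@big_cat_nat _ _ _ n) ?leq_addl //=.
  rewrite [RHS]addrAC subrr add0r -{2}[n]add0n big_addn addnK.
  by apply: eq_bigr => j _; rewrite addnC.
apply: cvgCB (cvgC_cst _).
by rewrite (cvg_shiftn n (series u)).
Qed.

Lemma cvg_series_finite u N : (forall n, (N <= n)%N -> u n = 0) ->
  series u @ \oo --> (\sum_(0 <= k < N) u k).
Proof.
move=> u0; rewrite -(cvg_shiftn N).
have -> : (fun n => series u (n + N)%N) = (fun=> \sum_(0 <= k < N) u k).
  apply/funext => k; rewrite /series /= (@big_cat_nat _ _ _ N) ?leq_addl //=.
  by rewrite [X in _ + X]big_nat_cond [X in _ + X]big1 ?addr0 // => i /andP[/andP[/u0]].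
exact: cvgC_cst.
Qed.

End ComplexLimits.
Arguments cvgC_cst {R} l.
Arguments cvgCD {R} [u w l l'] _ _.
Arguments cvgCB {R} [u w l l'] _ _.
Arguments cvgCM {R} [u w l l'] _ _.
Arguments cvgCV {R} [u l] _ _.

(** * Power bounds for the growth of sequences *)

Section PowerBounds.
Variable R : realType.
Local Notation C := (R[i] : numFieldType).
Local Notation normc := (@Normc.normc R).
Implicit Types (u w : nat -> C) (v : nat -> R) (z l : C) (p s : R).
Local Open Scope classical_set_scope.
Local Open Scope complex_scope.

(** This is u_n = O(n^p). The base n + 1 keeps the power positive at n = 0, so the bound can be
    asked for every n and not only eventually. *)
Definition pbound u p := exists M : R, forall n, normc (u n) <= M * n.+1%:R `^ p.

Lemma powRS_gt0 n p : 0 < n.+1%:R `^ p :> R.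
Proof. by apply: powR_gt0; rewrite ltr0n. Qed.

Lemma powRSD n p s : n.+1%:R `^ (p + s) = n.+1%:R `^ p * n.+1%:R `^ s :> R.
Proof. by rewrite powRD // pnatr_eq0 implybT. Qed.

Lemma eq_pbound u w p : u =1 w -> pbound u p -> pbound w p.
Proof. by move=> e [M h]; exists M => n; rewrite -e. Qed.

Lemma pboundM u w p s : pbound u p -> pbound w s ->
  pbound (fun n => u n * w n) (p + s).
Proof.
move=> [M hM] [N hN]; exists (M * N) => n.
rewrite Normc.normcM powRSD mulrACA; apply: ler_pM => //; exact: normc_ge0.
Qed.

Lemma pboundMl u z p : pbound u p -> pbound (fun n => z * u n) p.
Proof.
move=> [M hM]; exists (normc z * M) => n.
by rewrite Normc.normcM -mulrA ler_wpM2l // normc_ge0.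
Qed.

Lemma pboundD u w p : pbound u p -> pbound w p -> pbound (fun n => u n + w n) p.
Proof.
move=> [M hM] [N hN]; exists (M + N) => n.
by apply: le_trans (normc_triangle _ _) _; rewrite mulrDl lerD.
Qed.

Lemma pbound_le u p s : p <= s -> pbound u p -> pbound u s.
Proof.
move=> ps [M hM]; exists M => n; apply: le_trans (hM n) _.
apply: ler_wpM2l; last by apply: ler_powR => //; rewrite ler1n.
rewrite -(pmulr_lge0 _ (powRS_gt0 0 p)).
by apply: le_trans (hM 0%N); exact: normc_ge0.
Qed.

(** An eventual bound suffices, since the ratios of the finitely many earlier terms can be added to
    the constant. *)
Lemma pbound_near u p N M :
  (forall n, (N <= n)%N -> normc (u n) <= M * n.+1%:R `^ p) -> pbound u p.
Proof.
move=> hM; exists (`|M| + \sum_(k < N) normc (u k) / k.+1%:R `^ p) => n.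
have h0 : 0 <= \sum_(k < N) normc (u k) / k.+1%:R `^ p.
  by apply: sumr_ge0 => k _; rewrite divr_ge0 ?normc_ge0 // ltW // powRS_gt0.
case: (leqP N n) => [/hM h|ltnN].
  apply: le_trans h _; apply: ler_wpM2r; first by rewrite ltW // powRS_gt0.
  by apply: le_trans (ler_norm _) _; rewrite lerDl.
rewrite -ler_pdivrMr ?powRS_gt0 // (bigD1 (Ordinal ltnN)) //= addrCA lerDl.
apply: addr_ge0; first exact: normr_ge0.
by apply: sumr_ge0 => k _; rewrite divr_ge0 ?normc_ge0 // ltW // powRS_gt0.
Qed.

Lemma pbound_finite u p N : (forall n, (N <= n)%N -> u n = 0) -> pbound u p.
Proof.
move=> u0; apply: (@pbound_near _ _ N 0) => n /u0 ->.
by rewrite Normc.normc0 mul0r.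
Qed.

Lemma pbound_cvg u l : u @ \oo --> l -> pbound u 0.
Proof.
by move=> /cvg_bounded[M hM]; exists M => n; rewrite powRr0 mulr1.
Qed.

(** Allows the index of a bound to be shifted. For p >= 0 it rests on n0 + n + 1 <= (n0 + 1)(n + 1),
    for p < 0 on n + 1 <= n0 + n + 1. *)
Lemma pbound_pow n0 p : pbound (fun n => ((n0 + n.+1)%N%:R `^ p)%:C) p.
Proof.
exists (n0.+1%:R `^ `|p|) => n; rewrite normc_real.
have n1 : 0 < n.+1%:R :> R by rewrite ltr0n.
have nn : 0 < (n0 + n.+1)%N%:R :> R by rewrite ltr0n addnS.
rewrite ger0_norm ?powR_ge0 //.
case: (lerP 0 p) => p0.
  rewrite (ger0_norm p0) -powRM //; apply: ge0_ler_powR; rewrite ?nnegrE ?mulr_ge0 //.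
  by rewrite -natrM ler_nat mulSn mulnS; lia.
have le1 : 1 <= n0.+1%:R `^ `|p| :> R.
  by rewrite -[X in X <= _](powRr0 n0.+1%:R); apply: ler_powR => //; rewrite ler1n.
have le2 : (n0 + n.+1)%N%:R `^ p <= n.+1%:R `^ p :> R.
  rewrite -[p]opprK [X in X <= _]powRN [X in _ <= X]powRN lef_pV2 ?posrE ?powR_gt0 //.
  apply: ge0_ler_powR; rewrite ?nnegrE ?oppr_ge0 //; first exact: ltW.
  by rewrite ler_nat leq_addl.
by rewrite -[X in X <= _]mul1r; apply: ler_pM => //; exact: powR_ge0.
Qed.

Lemma pbound_shift u p : pbound u p -> pbound (fun n => u n.+1) p.
Proof.
move=> [M hM]; have [N hN] := pbound_pow 1 p; exists (M * N) => n.
have M0 : 0 <= M.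
  rewrite -(pmulr_lge0 _ (powRS_gt0 0 p)).
  by apply: le_trans (hM 0%N); exact: normc_ge0.
apply: le_trans (hM n.+1) _; rewrite -mulrA ler_wpM2l //.
apply: le_trans (hN n); rewrite normc_real; exact: ler_norm.
Qed.

Lemma pbound_unshift u p : pbound (fun n => u n.+1) p -> pbound u p.
Proof.
move=> [M hM].
have M0 : 0 <= M.
  rewrite -(pmulr_lge0 _ (powRS_gt0 0 p)).
  by apply: le_trans (hM 0%N); exact: normc_ge0.
have [N hN] := pbound_pow 1 (- p).
apply: (@pbound_near _ _ 1%N (M * N)) => -[|n] // _.
apply: le_trans (hM n) _; rewrite -mulrA ler_wpM2l //.
have := hN n; rewrite normc_real ger0_norm ?powR_ge0 // !powRN add1n.
rewrite ler_pdivlMr ?powRS_gt0 // mulrC ler_pdivrMr ?powRS_gt0 //.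
Qed.

Lemma ln1Dx_ge (x : R) : 0 <= x -> x / (1 + x) <= ln (1 + x).
Proof.
move=> x0; have x1 : 0 < 1 + x by rewrite ltr_pwDl.
have xx : x / (1 + x) = 1 - (1 + x)^-1 by field; rewrite gt_eqF.
have := @le_ln1Dx R ((1 + x)^-1 - 1).
rewrite (_ : 1 + ((1 + x)^-1 - 1) = (1 + x)^-1); last by rewrite addrC subrK.
rewrite lnV ?posrE // xx lerNl opprB; apply.
by rewrite ltrBrDr addNr invr_gt0.
Qed.

Lemma cvg_riemann p : p < -1 -> cvgn (series (fun n => n.+1%:R `^ p : R)).
Proof.
move=> p1; pose d := - p - 1; have d0 : 0 < d by rewrite /d; lra.
pose f n : R := n.+1%:R `^ (- d).
(* A telescoping majorant in place of an integral. After division by (n + 2)^(- d) it says (1 + 1 /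
   (n + 1))^d >= 1 + d / (n + 2), which follows from exp(y) >= 1 + y and ln(1 + x) >= x / (1 +
   x). *)
have ineq n : d * n.+2%:R `^ p <= f n - f n.+1.
  rewrite /f (_ : p = - d - 1); last by rewrite /d; ring.
  rewrite powRSD powR_inv1 //.
  have n1 : 0 < n.+1%:R :> R by rewrite ltr0n.
  have n2 : 0 < n.+2%:R :> R by rewrite ltr0n.
  have -> : n.+1%:R `^ (- d) = n.+2%:R `^ (- d) * (n.+2%:R / n.+1%:R) `^ d.
    rewrite powRM ?invr_ge0 // ?ltW // mulrA -powRSD addNr powRr0 mul1r.
    by rewrite -powR_inv1 ?ltW // -powRrM mulN1r.
  rewrite mulrCA -{3}[n.+2%:R `^ (- d)]mulr1 -mulrBr ler_wpM2l ?powR_ge0 //.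
  rewrite lerBrDl /powR gt_eqF ?divr_gt0 //.
  apply: le_trans (expR_ge1Dx _); rewrite lerD2l ler_wpM2l ?(ltW d0) //.
  have -> : n.+2%:R / n.+1%:R = 1 + n.+1%:R^-1 :> R.
    by rewrite -natr1 mulrDl divff ?gt_eqF // mul1r.
  have i1 : 0 <= n.+1%:R^-1 :> R by rewrite invr_ge0 ltW.
  apply: le_trans (ln1Dx_ge i1).
  have -> : 1 + n.+1%:R^-1 = n.+2%:R / n.+1%:R :> R.
    by rewrite -[n.+2%:R]natr1 mulrDl divff ?gt_eqF // mul1r.
  by rewrite invfM invrK mulrCA mulVf ?gt_eqF // mulr1.
have h0 n : 0 <= n.+1%:R `^ p :> R by exact: powR_ge0.
apply: nondecreasing_is_cvgn.
  exact: nondecreasing_series.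
exists (1 + d^-1) => _ [n _ <-].
case: n => [|n].
  by rewrite /series /= big_nil addr_ge0 // invr_ge0 ltW.
rewrite /series /= big_nat_recl // powR1 lerD2l -(ler_pM2l d0) divff ?gt_eqF //.
rewrite mulr_sumr; apply: (@le_trans _ _ (\sum_(0 <= i < n) (f i - f i.+1))).
  by apply: ler_sum => i _; exact: ineq.
under eq_bigr do rewrite -opprB.
rewrite sumrN telescope_sumr // opprB /f powR1 lerBlDl lerDr.
exact: powR_ge0.
Qed.

Lemma pbound_summable u p : p < -1 -> pbound u p -> abs_summable u.
Proof.
move=> p1 [M hM]; apply: (abs_summable_le hM).
have -> : (fun n => M * n.+1%:R `^ p) = M *: (fun n => n.+1%:R `^ p : R).
  by apply/funext.
by apply: is_cvg_seriesZ; exact: cvg_riemann.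
Qed.

Lemma pbound_cvg0 u p : p < 0 -> pbound u p -> u @ \oo --> (0 : C).
Proof.
move=> p0 [M hM]; apply: (@cvgC_le _ _ _ (fun n => M * n.+1%:R `^ p)).
  by move=> n; rewrite subr0.
rewrite -(mulr0 M); apply: cvgMl_tmp.
apply/cvgr0Pnorm_le => e e0.
(* As p < 0, n + 1 >= t = e^(1 / p) gives (n + 1)^p <= e. *)
pose t := e `^ (p^-1); have t0 : 0 < t by exact: powR_gt0.
have Et : e = t `^ p by rewrite -powRrM mulVf ?lt_eqF // powRr1 // ltW.
exists (Num.truncn t).+1 => // n /= hn.
have tn : t <= n.+1%:R.
  by apply: ltW; rewrite -truncn_lt_nat ?(ltW t0) //; lia.
rewrite ger0_norm ?powR_ge0 // Et -[p]opprK [X in X <= _]powRN [X in _ <= X]powRN.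
rewrite lef_pV2 ?posrE ?powR_gt0 //; apply: ge0_ler_powR; rewrite ?nnegrE ?oppr_ge0 //.
  exact: ltW.
exact: ltW.
Qed.

End PowerBounds.

(** * The Gamma function *)

Section TaylorBounds.
Variable R : realType.
Implicit Types u v x : R.
Local Open Scope classical_set_scope.

Lemma sin_le_norm v : `|sin v| <= `|v|.
Proof.
wlog v0 : v / 0 < v => [hw|].
  have [/hw //|v0|<-] := ltrgtP 0 v; last by rewrite sin0 normr0.
  by rewrite -normrN -sinN -[X in _ <= X]normrN hw // oppr_gt0.
have [c _] := @MVT R sin cos 0 v v0 (fun x _ => is_derive_sin x)
  (continuous_subspaceT (@continuous_sin R)).
rewrite sin0 !subr0 => ->; rewrite normrM ler_piMl //; exact: cos_max.
Qed.

Lemma cos_sub1 v : 1 - cos v = 2 * sin (v / 2) ^+ 2.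
Proof.
have {1}-> : v = (v / 2) *+ 2 by rewrite -mulr_natr divfK.
by rewrite cos_mulr2n cos2sin2; ring.
Qed.

Lemma cos_sub1_le v : `|1 - cos v| <= v ^+ 2.
Proof.
rewrite cos_sub1 ger0_norm; last by rewrite mulr_ge0 // sqr_ge0.
have : sin (v / 2) ^+ 2 <= (v / 2) ^+ 2.
  rewrite -(real_normK (num_real (sin _))) -(real_normK (num_real (v / 2))).
  by apply: lerXn2r; rewrite ?nnegrE // sin_le_norm.
have := sqr_ge0 v; nra.
Qed.

(** For v > 0 the mean value theorem gives sin v - v = - (1 - cos c) v with 0 < c < v, and 1 - cos c
    = 2 sin(c / 2)^2 <= 2 |sin(c / 2)| <= c. *)
Lemma sin_sub_le v : `|sin v - v| <= v ^+ 2.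
Proof.
wlog v0 : v / 0 < v => [hw|].
  have [/hw //|v0|<-] := ltrgtP 0 v; last by rewrite sin0 subrr normr0 expr0n.
  rewrite -normrN opprB addrC -sinN -sqrrN -[X in sin _ + X]opprK hw //.
  by rewrite oppr_gt0.
have [c + Hc] := @MVT R sin cos 0 v v0 (fun x _ => is_derive_sin x)
  (continuous_subspaceT (@continuous_sin R)).
rewrite in_itv /= => /andP[c0 cv].
have -> : sin v - v = - ((1 - cos c) * v).
  by move: Hc; rewrite sin0 !subr0 => ->; ring.
rewrite normrN normrM expr2 (gtr0_norm v0) ler_wpM2r ?(ltW v0) //.
rewrite cos_sub1 ger0_norm; last by rewrite mulr_ge0 // sqr_ge0.
have := sin_le_norm (c / 2); rewrite [X in _ <= X]ger0_norm; last by lra.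
have := sin_max (c / 2); have := normr_ge0 (sin (c / 2)).
have -> : sin (c / 2) ^+ 2 = `|sin (c / 2)| ^+ 2 by rewrite real_normK // num_real.
nra.
Qed.

Lemma expR_le_norm u : expR u <= expR `|u|.
Proof. by rewrite ler_expR ler_norm. Qed.

Lemma expR_ge1_norm u : 1 <= expR `|u|.
Proof. by apply: le_trans (expR_ge1Dx _); rewrite lerDl. Qed.

Lemma expR_sub1_le u : `|expR u - 1| <= `|u| * expR `|u|.
Proof.
have h1 := expR_ge1Dx u; have h2 := expR_ge1Dx (- u).
have h3 := expRxMexpNx_1 u; have h4 := expR_gt0 u; have h5 := expR_ge1_norm u.
have h6 := expR_le_norm u.
have h7 : expR u - 1 <= u * expR u.
  have : expR u * (1 - u) <= 1 by rewrite -[X in _ <= X]h3 ler_wpM2l // ltW.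
  nra.
rewrite ler_norml; apply/andP; split; case: (lerP 0 u) => u0.
- rewrite ger0_norm //; nra.
- rewrite ltr0_norm // in h5 *; nra.
- by rewrite ger0_norm // in h5 *.
- rewrite ltr0_norm // in h5 *; nra.
Qed.

Lemma expR_taylor u : `|expR u - 1 - u| <= u ^+ 2 * expR `|u|.
Proof.
have h1 := expR_ge1Dx u; have h2 := expR_ge1Dx (- u).
have h3 := expRxMexpNx_1 u; have h4 := expR_gt0 u.
have h7 : expR u - 1 <= u * expR u.
  have : expR u * (1 - u) <= 1 by rewrite -[X in _ <= X]h3 ler_wpM2l // ltW.
  nra.
rewrite ger0_norm; last by lra.
apply: (@le_trans _ _ (u * (expR u - 1))); first by lra.
apply: le_trans (ler_norm _) _; rewrite normrM -[u ^+ 2]ger0_norm ?sqr_ge0 //.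
by rewrite normrX expr2 -mulrA ler_wpM2l // expR_sub1_le.
Qed.

End TaylorBounds.

Section Gamma.
Variable R : realType.
Local Notation C := (R[i] : numFieldType).
Local Notation normc := (@Normc.normc R).
Implicit Types (u w : nat -> C) (z l : C).
Local Open Scope classical_set_scope.
Local Open Scope complex_scope.

Lemma complex_mulE (a b c d : R) :
  (a +i* b) * (c +i* d) = (a * c - b * d) +i* (a * d + b * c).
Proof. by []. Qed.

Lemma normc_rpowC (x : R) z : normc (rpowC x z) = x `^ complex.Re z.
Proof.
rewrite /Normc.normc /rpowC !exprMn -mulrDr cos2Dsin2 mulr1 sqrtr_sqr.
by rewrite ger0_norm // powR_ge0.
Qed.

Lemma rpowCD (x : R) z l : 0 < x -> rpowC x (z + l) = rpowC x z * rpowC x l.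
Proof.
move=> x0; case: z l => [a b] [c d]; rewrite /rpowC /=.
have h : (a + c == 0) ==> (x != 0) by rewrite (gt_eqF x0) implybT.
rewrite (powRD h) mulrDl cosD sinD.
by rewrite complex_mulE; congr Complex; ring.
Qed.

Lemma rpowCM (x y : R) z : 0 < x -> 0 < y ->
  rpowC (x * y) z = rpowC x z * rpowC y z.
Proof.
move=> x0 y0; case: z => [a b]; rewrite /rpowC /=.
rewrite powRM ?ltW // lnM ?posrE // mulrDr cosD sinD.
by rewrite complex_mulE; congr Complex; ring.
Qed.

Lemma rpowC1 (x : R) : 0 < x -> rpowC x 1 = x%:C.
Proof. by move=> x0; rewrite /rpowC /= mul0r cos0 sin0 mulr0 mulr1 powRr1 // ltW. Qed.

Lemma rpowC0 (x : R) : rpowC x 0 = 1.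
Proof. by rewrite /rpowC /= mul0r cos0 sin0 mulr0 mulr1 powRr0. Qed.

Lemma rpowC_neq0 (x : R) z : 0 < x -> rpowC x z != 0.
Proof.
move=> x0; apply: contraTneq (powR_gt0 (complex.Re z) x0) => h.
by rewrite -normc_rpowC h Normc.normc0 ltxx.
Qed.

(** With x = 1 / (n + 1), the error of order x^2 makes consecutive terms of the Gamma limit differ
    by a factor 1 + O(n^(-2)). *)
Lemma rpowC_taylor z : exists M : R, forall x : R, 0 <= x <= 1 ->
  normc (rpowC (1 + x) z - (1 + z * x%:C)) <= M * x ^+ 2.
Proof.
case: z => [a b]; pose E := expR `|a|.
exists (E * (b ^+ 2 + a ^+ 2 + b ^+ 2 + `|b| * `|a|) + `|a| + `|b|) => x /andP[x0 x1].
have x1p : 0 < 1 + x by rewrite ltr_pwDl.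
pose L := ln (1 + x).
have Lx : L <= x by apply: le_ln1Dx; rewrite (lt_le_trans _ x0) // oppr_lt0.
have L0 : 0 <= L by apply: ln_ge0; rewrite lerDl.
have Lge : x - L <= x ^+ 2.
  have := ln1Dx_ge x0; rewrite -/L.
  have -> : x / (1 + x) = x - x ^+ 2 / (1 + x) by field; rewrite gt_eqF.
  have : x ^+ 2 / (1 + x) <= x ^+ 2.
    by rewrite ler_pdivrMr // ler_peMr ?sqr_ge0 // lerDl.
  lra.
have L2 : L ^+ 2 <= x ^+ 2 by apply: lerXn2r.
have EL (c : R) : `|c| <= `|a| -> expR `|c * L| <= E.
  move=> ca; rewrite ler_expR normrM (ger0_norm L0).
  by apply: le_trans ca; rewrite ler_piMr // (le_trans Lx).
have E1 : 0 < E by exact: expR_gt0.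
apply: le_trans (normc_le_ReIm _) _.
have -> : rpowC (1 + x) (a +i* b) - (1 + (a +i* b) * x%:C) =
  (expR (a * L) * cos (b * L) - (1 + a * x)) +i* (expR (a * L) * sin (b * L) - b * x).
  rewrite /rpowC /powR gt_eqF //= -/L.
  change ((expR (a * L) * cos (b * L) - (1 + (a * x - b * 0))) +i*
    (expR (a * L) * sin (b * L) - (0 + (a * 0 + b * x))) =
   (expR (a * L) * cos (b * L) - (1 + a * x)) +i* (expR (a * L) * sin (b * L) - b * x)).
  by congr Complex; ring.
rewrite /=.
have hc : `|expR (a * L) * cos (b * L) - (1 + a * x)| <=
    (E * (b ^+ 2 + a ^+ 2) + `|a|) * x ^+ 2.
  (* Three errors of second order: that of the exponential, that of the cosine, and x - L. The
     imaginary part below is split in the same way. *)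
  have -> : expR (a * L) * cos (b * L) - (1 + a * x) =
    (expR (a * L) - 1 - a * L) - expR (a * L) * (1 - cos (b * L)) - a * (x - L) by ring.
  apply: le_trans (ler_normB _ _) _; rewrite mulrDl; apply: lerD; last first.
    by rewrite normrM ler_wpM2l // ger0_norm // subr_ge0.
  apply: le_trans (ler_normB _ _) _.
  have -> : E * (b ^+ 2 + a ^+ 2) * x ^+ 2 = E * a ^+ 2 * x ^+ 2 + E * b ^+ 2 * x ^+ 2 by ring.
  apply: lerD; last first.
    rewrite normrM -mulrA; apply: ler_pM => //.
      by rewrite ger0_norm ?expR_ge0 //; apply: le_trans (expR_le_norm _) (EL _ _).
    by apply: le_trans (cos_sub1_le _) _; rewrite exprMn ler_wpM2l // sqr_ge0.
  apply: le_trans (expR_taylor _) _.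
  have -> : E * a ^+ 2 * x ^+ 2 = (a ^+ 2 * x ^+ 2) * E by ring.
  apply: ler_pM; [exact: sqr_ge0 | exact: expR_ge0 | | exact: EL].
  by rewrite exprMn ler_wpM2l // sqr_ge0.
have hs : `|expR (a * L) * sin (b * L) - b * x| <=
    (E * (b ^+ 2 + `|b| * `|a|) + `|b|) * x ^+ 2.
  have -> : expR (a * L) * sin (b * L) - b * x =
    expR (a * L) * (sin (b * L) - b * L) + (b * L) * (expR (a * L) - 1) - b * (x - L) by ring.
  apply: le_trans (ler_normB _ _) _; rewrite mulrDl; apply: lerD; last first.
    by rewrite normrM ler_wpM2l // ger0_norm // subr_ge0.
  apply: le_trans (ler_normD _ _) _.
  have -> : E * (b ^+ 2 + `|b| * `|a|) * x ^+ 2 =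
    E * b ^+ 2 * x ^+ 2 + E * (`|b| * `|a|) * x ^+ 2 by ring.
  apply: lerD.
    rewrite normrM -mulrA; apply: ler_pM => //.
      by rewrite ger0_norm ?expR_ge0 //; apply: le_trans (expR_le_norm _) (EL _ _).
    by apply: le_trans (sin_sub_le _) _; rewrite exprMn ler_wpM2l // sqr_ge0.
  have h1 : `|expR (a * L) - 1| <= `|a| * L * E.
    apply: le_trans (expR_sub1_le _) _; rewrite normrM (ger0_norm L0).
    apply: ler_wpM2l; first by rewrite mulr_ge0.
    by rewrite -{1}(ger0_norm L0) -normrM; exact: EL.
  rewrite normrM [`|b * L|]normrM (ger0_norm L0).
  have -> : E * (`|b| * `|a|) * x ^+ 2 = `|b| * (`|a| * E) * x ^+ 2 by ring.
  apply: (@le_trans _ _ (`|b| * L * (`|a| * L * E))).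
    by apply: ler_wpM2l h1; rewrite mulr_ge0.
  have -> : `|b| * L * (`|a| * L * E) = `|b| * (`|a| * E) * L ^+ 2 by ring.
  by apply: ler_wpM2l; rewrite // !mulr_ge0 // ltW.
apply: le_trans (lerD hc hs) _; rewrite -mulrDl ler_wpM2r ?sqr_ge0 //; lra.
Qed.

End Gamma.

(** * Infinite products and the limit defining Gamma *)

Section Products.
Variable R : realType.
Local Notation C := (R[i] : numFieldType).
Local Notation normc := (@Normc.normc R).
Implicit Types (u w : nat -> C) (z l : C).
Local Open Scope classical_set_scope.
Local Open Scope complex_scope.

Lemma pbound_cst z : pbound (fun=> z : C) 0.
Proof. by exists (normc z) => n; rewrite powRr0 mulr1. Qed.

Lemma pbound_nat : pbound (fun n => n.+1%:R : C) 1.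
Proof. by exists 1 => n; rewrite normc_nat mul1r powRr1. Qed.

Lemma pbound_natV : pbound (fun n => n.+1%:R^-1 : C) (-1).
Proof. by exists 1 => n; rewrite Normc.normcV normc_nat mul1r powR_inv1. Qed.

Lemma pbound_lin z : pbound (fun n => z + n%:R) 1.
Proof.
apply: (eq_pbound (u := fun n => (z - 1) + n.+1%:R)).
  by move=> n; rewrite -natr1; ring.
apply: pboundD; last exact: pbound_nat.
by apply: pbound_le (pbound_cst _); rewrite ler01.
Qed.

Lemma pbound_linV z : pbound (fun n => (z + n%:R)^-1) (-1).
Proof.
apply: (@pbound_near _ _ _ (Num.truncn (2 * normc z)).+2 2) => n hn.
rewrite Normc.normcV powR_inv1 //.
have -> : 2 * n.+1%:R^-1 = (n.+1%:R / 2)^-1 :> R by rewrite invfM invrK mulrC.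
have hz : 2 * normc z < n%:R - 1.
  have h1 := truncnS_gt (2 * normc z); rewrite ltrBrDr.
  by apply: lt_le_trans (_ : (Num.truncn (2 * normc z)).+2%:R <= _);
    [rewrite -[X in _ < X]natr1 ltrD2r | rewrite ler_nat].
have hzn : n%:R - normc z <= normc (z + n%:R).
  rewrite lerBlDr -[X in X <= _](normc_nat R).
  rewrite [X in normc X <= _](_ : _ = (z + n%:R) + (0 - z)); last by rewrite add0r addrAC subrr add0r.
  by apply: le_trans (normc_triangle _ _) _; rewrite lerD2l normcB subr0.
have n1 : n.+1%:R = n%:R + 1 :> R by rewrite natr1.
have z0 := normc_ge0 z.
rewrite lef_pV2 ?posrE; lra.
Qed.

Lemma prod_bounded u w : (forall n, u n.+1 = u n * (1 + w n)) -> abs_summable w ->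
  exists M : R, forall n, normc (u n) <= M.
Proof.
move=> uS sw; exists (normc (u 0%N) * expR (limn (series (fun n => normc (w n))))) => n.
have h0 k : 0 <= normc (w k) by exact: normc_ge0.
apply: (@le_trans _ _ (normc (u 0%N) * expR (series (fun n => normc (w n)) n))).
  elim: n => [|n IHn]; first by rewrite /series /= big_nil expR0 mulr1.
  rewrite uS Normc.normcM /series /= big_nat_recr //= expRD mulrA.
  apply: ler_pM => //; try exact: normc_ge0.
  apply: le_trans (normc_triangle _ _) _; rewrite Normc.normc1.
  exact: expR_ge1Dx.
rewrite ler_wpM2l ?normc_ge0 // ler_expR.
by apply: nondecreasing_cvgn_le => //; exact: nondecreasing_series.
Qed.

Lemma prod_cvg_aux u w : (forall n, u n.+1 = u n * (1 + w n)) -> abs_summable w ->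
  exists l, u @ \oo --> l.
Proof.
move=> uS sw; have [M hM] := prod_bounded uS sw.
have [l hl] : exists l, series (fun n => u n.+1 - u n) @ \oo --> l.
  apply: abs_summable_cvg; apply: (@abs_summable_le _ _ (M *: (fun n => normc (w n)))).
    move=> n; rewrite uS mulrDr mulr1 addrAC subrr add0r Normc.normcM.
    by rewrite ler_wpM2r ?normc_ge0.
  exact: (is_cvg_seriesZ sw).
exists (l + u 0%N); have e : u = fun n => series (fun n => u n.+1 - u n) n + u 0%N.
  by apply/funext => n; rewrite /series /= telescope_sumr // subrK.
rewrite {1}e; exact: (cvgCD hl (cvgC_cst (u 0%N))).
Qed.

(** The limit is not 0 because the reciprocals also satisfy such a recurrence, with - w / (1 + w)
    for w; they converge as well, and the product of the two limits is 1. *)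
Lemma prod_cvg u w : (forall n, u n != 0) -> (forall n, u n.+1 = u n * (1 + w n)) ->
  pbound w (- 2) -> exists2 l, l != 0 & u @ \oo --> l.
Proof.
move=> u0 uS w2; have m2 : - 2 < -1 :> R by lra.
have [l ul] := prod_cvg_aux uS (pbound_summable m2 w2).
have w1 n : 1 + w n != 0 by have := u0 n.+1; rewrite uS mulf_eq0 negb_or => /andP[].
have wV : (fun n => (1 + w n)^-1) @ \oo --> (1^-1 : C).
  apply: cvgCV; first exact: oner_neq0.
  rewrite -[X in _ --> X]addr0; apply: (cvgCD (cvgC_cst 1)).
  by apply: pbound_cvg0 w2; lra.
have [l' ul'] : exists l', (fun n => (u n)^-1) @ \oo --> l'.
  apply: (@prod_cvg_aux _ (fun n => - w n * (1 + w n)^-1)).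
    by move=> n; rewrite uS; field; rewrite u0 w1.
  apply: (pbound_summable m2).
  rewrite -[X in pbound _ X]addr0; apply: pboundM (pbound_cvg wV).
  by apply: (eq_pbound _ (pboundMl (-1) w2)) => n; rewrite mulN1r.
exists l; last exact: ul.
apply/eqP => l0.
have := cvgCM ul ul'.
have -> : (fun n => u n * (u n)^-1) = fun=> 1.
  by apply/funext => n; rewrite divff.
move=> h; have /eqP := cvgC_unique (cvgC_cst 1) h; rewrite l0 mul0r.
by rewrite oner_eq0.
Qed.

Lemma cvgC_shift u l : (fun n => u n.+1) @ \oo --> l <-> u @ \oo --> l.
Proof. by rewrite -(cvg_shiftS u). Qed.

Lemma cvgC_ext u w l : u =1 w -> u @ \oo --> l -> w @ \oo --> l.
Proof. by move=> /funext ->. Qed.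

Definition gseq z n : C := n`!%:R * rpowC n%:R z / poch z n.+1.

Lemma gseq_cvg z : ~ nonposint z -> exists2 l, l != 0 & gseq z @ \oo --> l.
Proof.
(* The term of index 0 contains a power of 0 and may vanish, so the product starts at index 1. *)
move=> Nz; suff [l l0 hl] : exists2 l, l != 0 & (fun n => gseq z n.+1) @ \oo --> l.
  by exists l => //; rewrite -cvg_shiftS.
pose x n : R := n.+1%:R^-1.
pose r n : C := rpowC (1 + x n) z - (1 + z * (x n)%:C).
have xE n : (x n)%:C = n.+1%:R^-1 by rewrite /x fmorphV rmorph_nat.
have zn n : z + n%:R != 0 by apply: nonposint_neq0; exact: nonposintD.
(* The ratio of consecutive terms is (n + 2)(1 + x)^z / (z + n + 2) with x = 1 / (n + 1). Inserting
   (1 + x)^z = 1 + z x + r and subtracting 1 leaves this expression of order n^(-2). *)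
apply: (@prod_cvg _ (fun n => ((1 + n.+1%:R) * r n + z * n.+1%:R^-1) * (z + 1 + n.+1%:R)^-1)).
- move=> n; rewrite /gseq !mulf_neq0 ?factR_neq0 ?rpowC_neq0 ?ltr0n ?invr_eq0 //.
  exact: poch_neq0.
- move=> n; rewrite /gseq factS natrM [poch z n.+3]pochS /r xE.
  have -> : n.+2%:R = n.+1%:R * (1 + x n) :> R.
    by rewrite mulrDr mulr1 divff ?pnatr_eq0 // natr1.
  have x0 : 0 < x n by rewrite invr_gt0 ltr0n.
  rewrite rpowCM ?ltr0n ?ltr_wpDr ?(ltW x0) //.
  have e : z + 1 + n.+1%:R = z + n.+2%:R by rewrite -[n.+2%:R]natr1; ring.
  rewrite e; have := zn n.+2; have := poch_neq0 n.+2 Nz.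
  have : n.+1%:R != 0 :> C by rewrite pnatr_eq0.
  rewrite -[n.+2%:R]natr1 => ? ? ?.
  by field; rewrite ?nat1r; apply/and3P.
have r2 : pbound r (-2).
  have [M hM] := rpowC_taylor z; exists M => n.
  rewrite -[2]/(2%:R) powR_invn // -exprVn; apply: hM.
  by rewrite invr_ge0 ler0n invf_le1 ?ltr0n // ler1n.
have e2 : (-2 : R) = (1 + - 2) + -1 by lra.
rewrite e2; apply: pboundM; last exact: (pbound_shift (pbound_linV (z + 1))).
apply: pboundD.
  apply: (pboundM _ r2).
  apply: (eq_pbound _ (pbound_shift (pbound_lin 1))) => n //.
apply: (@pbound_le _ _ (-1)); first by lra.
exact: pboundMl pbound_natV.
Qed.

Lemma Gamma_neq0 z : ~ nonposint z -> Gamma z != 0.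
Proof. by move=> /gseq_cvg[l l0 /cvgC_lim h]; rewrite /Gamma h. Qed.

Lemma cvg_gseq z : ~ nonposint z -> gseq z @ \oo --> (Gamma z : C).
Proof. by move=> /gseq_cvg[l l0 hl]; rewrite /Gamma (cvgC_lim hl). Qed.

Lemma cvg_poch_ratio x y s t :
  ~ nonposint x -> ~ nonposint y -> ~ nonposint s -> ~ nonposint t ->
  x + y = s + t ->
  (fun n => poch x n * poch y n / (poch s n * poch t n)) @ \oo -->
    (Gamma s * Gamma t / (Gamma x * Gamma y) : C).
Proof.
move=> Nx Ny Ns Nt e.
have h : (fun n => gseq s n * gseq t n * (gseq x n * gseq y n)^-1) @ \oo -->
    (Gamma s * Gamma t / (Gamma x * Gamma y) : C).
  apply: cvgCM; first by apply: cvgCM; exact: cvg_gseq.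
  apply: cvgCV; first by rewrite mulf_neq0 ?Gamma_neq0.
  by apply: cvgCM; exact: cvg_gseq.
(* [gseq z n] contains [poch z n.+1] and is nonzero only from n = 1 on, hence two shifts against
   one. The powers of n + 1 cancel because x + y = s + t. *)
do 2 apply/cvgC_shift; move: ((cvgC_shift _ _).2 h); apply: cvgC_ext => n.
have n1 : 0 < n.+1%:R :> R by rewrite ltr0n.
have := congr1 (rpowC n.+1%:R) e; rewrite !rpowCD // => ee.
rewrite /gseq.
have := rpowC_neq0 x n1; have := rpowC_neq0 y n1.
have := rpowC_neq0 s n1; have := rpowC_neq0 t n1.
have := factR_neq0 C n.+1.
have := poch_neq0 n.+2 Nx; have := poch_neq0 n.+2 Ny.
have := poch_neq0 n.+2 Ns; have := poch_neq0 n.+2 Nt.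
move=> ? ? ? ? ? ? ? ? ?.
transitivity ((poch x n.+2 * poch y n.+2 / (poch s n.+2 * poch t n.+2)) *
  (rpowC n.+1%:R s * rpowC n.+1%:R t / (rpowC n.+1%:R x * rpowC n.+1%:R y))).
  by field; do ?[apply/andP; split => //].
by rewrite ee divff ?mulf_neq0 // mulr1.
Qed.

(** [bseq z n] behaves like n^(z - 1) / Gamma(z). Since the limit of [gseq] is finite and nonzero,
    bounds hold for it and for its inverse. *)
Lemma pbound_bseq_aux z : ~ nonposint z ->
  pbound (fun n => bseq z n) (complex.Re z - 1) /\
  pbound (fun n => (bseq z n)^-1) (1 - complex.Re z).
Proof.
move=> Nz; have [l l0 hl] := gseq_cvg Nz.
have hV := cvgCV l0 hl.
have hb := pbound_shift (pbound_cvg hl); have hbV := pbound_shift (pbound_cvg hV).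
have hp (s : C) : pbound (fun n => rpowC (n.+1%:R : R) s) (complex.Re s).
  by exists 1 => n; rewrite normc_rpowC mul1r.
have [pn pnV] := (pbound_nat, pbound_natV).
have e n : bseq z n.+2 = rpowC n.+1%:R z * (gseq z n.+1)^-1 * (1 + n.+1%:R)^-1.
  have n1 : 0 < n.+1%:R :> R by rewrite ltr0n.
  rewrite /bseq /gseq [in LHS]factS natrM -nat1r.
  have := rpowC_neq0 z n1; have := factR_neq0 C n.+1; have := poch_neq0 n.+2 Nz.
  have : 1 + n.+1%:R != 0 :> C by rewrite nat1r pnatr_eq0.
  by move=> ? ? ? ?; field; apply/and4P.
split; do 2 apply: pbound_unshift.
  apply: (eq_pbound (u := fun n => rpowC n.+1%:R z * (gseq z n.+1)^-1 * (1 + n.+1%:R)^-1)).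
    by move=> n; rewrite e.
  apply: pboundM; last exact: (pbound_shift (pbound_linV 1)).
  by rewrite -[X in pbound _ X]addr0; exact: pboundM.
apply: (eq_pbound (u := fun n => rpowC n.+1%:R (- z) * gseq z n.+1 * (1 + n.+1%:R))).
  move=> n; rewrite e !invfM !invrK; congr (_ * _ * _).
  have n1 : 0 < n.+1%:R :> R by rewrite ltr0n.
  apply: (mulIf (rpowC_neq0 z n1)); rewrite mulVf ?rpowC_neq0 //.
  by rewrite -rpowCD // addNr rpowC0.
rewrite addrC; apply: pboundM; last exact: (pbound_shift (pbound_lin 1)).
rewrite -[X in pbound _ X]addr0; apply: pboundM => //.
by have -> : - complex.Re z = complex.Re (- z) by case: (z).
Qed.

Lemma pbound_bseqV z : ~ nonposint z ->
  pbound (fun n => (bseq z n)^-1) (1 - complex.Re z).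
Proof. by case/pbound_bseq_aux. Qed.

Lemma bseq_nonposint z : nonposint z -> exists N, forall n, (N <= n)%N -> bseq z n = 0.
Proof. by case=> N ->; exists N.+1 => n Nn; rewrite /bseq poch_natN ?mul0r. Qed.

Lemma pbound_bseq z : pbound (fun n => bseq z n) (complex.Re z - 1).
Proof.
have [/bseq_nonposint[N]|/pbound_bseq_aux[] //] := pselect (nonposint z).
exact: pbound_finite.
Qed.

Lemma GammaS z : ~ nonposint z -> Gamma (z + 1) = z * Gamma z.
Proof.
move=> Nz; have Nz1 : ~ nonposint (z + 1) by exact: (@nonposintD _ z 1).
apply: (cvgC_unique (cvg_gseq Nz1)).
(* The last factor is n / (z + 1 + n), written so that its limit is visible. *)
have h : (fun n => z * gseq z n * (1 - (z + 1) * (z + 1 + n%:R)^-1)) @ \oo -->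
    (z * Gamma z * (1 - (z + 1) * 0) : C).
  apply: cvgCM; first exact: (cvgCM (cvgC_cst z) (cvg_gseq Nz)).
  apply: (cvgCB (cvgC_cst 1)); apply: (cvgCM (cvgC_cst (z + 1))).
  by apply: (pbound_cvg0 _ (pbound_linV (z + 1))); lra.
move: h; rewrite mulr0 subr0 mulr1 => h.
apply/cvgC_shift; move: ((cvgC_shift _ _).2 h); apply: cvgC_ext => n.
have n1 : 0 < n.+1%:R :> R by rewrite ltr0n.
have e1 : z * poch (z + 1) n.+2 = poch z n.+2 * (z + n.+2%:R) by rewrite -pochSl pochS.
have e2 : z + n.+2%:R = z + 1 + n.+1%:R by rewrite -natr1; ring.
have z1n : z + 1 + n.+1%:R != 0 by apply: nonposint_neq0; exact: nonposintD.
rewrite /gseq rpowCD // rpowC1 // rmorph_nat.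
have := poch_neq0 n.+2 Nz; have := poch_neq0 n.+2 Nz1; have := nonposint_neq0 Nz.
move=> z0 p1 p0.
have -> : poch (z + 1) n.+2 = poch z n.+2 * (z + 1 + n.+1%:R) / z.
  by rewrite -e2 -e1 mulrC mulKf.
by field; rewrite nat1r; apply/and3P.
Qed.

End Products.

(** * Gauss's theorem *)

Section Gauss.
Variable R : realType.
Local Notation C := (R[i] : numFieldType).
Local Notation normc := (@Normc.normc R).
Implicit Types (u w g : nat -> C) (a b c d e z l : C) (p s : R).
Local Open Scope classical_set_scope.
Local Open Scope complex_scope.

Lemma cReD z l : complex.Re (z + l) = complex.Re z + complex.Re l.
Proof. by case: z l => [? ?] [? ?]. Qed.

Lemma cReN z : complex.Re (- z) = - complex.Re z.
Proof. by case: z. Qed.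

Lemma cRe_nat n : complex.Re (n%:R : C) = n%:R.
Proof. by rewrite -(rmorph_nat (real_complex R)). Qed.

Definition cReE := (cReD, cReN, cRe_nat).

Lemma poch_real (x : R) n : poch x%:C n = (poch x n)%:C.
Proof.
elim: n => [|n IHn]; first by rewrite !poch0.
rewrite !pochS IHn -(rmorph_nat (real_complex R) n).
by rewrite -rmorphD -rmorphM.
Qed.

Definition prat d e n : C := poch d n / poch e n.

Lemma prat0 d e : prat d e 0 = 1.
Proof. by rewrite /prat !poch0 divr1. Qed.

Lemma pratE d e n : prat d e n = bseq d n * (bseq e n)^-1.
Proof.
by rewrite /prat /bseq invfM invrK mulrACA mulVf ?factR_neq0 // mulr1.
Qed.

Lemma pbound_prat d e : ~ nonposint e ->
  pbound (prat d e) (complex.Re d - complex.Re e).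
Proof.
move=> Ne; apply: (eq_pbound (u := fun n => bseq d n * (bseq e n)^-1)).
  by move=> n; rewrite pratE.
have -> : complex.Re d - complex.Re e = (complex.Re d - 1) + (1 - complex.Re e) by ring.
by apply: pboundM; [exact: pbound_bseq | exact: pbound_bseqV].
Qed.

(* Either the series terminates, or its terms decrease faster than [1 / n]. *)
Definition fast u := exists2 p : R, p < -1 & pbound u p.

Lemma fast_finite u N : (forall n, (N <= n)%N -> u n = 0) -> fast u.
Proof. by move=> h; exists (-2); [lra | exact: pbound_finite h]. Qed.

Lemma fast_summable u : fast u -> abs_summable u.
Proof. by case=> p p1; exact: pbound_summable. Qed.

Lemma fast_cvg u : fast u -> exists l, series u @ \oo --> l.
Proof. by move/fast_summable/abs_summable_cvg. Qed.

Lemma fast_mul u w : fast u -> pbound w 1 -> (fun n => u n * w n) @ \oo --> (0 : C).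
Proof.
move=> [p p1 hu] hw; apply: (@pbound_cvg0 _ _ (p + 1)); first by lra.
exact: pboundM.
Qed.

Lemma fast_prat g s d e : ~ nonposint e -> pbound g s ->
  nonposint d \/ s + complex.Re d - complex.Re e < -1 ->
  fast (fun n => g n * prat d e n).
Proof.
move=> Ne hg [[N dN]|h].
  apply: (@fast_finite _ N.+1) => n Nn.
  by rewrite /prat dN poch_natN // mul0r mulr0.
exists (s + (complex.Re d - complex.Re e)); first by rewrite addrA.
by apply: pboundM => //; exact: pbound_prat.
Qed.

Lemma poch_nat_le z K n : K%:R <= complex.Re z -> poch K%:R n <= normc (poch z n).
Proof.
move=> Kz; elim: n => [|n IHn]; first by rewrite !poch0 Normc.normc1.
rewrite !pochS Normc.normcM; apply: ler_pM => //.
  by apply: prodr_ge0 => i _; rewrite addr_ge0.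
have := normc_Re (z + n%:R); rewrite !cReE; apply: le_trans.
by apply: le_trans (ler_norm _); rewrite lerD2r.
Qed.

(** Dominated convergence as the lower parameter tends to infinity: only the term j = 0, equal to g
    0, survives. *)
Lemma series_shift_lim g s d z (S : nat -> C) : pbound g s ->
  (forall n, ~ nonposint (z + n%:R)) ->
  (forall n, series (fun j => g j * prat d (z + n%:R) j) @ \oo --> S n) ->
  S @ \oo --> g 0%N.
Proof.
move=> hg Nz hS.
(* A real lower parameter K for which g_j (d)_j / (K)_j is absolutely summable; that series is the
   majorant. *)
pose K := (Num.truncn (`|s| + `|complex.Re d| + 2)).+1.
have hK : s + complex.Re d - K%:R < -1.
  have := truncnS_gt (`|s| + `|complex.Re d| + 2); rewrite -/K.
  have := ler_norm s; have := ler_norm (complex.Re d); lra.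
have K0 : 0 < K%:R :> R by rewrite ltr0n.
have NK : ~ nonposint (K%:R : C).
  move=> [n /eqP]; rewrite -subr_eq0 opprK -natrD pnatr_eq0; by [].
have Kf : fast (fun n => g n * prat d K%:R n).
  by apply: (fast_prat NK hg); right; rewrite cRe_nat.
pose v n := normc (g n * prat d K%:R n).
have [V hV] : exists V : R, series v @ \oo --> V by apply/cvg_ex; exact: fast_summable.
pose N1 := (Num.truncn (K%:R + `|complex.Re z|)).+1.
have hN1 n : K%:R + n%:R <= complex.Re z + (n + N1)%N%:R.
  rewrite natrD; have := truncnS_gt (K%:R + `|complex.Re z|).
  rewrite -/N1; have := ler_norm (- complex.Re z); rewrite normrN; lra.
have V0 : 0 <= V.
  have -> : V = limn (series v) by apply/esym/cvg_lim.
  apply: (@le_trans _ _ (series v 0%N)); first by rewrite /series /= big_nil.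
  apply: nondecreasing_cvgn_le; last by apply/cvg_ex; exists V.
  by apply: nondecreasing_series => n _ _; exact: normc_ge0.
(* For Re y >= K one has |(y)_(j+1)| >= Re y (K + 1)_j, so each term with j > 0 is at most K / Re y
   times the majorant, and Re y grows linearly in n. *)
have bound n : normc (S (n + N1)%N - g 0%N) <= (K%:R * V) * n.+1%:R^-1.
  set y : C := z + (n + N1)%N%:R.
  have hy : K%:R + n%:R <= complex.Re y by rewrite /y !cReE.
  have y0 : 0 < complex.Re y by apply: lt_le_trans hy; rewrite ltr_wpDr.
  have Ky : K%:R <= complex.Re y by apply: le_trans hy; rewrite lerDl.
  have h1 : series (fun j => g j * prat d y j + (if j is 0%N then - g 0%N else 0)) @ \oo -->
      (S (n + N1)%N - g 0%N).
    apply: cvg_seriesD (hS _) _.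
    have := @cvg_series_finite _ (fun j => if j is 0%N then - g 0%N else 0) 1.
    by rewrite big_nat1; apply => -[].
  have h2 : series ((K%:R / complex.Re y) *: v) @ \oo --> ((K%:R / complex.Re y) * V).
    by rewrite seriesZ; apply: cvgMl_tmp.
  apply: (@le_trans _ _ (K%:R / complex.Re y * V)); last first.
    rewrite mulrAC ler_wpM2l ?mulr_ge0 // lef_pV2 ?posrE //.
    apply: le_trans hy; rewrite -nat1r lerD2r ler1n //.
  apply: (normc_series_le _ h1 h2) => -[|j].
    rewrite prat0 mulr1 subrr Normc.normc0 mulr_ge0 ?normc_ge0 //.
    by rewrite divr_ge0 // ltW.
  rewrite addr0 /v /prat /GRing.scale /= !Normc.normcM [X in _ <= X]mulrCA ler_wpM2l ?normc_ge0 //.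
  rewrite [X in _ <= X]mulrCA ler_wpM2l ?normc_ge0 // !Normc.normcV.
  rewrite !pochSl !Normc.normcM normc_nat !invfM.
  have -> : K%:R / complex.Re y * (K%:R^-1 * (normc (poch (K%:R + 1) j))^-1) =
     (complex.Re y)^-1 * (normc (poch (K%:R + 1) j))^-1.
    by rewrite mulrA [_ / _ * _]mulrAC divff ?mul1r // gt_eqF.
  have K1 : normc (poch (K%:R + 1) j) = poch K.+1%:R j.
    rewrite natr1 -(rmorph_nat (real_complex R)).
    by rewrite poch_real normc_real ger0_norm //; apply: prodr_ge0 => i _; rewrite addr_ge0.
  have P0 : 0 < poch (K.+1%:R : R) j.
    by apply: prodr_gt0 => i _; rewrite ltr_pwDl.
  have P1 : poch K.+1%:R j <= normc (poch (y + 1) j).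
    by apply: poch_nat_le; rewrite cReD -natr1 lerD2r.
  rewrite K1; apply: ler_pM; rewrite ?invr_ge0 ?normc_ge0 //.
    rewrite lef_pV2 ?posrE //; last by apply: lt_le_trans y0 (le_trans (ler_norm _) (normc_Re _)).
    exact: le_trans (ler_norm _) (normc_Re _).
  by rewrite lef_pV2 ?posrE //; apply: lt_le_trans P1.
have h3 : (fun n => S (n + N1)%N - g 0%N) @ \oo --> (0 : C).
  apply: (@pbound_cvg0 _ _ (-1)); first by lra.
  by exists (K%:R * V) => n; rewrite powR_inv1.
have h4 : (fun n => S (n + N1)%N) @ \oo --> g 0%N.
  rewrite -[g 0%N]add0r; apply: cvgC_ext (cvgCD h3 (cvgC_cst (g 0%N))) => n.
  by rewrite subrK.
by rewrite -(cvg_shiftn N1 S).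
Qed.

End Gauss.

Section Summation.
Variable R : realType.
Local Notation C := (R[i] : numFieldType).
Implicit Types (u w g : nat -> C) (a b c d e z l : C) (p s : R).
Local Open Scope classical_set_scope.
Local Open Scope complex_scope.

Definition hconv a b c :=
  (nonposint a \/ nonposint b) \/ 0 < complex.Re (c - a - b).

Lemma hconv_shift a b c n : hconv a b c -> hconv a b (c + n%:R).
Proof.
case=> [h|h]; [by left|right]; apply: lt_le_trans h _.
by rewrite !cReE; have := ler0n R n; lra.
Qed.

Lemma fast_hterm a b c : ~ nonposint c -> hconv a b c ->
  fast (fun n => bseq a n * prat b c n).
Proof.
move=> Nc [[/bseq_nonposint[N aN]|b0]|h].
- by apply: (@fast_finite _ _ N) => n /aN ->; rewrite mul0r.
- by apply: (fast_prat Nc (pbound_bseq a)); left.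
- apply: (fast_prat Nc (pbound_bseq a)); right.
  by move: h; rewrite !cReE; lra.
Qed.

Lemma nonposint_bseq0 c n : ~ nonposint c -> c + n%:R != 0.
Proof. by move=> Nc; apply: nonposint_neq0; exact: nonposintD. Qed.

Lemma prat_shift b c n : ~ nonposint c ->
  (c + n%:R) * prat b (c + 1) n = c * prat b c n.
Proof.
move=> Nc; have c0 := nonposint_neq0 Nc; have cn := nonposint_bseq0 n Nc.
have := pochSl c n; rewrite pochS => e.
have p1 := poch_neq0 n Nc.
have p2 : poch (c + 1) n != 0 by apply: poch_neq0; exact: (@nonposintD _ c 1).
rewrite /prat.
have -> : poch (c + 1) n = poch c n * (c + n%:R) / c by rewrite e mulrC mulKf.
by field; apply/and3P.
Qed.

Lemma pratS b c n : ~ nonposint c ->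
  (c + n%:R) * prat b c n.+1 = (b + n%:R) * prat b c n.
Proof.
move=> Nc; have cn := nonposint_bseq0 n Nc; have p1 := poch_neq0 n Nc.
by rewrite /prat !pochS; field; apply/andP.
Qed.

Lemma gauss_step a b c l l' : ~ nonposint c -> hconv a b c ->
  series (fun n => bseq a n * prat b c n) @ \oo --> l ->
  series (fun n => bseq a n * prat b (c + 1) n) @ \oo --> l' ->
  c * (c - a - b) * l = (c - a) * (c - b) * l'.
Proof.
move=> Nc hc hl hl'; have c0 := nonposint_neq0 Nc.
(* Telescoping certificate for the contiguous relation in c. *)
pose G n : C := c * (n%:R * (bseq a n * prat b c n)).
have G0 : G @ \oo --> (0 : C).
  rewrite -(mulr0 c); apply: (cvgCM (cvgC_cst c)).
  apply: cvgC_ext (fast_mul (fast_hterm Nc hc) (pbound_lin 0)) => n.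
  by rewrite add0r mulrC.
have := series_telescope G0; rewrite /G mul0r mulr0 subr0 => h0.
have h1 := cvg_seriesD (@cvg_seriesZ _ (c * (c - a - b)) _ _ hl)
  (@cvg_seriesZ _ (- ((c - a) * (c - b))) _ _ hl').
apply/eqP; rewrite -subr_eq0; apply/eqP; rewrite -mulNr.
apply: cvgC_unique h1 _; apply: cvgC_ext h0 => N.
apply: eq_bigr => n _.
have cn := nonposint_bseq0 n Nc.
have e1 : prat b (c + 1) n = c * prat b c n / (c + n%:R) by rewrite -prat_shift // mulrC mulKf.
have e2 : prat b c n.+1 = (b + n%:R) * prat b c n / (c + n%:R) by rewrite -pratS // mulrC mulKf.
have e3 : n.+1%:R * (bseq a n.+1 * prat b c n.+1) =
    (a + n%:R) * bseq a n * prat b c n.+1 by rewrite mulrA bseqS.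
by rewrite e3 e2 e1; field.
Qed.

(** Iterating [gauss_step] moves c to c + n. The sum then tends to 1, and the accumulated Pochhammer
    quotient to the quotient of Gamma values. *)
Lemma gauss_sum a b c : ~ nonposint c -> hconv a b c ->
  ~ nonposint (c - a) -> ~ nonposint (c - b) -> ~ nonposint (c - a - b) ->
  series (fun n => bseq a n * prat b c n) @ \oo -->
    (Gamma c * Gamma (c - a - b) / (Gamma (c - a) * Gamma (c - b)) : C).
Proof.
move=> Nc hc Nca Ncb Ncab.
have Ncn n : ~ nonposint (c + n%:R) by exact: nonposintD.
have hcn n := hconv_shift n hc.
have [S hS] := choice (fun n => fast_cvg (fast_hterm (Ncn n) (hcn n))).
have S1 : S @ \oo --> (1 : C).
  by rewrite -(bseq0 a); apply: (series_shift_lim (pbound_bseq a) Ncn hS).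
have SE n : S 0%N = poch (c - a) n * poch (c - b) n / (poch c n * poch (c - a - b) n) * S n.
  elim: n => [|n ->]; first by rewrite !poch0 mulr1 divr1 mul1r.
  have e := gauss_step (Ncn n) (hcn n) (hS n).
  rewrite -addrA natr1 in e; have {}e := e _ (hS n.+1).
  rewrite !pochS.
  have := poch_neq0 n Nc; have := poch_neq0 n Ncab.
  have := nonposint_bseq0 n Nc; have := nonposint_bseq0 n Ncab.
  move=> h1 h2 h3 h4.
  have h1' : c + n%:R - a - b != 0.
    by rewrite (_ : c + n%:R - a - b = c - a - b + n%:R) //; ring.
  have -> : S n = (c + n%:R - a) * (c + n%:R - b) * S n.+1 / ((c + n%:R) * (c + n%:R - a - b)).
    by rewrite -e mulrC mulKf // mulf_neq0.
  by field; do ?[apply/andP; split => //].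
have h0 : (fun=> S 0%N) @ \oo -->
   (Gamma c * Gamma (c - a - b) / (Gamma (c - a) * Gamma (c - b)) : C).
  rewrite -[X in _ --> X]mulr1.
  apply: cvgC_ext (cvgCM (cvg_poch_ratio Nca Ncb Nc Ncab _) S1) => [n|].
    by rewrite -SE.
  by ring.
have <- := cvgC_unique (cvgC_cst (S 0%N)) h0.
by have := hS 0%N; rewrite addr0.
Qed.

End Summation.

(** * The 3F2 series with al over al + 1 *)

Section UnitGap.
Variable R : realType.
Local Notation C := (R[i] : numFieldType).
Implicit Types (u w g : nat -> C) (b d e z l al : C) (p s : R).
Local Open Scope classical_set_scope.
Local Open Scope complex_scope.

Lemma fast_lim u : fast u -> series u @ \oo --> (limn (series u) : C).
Proof. by move=> /fast_cvg[l hl]; rewrite (cvgC_lim hl). Qed.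

(** The sum of [iterm] is 3F2(al, b, d; al + 1, e) / al, that of [kterm] is 3F2(1, al + 1 - b, d; al
    + 1, e - b + 1) / al. Their conjectured ratio [gfac] is the Gamma factor for the exponent b -
    1. *)
Definition vcoef al b j : C := poch (al + 1 - b) j / poch al j.+1.
Definition iterm al b d e n : C := bseq b n * prat d e n / (al + n%:R).
Definition kterm al b d e j : C := vcoef al b j * prat d (e - b + 1) j.
Definition gfac b d e : C :=
  Gamma e * Gamma (e - b + 1 - d) / (Gamma (e - d) * Gamma (e - b + 1)).

Definition regular al b d e :=
  [/\ ~ nonposint al, ~ nonposint e, ~ nonposint (e - d),
      ~ nonposint (e - b + 1) & ~ nonposint (e - b + 1 - d)].

Definition kconv al b d e :=
  (nonposint (al + 1 - b) \/ nonposint d) \/ 0 < complex.Re (e - d).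

Lemma regular_shift al b d e n : regular al b d e -> regular al b d (e + n%:R).
Proof.
case=> h1 h2 h3 h4 h5; split=> //.
- exact: nonposintD.
- by rewrite addrAC; exact: nonposintD.
- by rewrite (_ : _ + 1 = e - b + 1 + n%:R); [exact: nonposintD | ring].
- by rewrite (_ : _ - d = e - b + 1 - d + n%:R); [exact: nonposintD | ring].
Qed.

Lemma kconv_shift al b d e n : kconv al b d e -> kconv al b d (e + n%:R).
Proof.
case=> h; [by left|right]; apply: lt_le_trans h _.
by rewrite !cReE; have := ler0n R n; lra.
Qed.

Lemma pbound_vcoef al b : ~ nonposint al -> pbound (vcoef al b) (- complex.Re b).
Proof.
move=> Na.
apply: (eq_pbound (u := fun n => prat (al + 1 - b) al n * (al + n%:R)^-1)).
  by move=> n; rewrite /vcoef /prat pochS invfM mulrA.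
have -> : - complex.Re b = complex.Re (al + 1 - b) - complex.Re al + (- 1).
  by rewrite !cReE (@cRe_nat R 1); ring.
by apply: pboundM; [exact: pbound_prat | exact: pbound_linV].
Qed.

Lemma fast_iterm al b d e : ~ nonposint e -> hconv b d e -> fast (iterm al b d e).
Proof.
move=> Ne he; have [p p1 hp] := fast_hterm Ne he.
exists (p + -1); first by lra.
by apply: pboundM => //; exact: pbound_linV.
Qed.

Lemma fast_kterm al b d e : regular al b d e -> kconv al b d e ->
  fast (kterm al b d e).
Proof.
case=> Na Ne Ned Nc Ncd [[/bseq_nonposint[N h]|dN]|h].
- apply: (@fast_finite _ _ N) => n /h; rewrite /kterm /vcoef /bseq => /eqP.
  by rewrite mulf_eq0 invr_eq0 (negPf (factR_neq0 _ _)) orbF => /eqP->; rewrite !mul0r.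
- by apply: fast_prat Nc (pbound_vcoef b Na) _; left.
- apply: fast_prat Nc (pbound_vcoef b Na) _; right.
  by move: h; rewrite !cReE (@cRe_nat R 1); lra.
Qed.

Lemma gfacS b d e al : regular al b d e ->
  (e - d) * (e - b + 1) * gfac b d (e + 1) = e * (e - b + 1 - d) * gfac b d e.
Proof.
case=> Na Ne Ned Nc Ncd; rewrite /gfac.
set c := e - b + 1 in Nc Ncd *.
have -> : e + 1 - b + 1 = c + 1 by rewrite /c; ring.
have -> : c + 1 - d = (c - d) + 1 by ring.
have -> : e + 1 - d = (e - d) + 1 by ring.
rewrite (GammaS Ne) (GammaS Nc) (GammaS Ncd) (GammaS Ned).
have := Gamma_neq0 Ned; have := Gamma_neq0 Nc.
have := nonposint_neq0 Ned; have := nonposint_neq0 Nc.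
by move=> ? ? ? ?; field; do ?[apply/andP; split => //].
Qed.

Definition defect al b d e : C :=
  limn (series (iterm al b d e)) - gfac b d e * limn (series (kterm al b d e)).

(** Each sum alone satisfies an inhomogeneous recurrence in e. The inhomogeneity is a Gauss sum for
    [iterm] and the constant 1 for [kterm]; they cancel once the latter is multiplied by the Gamma
    factor. *)
Lemma defect_e al b d e : regular al b d e -> hconv b d e -> kconv al b d e ->
  e * defect al b d e = (e - al) * defect al b d (e + 1).
Proof.
move=> hr hI hK; have [Na Ne Ned Nc Ncd] := hr.
have hr1 := regular_shift 1 hr; have hI1 := hconv_shift 1 hI.
have hK1 := kconv_shift 1 hK; have [_ Ne1 Ned1 Nc1 Ncd1] := hr1.
have lI := fast_lim (fast_iterm al Ne hI); have lI1 := fast_lim (fast_iterm al Ne1 hI1).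
have lK := fast_lim (fast_kterm hr hK); have lK1 := fast_lim (fast_kterm hr1 hK1).
have e0 := nonposint_neq0 Ne; have ed0 := nonposint_neq0 Ned.
set c := e - b + 1 in Nc Ncd *; have c0 := nonposint_neq0 Nc.
have Nd1 : ~ nonposint (e + 1 - b - d) by rewrite (_ : _ - d = c - d) // /c; ring.
have Nb1 : ~ nonposint (e + 1 - b) by rewrite (_ : _ - b = c) // /c; ring.
have hG := gauss_sum Ne1 hI1 Nb1 Ned1 Nd1.
(* Termwise, e (d)_n / (e)_n = (e + n) (d)_n / (e + 1)_n, and e + n = (e - al) + (al + n): the
   second part cancels the denominator. *)
have eqI : e * limn (series (iterm al b d e)) =
   (e - al) * limn (series (iterm al b d (e + 1))) +
   Gamma (e + 1) * Gamma (e + 1 - b - d) / (Gamma (e + 1 - b) * Gamma (e + 1 - d)).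
  apply: cvgC_unique (@cvg_seriesZ _ e _ _ lI) _.
  apply: cvgC_ext (cvg_seriesD (@cvg_seriesZ _ (e - al) _ _ lI1) hG) => N.
  apply: eq_bigr => n _; rewrite /iterm.
  have an := nonposint_bseq0 n Na; have en := nonposint_bseq0 n Ne.
  have -> : prat d e n = (e + n%:R) * prat d (e + 1) n / e.
    by rewrite prat_shift // mulrC mulKf.
  by field; apply/andP.
have eqK : (e - d) * limn (series (kterm al b d e)) -
   (e - al) * (c - d) / c * limn (series (kterm al b d (e + 1))) = 1.
  pose G j : C := kterm al b d e j * (al + j%:R).
  have G0 : G @ \oo --> (0 : C).
    by apply: fast_mul (fast_kterm hr hK) _; exact: pbound_lin.
  have := series_telescope G0; rewrite subr0.
  have -> : G 0%N = 1.
    rewrite /G /kterm /vcoef prat0 pochS !poch0 !addr0 mul1r mul1r mulr1.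
    by rewrite mulVf // nonposint_neq0.
  move=> hT; rewrite -mulNr.
  apply: cvgC_unique (cvg_seriesD (@cvg_seriesZ _ (e - d) _ _ lK)
    (@cvg_seriesZ _ (- ((e - al) * (c - d) / c)) _ _ lK1)) _.
  apply: cvgC_ext hT => N; apply: eq_bigr => n _.
  rewrite /G /kterm (_ : e + 1 - b + 1 = c + 1); last by rewrite /c; ring.
  rewrite -/c; have cn := nonposint_bseq0 n Nc; have an := nonposint_bseq0 n Na.
  have an1 : al + n.+1%:R != 0 by exact: nonposint_bseq0.
  have -> : prat d (c + 1) n = c * prat d c n / (c + n%:R).
    by rewrite -prat_shift // mulrC mulKf.
  have -> : prat d c n.+1 = (d + n%:R) * prat d c n / (c + n%:R).
    by rewrite -pratS // mulrC mulKf.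
  have -> : vcoef al b n.+1 = vcoef al b n * (al + 1 - b + n%:R) / (al + n.+1%:R).
    rewrite /vcoef [poch _ n.+1]pochS [poch al n.+2]pochS invfM; ring.
  by rewrite /c in cn c0 *; field; apply/and3P; split => //; rewrite nat1r.
have eG := gfacS hr; rewrite -/c in eG.
have eqG : Gamma (e + 1) * Gamma (e + 1 - b - d) /
    (Gamma (e + 1 - b) * Gamma (e + 1 - d)) = e * gfac b d e / (e - d).
  rewrite /gfac -/c (_ : e + 1 - b - d = c - d); last by rewrite /c; ring.
  rewrite (_ : e + 1 - b = c); last by rewrite /c; ring.
  rewrite (_ : e + 1 - d = e - d + 1); last by ring.
  rewrite (GammaS Ne) (GammaS Ned); have := Gamma_neq0 Ned; have := Gamma_neq0 Nc.
  by move=> ? ?; field; do ?[apply/andP; split => //].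
rewrite /defect mulrBr eqI eqG mulrBr.
have -> : limn (series (kterm al b d e)) =
   (1 + (e - al) * (c - d) / c * limn (series (kterm al b d (e + 1)))) / (e - d).
  by move/eqP: eqK; rewrite subr_eq => /eqP <-; rewrite mulrC mulKf.
have -> : gfac b d (e + 1) = e * (c - d) * gfac b d e / ((e - d) * c).
  by rewrite -eG mulrC mulKf // mulf_neq0.
by field; apply/andP.
Qed.

End UnitGap.

Section UnitGapTheorem.
Variable R : realType.
Local Notation C := (R[i] : numFieldType).
Implicit Types (u w g : nat -> C) (b d e z l al : C) (p s : R).
Local Open Scope classical_set_scope.
Local Open Scope complex_scope.

(** The same cancellation for a shift of al. The positive real parts ensure convergence and keep e -
    b and e - b - d away from the poles of Gamma. *)
Lemma defect_al al b d e : regular al b d e ->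
  0 < complex.Re (e - b - d) -> 0 < complex.Re (e - d) -> 0 < complex.Re (e - b) ->
  al * (al + 1 - e) * defect al b d e =
  (al + 1 - b) * (al + 1 - d) * defect (al + 1) b d e.
Proof.
move=> hr R1 R2 R3; have [Na Ne Ned Nc Ncd] := hr.
have Na1 : ~ nonposint (al + 1) by exact: (@nonposintD _ al 1).
have hr1 : regular (al + 1) b d e by [].
have hI : hconv b d e by right.
have hK : kconv al b d e by right.
have hK1 : kconv (al + 1) b d e by right.
have lI := fast_lim (fast_iterm al Ne hI).
have lI1 := fast_lim (fast_iterm (al + 1) Ne hI).
have lK := fast_lim (fast_kterm hr hK); have lK1 := fast_lim (fast_kterm hr1 hK1).
have Npos z : 0 < complex.Re z -> ~ nonposint z.
  move=> h [n hz]; move: h; rewrite hz !cReE oppr_gt0 => h.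
  by have := lt_le_trans h (ler0n R n); rewrite ltxx.
have Neb := Npos _ R3; have Nebd := Npos _ R1.
have hG := gauss_sum Ne hI Neb Ned Nebd.
set S := Gamma e * _ / _ in hG.
have al0 := nonposint_neq0 Na.
have eqI : al * (al + 1 - e) * limn (series (iterm al b d e)) =
   (al + 1 - b) * (al + 1 - d) * limn (series (iterm (al + 1) b d e)) - (e - b - d) * S.
  (* The quadratic factor exceeds the denominator al + n by one degree only, so T still tends to
     0. *)
  pose T n : C := n%:R * (e + n%:R - 1) * iterm al b d e n.
  have T0 : T @ \oo --> (0 : C).
    have hp : pbound (fun n => n%:R * (e + n%:R - 1) * (al + n%:R)^-1 : C) (1 + 1 + -1).
      apply: pboundM (pbound_linV _); apply: pboundM.
        by apply: (eq_pbound _ (pbound_lin 0)) => n; rewrite add0r.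
      by apply: (eq_pbound _ (pbound_lin (e - 1))) => n; rewrite addrAC.
    rewrite addrK in hp.
    apply: cvgC_ext (fast_mul (fast_hterm Ne hI) hp) => n.
    by rewrite /T /iterm; ring.
  have := series_telescope T0; rewrite /T !mul0r subr0 => hT.
  have h := cvg_seriesD (cvg_seriesD (@cvg_seriesZ _ (e - b - d) _ _ hG)
    (@cvg_seriesZ _ (al * (al + 1 - e)) _ _ lI))
    (@cvg_seriesZ _ (- ((al + 1 - b) * (al + 1 - d))) _ _ lI1).
  have h0 : (e - b - d) * S + al * (al + 1 - e) * limn (series (iterm al b d e)) +
     - ((al + 1 - b) * (al + 1 - d)) * limn (series (iterm (al + 1) b d e)) = 0.
    apply: cvgC_unique h _; apply: cvgC_ext hT => N; apply: eq_bigr => n _.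
    have an := nonposint_bseq0 n Na; have an1 := nonposint_bseq0 n Na1.
    have en := nonposint_bseq0 n Ne.
    have e1 : n.+1%:R * (bseq b n.+1 * prat d e n.+1) =
      (b + n%:R) * bseq b n * ((d + n%:R) * prat d e n / (e + n%:R)).
      by rewrite mulrA bseqS -pratS // [(e + _) * _]mulrC mulfK.
    have e2 : al + n.+1%:R = al + 1 + n%:R by rewrite -natr1; ring.
    have -> : n.+1%:R * (e + n.+1%:R - 1) * iterm al b d e n.+1 =
       (e + n%:R) * (n.+1%:R * (bseq b n.+1 * prat d e n.+1)) / (al + 1 + n%:R).
      by rewrite /iterm e2 -natr1; ring.
    by rewrite e1 /iterm; field; apply/and3P.
  apply/eqP; rewrite -subr_eq0 -h0; apply/eqP; ring.
have eqK : al * (al + 1 - e) * limn (series (kterm al b d e)) =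
   (al + 1 - b) * (al + 1 - d) * limn (series (kterm (al + 1) b d e)) - (e - b).
  pose G j : C := kterm al b d e j * (e - b + j%:R).
  have G0 : G @ \oo --> (0 : C).
    by apply: fast_mul (fast_kterm hr hK) _; exact: pbound_lin.
  have := series_telescope G0; rewrite subr0.
  have -> : G 0%N = (e - b) / al.
    by rewrite /G /kterm /vcoef prat0 pochS !poch0 !addr0 mul1r mul1r mulr1 mulrC.
  move=> hT.
  have h := cvg_seriesD (@cvg_seriesZ _ (- (al + 1 - e)) _ _ lK)
    (@cvg_seriesZ _ ((al + 1 - b) * (al + 1 - d) / al) _ _ lK1).
  have h0 : - (al + 1 - e) * limn (series (kterm al b d e)) +
     (al + 1 - b) * (al + 1 - d) / al * limn (series (kterm (al + 1) b d e)) = (e - b) / al.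
    apply: cvgC_unique h _; apply: cvgC_ext hT => N; apply: eq_bigr => n _.
    have an := nonposint_bseq0 n Na; have an1 := nonposint_bseq0 n Na1.
    have cn := nonposint_bseq0 n Nc.
    have an2 : al + n.+1%:R != 0 by exact: nonposint_bseq0.
    have pan := poch_neq0 n.+1 Na.
    have e2 : al + n.+1%:R = al + 1 + n%:R by rewrite -natr1; ring.
    have V1 : vcoef al b n.+1 = vcoef al b n * (al + 1 - b + n%:R) / (al + n.+1%:R).
      rewrite /vcoef [poch _ n.+1]pochS [poch al n.+2]pochS invfM; ring.
    have V2 : (al + 1 - b) * vcoef (al + 1) b n = al * vcoef al b n.+1.
      rewrite /vcoef [poch (al + 1 - b) n.+1]pochSl [poch al n.+2]pochSl.
      rewrite (_ : al + 1 - b + 1 = al + 1 + 1 - b); last by ring.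
      have := poch_neq0 n.+1 Na1 => ?; by field; apply/andP.
    have P1 : (e - b + n.+1%:R) * prat d (e - b + 1) n.+1 =
        (d + n%:R) * prat d (e - b + 1) n.
      by rewrite -(pratS d n Nc) -natr1; ring.
    have -> : G n - G n.+1 = vcoef al b n * prat d (e - b + 1) n * (e - b + n%:R) -
       vcoef al b n.+1 * ((d + n%:R) * prat d (e - b + 1) n).
      by rewrite -P1 /G /kterm; ring.
    have -> : (al + 1 - b) * (al + 1 - d) / al * kterm (al + 1) b d e n =
       (al + 1 - d) * vcoef al b n.+1 * prat d (e - b + 1) n.
      rewrite /kterm.
      transitivity ((al + 1 - d) / al * ((al + 1 - b) * vcoef (al + 1) b n) *
        prat d (e - b + 1) n); first by ring.
      by rewrite V2; field.
    by rewrite V1 /kterm e2; field; rewrite -?e2.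
  have -> : e - b = al * ((e - b) / al) by rewrite mulrC divfK.
  by rewrite -h0; field.
have eqG : (e - b) * gfac b d e = (e - b - d) * S.
  rewrite /gfac /S (GammaS Neb).
  rewrite (_ : e - b + 1 - d = e - b - d + 1); last by ring.
  rewrite (GammaS Nebd).
  have := Gamma_neq0 Ned; have := Gamma_neq0 Neb; have := nonposint_neq0 Neb.
  by move=> ? ? ?; field; do ?[apply/andP; split => //].
rewrite /defect mulrBr eqI.
transitivity ((al + 1 - b) * (al + 1 - d) * limn (series (iterm (al + 1) b d e)) - (e - b - d) * S -
   gfac b d e * (al * (al + 1 - e) * limn (series (kterm al b d e)))); first by ring.
by rewrite eqK -eqG; ring.
Qed.

Lemma defect_prat al b d e n : regular al b d e -> hconv b d e -> kconv al b d e ->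
  defect al b d e = prat (e - al) e n * defect al b d (e + n%:R).
Proof.
move=> hr hI hK; elim: n => [|n ->]; first by rewrite prat0 mul1r addr0.
have hrn := regular_shift n hr; have hIn := hconv_shift n hI.
have h := defect_e hrn hIn (kconv_shift n hK).
have [_ Ne _ _ _] := hr; have en := nonposint_bseq0 n Ne.
have -> : defect al b d (e + n%:R) =
    (e + n%:R - al) * defect al b d (e + n%:R + 1) / (e + n%:R).
  by rewrite -h mulrC mulKf.
have -> : prat (e - al) e n.+1 = (e - al + n%:R) * prat (e - al) e n / (e + n%:R).
  by rewrite -pratS // mulrC mulKf.
by rewrite -natr1 addrA; field.
Qed.

(** The prefactor (e - al)_n / (e)_n decays like n^(- Re al), so it is enough that the defect at e +
    n has some finite limit. *)
Lemma defect0_aux al b d e : 0 < complex.Re al ->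
  regular al b d e -> hconv b d e -> kconv al b d e -> defect al b d e = 0.
Proof.
move=> Ra hr hI hK; have [Na Ne Ned Nc Ncd] := hr.
have Nen n : ~ nonposint (e + n%:R) by exact: nonposintD.
have Ncn n : ~ nonposint (e - b + 1 + n%:R) by exact: nonposintD.
have hI' : (fun n => limn (series (iterm al b d (e + n%:R)))) @ \oo -->
    (bseq b 0 / (al + 0%:R) : C).
  have hg : pbound (fun n => bseq b n / (al + n%:R)) (complex.Re b - 1 + -1).
    by apply: pboundM; [exact: pbound_bseq | exact: pbound_linV].
  apply: (series_shift_lim hg Nen (d := d)) => n.
  apply: cvgC_ext (fast_lim (fast_iterm al (Nen n) (hconv_shift n hI))) => N.
  by apply: eq_bigr => k _; rewrite /iterm; ring.
have hK' : (fun n => limn (series (kterm al b d (e + n%:R)))) @ \oo -->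
    (vcoef al b 0 : C).
  apply: (series_shift_lim (pbound_vcoef b Na) Ncn (d := d)) => n.
  apply: cvgC_ext (fast_lim (fast_kterm (regular_shift n hr) (kconv_shift n hK))) => N.
  by apply: eq_bigr => k _; rewrite /kterm (_ : e + _ - b + 1 = e - b + 1 + n%:R) //; ring.
have gE n : gfac b d (e + n%:R) =
   gfac b d e * (poch e n * poch (e - b + 1 - d) n / (poch (e - d) n * poch (e - b + 1) n)).
  elim: n => [|n IHn]; first by rewrite !poch0 mulr1 divr1 mulr1 addr0.
  have := gfacS (regular_shift n hr).
  rewrite (_ : e + n%:R + 1 = e + n.+1%:R); last by rewrite -natr1; ring.
  rewrite IHn.
  set c := e - b + 1 in Nc Ncd *.
  have := poch_neq0 n Ned; have := poch_neq0 n Nc.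
  have := nonposint_bseq0 n Ned; have := nonposint_bseq0 n Nc.
  rewrite (_ : e + n%:R - b + 1 = c + n%:R); last by rewrite /c; ring.
  rewrite (_ : c + n%:R - d = c - d + n%:R); last by ring.
  rewrite (_ : e + n%:R - d = e - d + n%:R); last by ring.
  move=> h1 h2 h3 h4 h5.
  have -> : gfac b d (e + n.+1%:R) = (e - d + n%:R) * (c + n%:R) * gfac b d (e + n.+1%:R) /
       ((e - d + n%:R) * (c + n%:R)) by rewrite mulrC mulKf // mulf_neq0.
  by rewrite h5 !pochS; field; do ?[apply/andP; split => //].
have [lg hg] : exists lg : C, (fun n => gfac b d (e + n%:R)) @ \oo --> lg.
  exists (gfac b d e * (Gamma (e - d) * Gamma (e - b + 1) / (Gamma e * Gamma (e - b + 1 - d)))).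
  have hp := cvg_poch_ratio Ne Ncd Ned Nc _.
  apply: cvgC_ext (cvgCM (cvgC_cst (gfac b d e)) (hp _)) => [n|]; first by rewrite gE.
  by ring.
have hD := cvgCB hI' (cvgCM hg hK').
have hP : prat (e - al) e @ \oo --> (0 : C).
  by apply: (pbound_cvg0 _ (pbound_prat (e - al) Ne)); rewrite !cReE; lra.
have := cvgCM hP hD; rewrite mul0r => h0.
apply: cvgC_unique (cvgC_cst (defect al b d e)) _.
by apply: cvgC_ext h0 => n; rewrite (defect_prat n hr hI hK).
Qed.

(** Induction on an integer above - Re al, for all e at once, because each step first moves e to e +
    N. *)
Lemma defect0 al b d e :
  regular al b d e -> hconv b d e -> kconv al b d e -> defect al b d e = 0.
Proof.
have [M hM] : exists M, - complex.Re al < M%:R.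
  by exists (Num.truncn (- complex.Re al)).+1; exact: truncnS_gt.
elim: M al e hM => [|M IHM] al e hM hr hI hK.
  by apply: defect0_aux => //; rewrite -oppr_lt0.
(* N makes Re (e + N) exceed all that [defect_al] asks for, and also Re (al + 1), so that the factor
   al + 1 - (e + N) cannot vanish. *)
pose N := (Num.truncn (`|complex.Re e| + `|complex.Re b| + `|complex.Re d| + `|complex.Re al| + 1)).+1.
have hN := truncnS_gt (`|complex.Re e| + `|complex.Re b| + `|complex.Re d| + `|complex.Re al| + 1).
rewrite -/N in hN.
have [e1 e2] := (ler_norm (complex.Re e), ler_norm (- complex.Re e)).
have [b1 b2] := (ler_norm (complex.Re b), ler_norm (- complex.Re b)).
have [d1 d2] := (ler_norm (complex.Re d), ler_norm (- complex.Re d)).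
have [a1 a2] := (ler_norm (complex.Re al), ler_norm (- complex.Re al)).
rewrite !normrN in e2 b2 d2 a2.
have hrN := regular_shift N hr; have [Na NeN NedN NcN NcdN] := hrN.
have Na1 : ~ nonposint (al + 1) by exact: (@nonposintD _ al 1).
have hd : defect (al + 1) b d (e + N%:R) = 0.
  apply: IHM.
  - by rewrite !cReE (@cRe_nat R 1) opprD ltrBlDr natr1.
  - by split.
  - exact: hconv_shift.
  - by right; rewrite !cReE; lra.
rewrite (defect_prat N hr hI hK).
suff -> : defect al b d (e + N%:R) = 0 by rewrite mulr0.
have h : al * (al + 1 - (e + N%:R)) * defect al b d (e + N%:R) = 0.
  rewrite defect_al ?hd ?mulr0 //; rewrite !cReE; lra.
move/eqP: h; rewrite !mulf_eq0 (negPf (nonposint_neq0 Na)) /=.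
case/orP => [/eqP h|/eqP //].
have := congr1 (@complex.Re R) h; rewrite !cReE (@cRe_nat R 1) => h'.
exfalso; move: h'; rewrite /=; lra.
Qed.

End UnitGapTheorem.

(** * The transformation *)

Section Transform.
Variable R : realType.
Local Notation C := (R[i] : numFieldType).
Implicit Types (u w W g : nat -> C) (b d e z l al be s : C).
Local Open Scope classical_set_scope.
Local Open Scope complex_scope.

Definition tfac be d e : C :=
  Gamma e * Gamma (e - be - d) / (Gamma (e - d) * Gamma (e - be)).

(* The sequence [W] is the one with [sum u_n x^n = (1 - x) ^ (- be) * sum W_j x^j]. *)
Definition transforms be d e u := exists W S,
  [/\ conv W (bseq be) =1 u,
      series (fun j => W j * prat d (e - be) j) @ \oo --> (S : C) &
      series (fun n => u n * prat d e n) @ \oo --> (tfac be d e * S : C)].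

Lemma eq_transforms be d e u w : u =1 w -> transforms be d e u -> transforms be d e w.
Proof. by move/funext => ->. Qed.

Lemma transformsD be d e u w : transforms be d e u -> transforms be d e w ->
  transforms be d e (fun n => u n + w n).
Proof.
move=> [W [S [h1 h2 h3]]] [W' [S' [h1' h2' h3']]].
exists (fun j => W j + W' j), (S + S'); split.
- by move=> n; rewrite convD h1 h1'.
- by apply: cvgC_ext (cvg_seriesD h2 h2') => N; apply: eq_bigr => j _; rewrite mulrDl.
- rewrite mulrDr.
  by apply: cvgC_ext (cvg_seriesD h3 h3') => N; apply: eq_bigr => j _; rewrite mulrDl.
Qed.

Lemma transformsZ be d e z u : transforms be d e u ->
  transforms be d e (fun n => z * u n).
Proof.
move=> [W [S [h1 h2 h3]]]; exists (fun j => z * W j), (z * S); split.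
- by move=> n; rewrite convZ h1.
- by apply: cvgC_ext (@cvg_seriesZ _ z _ _ h2) => N; apply: eq_bigr => j _; rewrite mulrA.
- rewrite mulrCA.
  by apply: cvgC_ext (@cvg_seriesZ _ z _ _ h3) => N; apply: eq_bigr => j _; rewrite mulrA.
Qed.

Lemma transforms0 be d e : transforms be d e (fun=> 0).
Proof.
exists (fun=> 0), 0; split.
- by move=> n; rewrite /conv big1 // => j _; rewrite mul0r.
- have := @cvg_series_finite _ (fun=> 0 : C) 0 (fun _ _ => erefl); rewrite big_nil.
  by apply: cvgC_ext => N; apply: eq_bigr => j _; rewrite mul0r.
- have := @cvg_series_finite _ (fun=> 0 : C) 0 (fun _ _ => erefl); rewrite big_nil mulr0.
  by apply: cvgC_ext => N; apply: eq_bigr => j _; rewrite mul0r.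
Qed.

Lemma transforms_sum be d e (I : Type) (r : seq I) (F : I -> nat -> C) :
  (forall i, transforms be d e (F i)) ->
  transforms be d e (fun n => \sum_(i <- r) F i n).
Proof.
move=> hF; elim: r => [|i r IHr].
  by apply: eq_transforms (transforms0 _ _ _) => n; rewrite big_nil.
by apply: eq_transforms (transformsD (hF i) IHr) => n; rewrite big_cons.
Qed.

(** Here (1 - x)^(- (be - s)) = (1 - x)^(- be) (1 - x)^s, so W is [bseq (- s)] and both sums are
    Gauss sums. *)
Lemma transforms_bseq be d e s :
  ~ nonposint e -> ~ nonposint (e - d) ->
  ~ nonposint (e - be) -> ~ nonposint (e - be - d) ->
  ~ nonposint (e - be + s) -> ~ nonposint (e - be + s - d) ->
  hconv (be - s) d e -> hconv (- s) d (e - be) ->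
  transforms be d e (bseq (be - s)).
Proof.
move=> Ne Ned Nb Nbd Ns Nsd h1 h2.
exists (bseq (- s)), (Gamma (e - be) * Gamma (e - be + s - d) /
  (Gamma (e - be + s) * Gamma (e - be - d))); split.
- by move=> n; rewrite bseq_conv addrC.
- have := gauss_sum Nb h2 _ Nbd _; rewrite opprK; exact.
have e1 : e - (be - s) = e - be + s by ring.
have := gauss_sum Ne h1 _ Ned _; rewrite e1 => /(_ Ns Nsd).
have -> : Gamma e * Gamma (e - be + s - d) / (Gamma (e - be + s) * Gamma (e - d)) =
  tfac be d e * (Gamma (e - be) * Gamma (e - be + s - d) /
   (Gamma (e - be + s) * Gamma (e - be - d))); last exact.
rewrite /tfac; have := Gamma_neq0 Ned; have := Gamma_neq0 Nb.
have := Gamma_neq0 Nbd; have := Gamma_neq0 Ns.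
by move=> ? ? ? ?; field; do ?[apply/andP; split => //].
Qed.

Lemma pbound_unshiftn u p k : pbound (fun n => u (n + k)%N) p -> pbound u p.
Proof.
elim: k => [|k IHk] h; first by apply: eq_pbound h => n; rewrite addn0.
by apply: IHk; apply: pbound_unshift; apply: eq_pbound h => n; rewrite addnS.
Qed.

Section Pole.
Variables (al b d e : C).
Hypotheses (hr : regular al b d e) (hI : hconv b d e) (hK : kconv al b d e).
Let v := al + 1 - b.

(** Every factor 1 - x improves the decay of W by one power of j. *)
Lemma pole_coef_bound W (k : nat) (ka : C) :
  (forall j, W (j + k)%N = ka * (poch v j / poch al (j + k).+1)) ->
  pbound W (- complex.Re b - k%:R).
Proof.
have [Na _ _ _ _] := hr; move=> hW.
apply: (@pbound_unshiftn _ _ k).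
apply: (eq_pbound (u := fun n => (ka / poch al k) *
   (prat v (al + k%:R) n * (al + k%:R + n%:R)^-1))).
  move=> n; rewrite hW pochS (addnC n) pochD /prat natrD addrA.
  by rewrite !invfM; ring.
apply: pboundMl; have -> : - complex.Re b - k%:R =
   complex.Re v - complex.Re (al + k%:R) + - 1.
  by rewrite /v !cReE (@cRe_nat R 1); ring.
apply: pboundM; last exact: pbound_linV.
by apply: pbound_prat; exact: nonposintD.
Qed.

(** The invariant for raising the exponent from b - 1 to b + q. The closed form of W from index k on
    is part of it, since it controls the boundary term of the summation by parts. *)
Definition pole_transf (k : nat) := exists W S ka,
  [/\ conv W (bseq (b - 1 + k%:R)) =1 (fun n => bseq b n / (al + n%:R)),
      forall j, W (j + k)%N = ka * (poch v j / poch al (j + k).+1),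
      series (fun j => W j * prat d (e - (b - 1 + k%:R)) j) @ \oo --> (S : C) &
      series (fun n => bseq b n / (al + n%:R) * prat d e n) @ \oo -->
         (tfac (b - 1 + k%:R) d e * S : C)].

Lemma pole_transf0 : pole_transf 0.
Proof.
have [Na Ne Ned Nc Ncd] := hr.
have al0 := nonposint_neq0 Na.
exists (vcoef al b), (limn (series (kterm al b d e))), 1; split.
- move=> n; rewrite addr0.
  have C0 j : poch (al + 1) j != 0 by apply: poch_neq0; exact: (@nonposintD _ al 1).
  have eC : al + 1 = al + 0%:R - (-1) by rewrite opprK addr0.
  (* Euler's transformation of 2F1(al, b; al + 1; x), with [M = 0] and [Q = -1]. *)
  have := euler_transf C0 eC (erefl (b + - 1)) n.
  set w := euler_coef _ _ _ _ _ => hE.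
  have -> : vcoef al b = fun j => al^-1 * w j.
    apply/funext => j; rewrite /w /euler_coef /eulerS big_ord_recl big1 => [|i _].
      rewrite bin0 poch0 subn0 /= add0r opprK addr0 mul1r addr0 /vcoef pochSl.
      have -> : poch 1 j = j`!%:R :> C.
        elim: (j) => [|j' IHj]; first by rewrite poch0.
        by rewrite pochS factS natrM IHj nat1r mulrC.
      rewrite (_ : al + - (b - 1) = al + 1 - b); last by ring.
      by have := factR_neq0 C j; have := C0 j; move=> ? ?; field; do ?[apply/andP; split => //].
    by rewrite /bump /= ?bin_small // !mul0r.
  rewrite convZ hE /bseq.
  have e1 : poch al n * (al + n%:R) = al * poch (al + 1) n by rewrite -pochS pochSl.
  have an := nonposint_bseq0 n Na.
  have -> : poch al n = al * poch (al + 1) n / (al + n%:R) by rewrite -e1 mulfK.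
  by have := factR_neq0 C n; have := C0 n; move=> ? ?; field; do ?[apply/andP; split => //].
- by move=> j; rewrite addn0 mul1r.
- rewrite addr0 (_ : e - (b - 1) = e - b + 1); last by ring.
  exact: fast_lim (fast_kterm hr hK).
- rewrite addr0; have := defect0 hr hI hK; rewrite /defect => /eqP.
  have -> : tfac (b - 1) d e = gfac b d e.
    by rewrite /tfac /gfac (_ : e - (b - 1) = e - b + 1) //; ring.
  rewrite subr_eq0 => /eqP <-.
  apply: cvgC_ext (fast_lim (fast_iterm al Ne hI)) => N; apply: eq_bigr => n _.
  by rewrite /iterm mulrAC.
Qed.

Lemma pole_transfS k : ~ nonposint (e - b - k%:R) -> ~ nonposint (e - b - k%:R - d) ->
  pole_transf k -> pole_transf k.+1.
Proof.
have [Na Ne Ned Nc Ncd] := hr.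
move=> Ny Nyd [W [S [ka [h1 h2 h3 h4]]]].
set be := b - 1 + k%:R in h1 h3 h4.
set y := e - b - k%:R in Ny Nyd.
have ey : e - be = y + 1 by rewrite /be /y; ring.
have ebe : b - 1 + k.+1%:R = be + 1 by rewrite /be -natr1; ring.
have ey1 : e - (be + 1) = y by rewrite opprD addrA ey addrK.
have y0 := nonposint_neq0 Ny; have yd0 := nonposint_neq0 Nyd.
(* The new constant comes from (v + j) - (al + j + k + 1) = - b - k. *)
exists (dseq W), ((y - d) / y * S), (ka * (- b - k%:R)); rewrite ebe.
split.
- by move=> n; rewrite conv_dseq_bseq h1.
- move=> j; rewrite !addnS /dseq -addSn !h2.
  rewrite !addSn [poch al (j + k).+2]pochS [poch v j.+1]pochS.
  have an : al + (j + k).+1%:R != 0 by exact: nonposint_bseq0.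
  have pan := poch_neq0 (j + k).+1 Na.
  rewrite -[(j + k).+1%:R]natr1 natrD in an *.
  by rewrite /v; field; apply/andP.
- rewrite ey1; rewrite ey in h3.
  (* Boundary term of the summation by parts, which uses (d)_j / (y)_j - (d)_(j+1) / (y)_(j+1) = ((y
     - d) / y) (d)_j / (y + 1)_j. *)
  pose H j : C := if j is j'.+1 then W j' * prat d y j else 0.
  have H0 : H @ \oo --> (0 : C).
    apply/cvgC_shift; rewrite /H.
    have hy1 := pbound_shift (pbound_prat d Ny).
    (* Either a series terminates, or the decay gained by W makes up for the smaller lower parameter
       y = e - b - k: the exponent is Re (d - e) for every k. *)
    case: hK => [[[N vN]|[N dN]]|hre].
    + apply: (@pbound_cvg0 _ _ (-1)); first by lra.
      apply: (@pbound_finite _ _ _ (N.+1 + k)) => n Nn.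
      have -> : n = ((n - k) + k)%N by lia.
      by rewrite h2 /v vN poch_natN ?mul0r ?mulr0 ?mul0r //; lia.
    + apply: (@pbound_cvg0 _ _ (-1)); first by lra.
      apply: (@pbound_finite _ _ _ N) => n Nn.
      by rewrite /prat dN poch_natN ?mul0r ?mulr0.
    + apply: pbound_cvg0 (pboundM (pole_coef_bound h2) hy1).
      by move: hre; rewrite /y !cReE; lra.
  have hT := series_telescope H0; rewrite {1}/H subr0 in hT.
  have h := cvg_seriesD (@cvg_seriesZ _ ((y - d) / y) _ _ h3) (@cvg_seriesZ _ (-1) _ _ hT).
  rewrite mulr0 addr0 in h; apply: cvgC_ext h => N; apply: eq_bigr => j _.
  have yj := nonposint_bseq0 j Ny.
  have -> : prat d (y + 1) j = y * prat d y j / (y + j%:R).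
    by rewrite -prat_shift // mulrC mulKf.
  have e2 : prat d y j.+1 = (d + j%:R) * prat d y j / (y + j%:R).
    by rewrite -pratS // mulrC mulKf.
  rewrite /H e2 /dseq; case: j yj {e2} => [|j] yj; by field; rewrite ?nat1r ?y0 ?yj.
- have <- : tfac be d e * S = tfac (be + 1) d e * ((y - d) / y * S); last exact: h4.
  rewrite /tfac ey ey1 (_ : y + 1 - d = y - d + 1); last by ring.
  rewrite (GammaS Ny) (GammaS Nyd).
  have := Gamma_neq0 Ned; have := Gamma_neq0 Ny.
  by move=> ? ?; field; do ?[apply/andP; split => //].
Qed.

Lemma transforms_pole q : ~ nonposint (e - b - q%:R) -> ~ nonposint (e - b - q%:R - d) ->
  transforms (b + q%:R) d e (fun n => bseq b n / (al + n%:R)).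
Proof.
move=> Nq Nqd.
have hk k : (k <= q.+1)%N -> pole_transf k.
  elim: k => [|k IHk] kq; first exact: pole_transf0.
  apply: pole_transfS (IHk (ltnW kq)).
    rewrite (_ : e - b - k%:R = e - b - q%:R + (q - k)%N%:R); first exact: nonposintD.
    by rewrite natrB -1?ltnS //; ring.
  rewrite (_ : e - b - k%:R - d = e - b - q%:R - d + (q - k)%N%:R); first exact: nonposintD.
  by rewrite natrB -1?ltnS //; ring.
have [W [S [ka []]]] := hk q.+1 (leqnn _).
rewrite (_ : b - 1 + q.+1%:R = b + q%:R); last by rewrite -natr1; ring.
move=> h1 _ h3 h4; exists W, S; split; [exact: h1 | exact: h3 | exact: h4].
Qed.

End Pole.
End Transform.

(** * Polynomial division and partial fractions *)

Lemma poly_linear_div (K : fieldType) (P : {poly K}) (c : K) n :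
  (size P <= n.+1)%N ->
  exists2 Q : {poly K}, (size Q <= n)%N & forall x, P.[x] = Q.[x] * (x - c) + P.[c].
Proof.
move=> sP; have /factor_theorem[Q hQ] : root (P - P.[c]%:P) c.
  by rewrite /root !hornerE subrr.
exists Q; last first.
  move=> x; have e : P = Q * ('X - c%:P) + P.[c]%:P by rewrite -hQ subrK.
  by rewrite {1}e hornerD hornerM hornerXsubC hornerC.
have [->|Q0] := eqVneq Q 0; first by rewrite size_poly0.
have : (size (Q * ('X - c%:P))%R <= n.+1)%N.
  rewrite -hQ; apply: leq_trans (size_polyD _ _) _.
  by rewrite geq_max sP size_polyN (leq_trans (size_polyC_leq1 _)).
by rewrite size_Mmonic ?monicXsubC // size_XsubC addn2.
Qed.

(** Newton's form, by successive division by x + b, x + b + 1, and so on. *)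
Lemma poly_poch_basis (K : fieldType) (q : nat) (P : {poly K}) (b : K) :
  (size P <= q.+1)%N ->
  exists c : nat -> K, forall x, P.[x] = \sum_(k < q.+1) c k * poch (b + x) k.
Proof.
elim: q P b => [|q IHq] P b sP.
  exists (fun=> P.[0]) => x; rewrite big_ord1 poch0 mulr1.
  by have /size1_polyC-> := sP; rewrite !hornerE.
have [Q sQ hQ] := poly_linear_div (- b) sP.
have [c hc] := IHq Q (b + 1) sQ.
exists (fun k => if k is k'.+1 then c k' else P.[- b]) => x.
rewrite big_ord_recl poch0 mulr1 hQ addrC; congr (_ + _).
rewrite hc mulr_suml; apply: eq_bigr => k _.
rewrite /= /bump /= add1n pochSl opprK (_ : b + x + 1 = b + 1 + x); ring.
Qed.

Section Span.
Variable R : realType.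
Local Notation C := (R[i] : numFieldType).
Implicit Types (u w W g : nat -> C) (a b d e z l al be s : C).
Local Open Scope classical_set_scope.
Local Open Scope complex_scope.

Lemma bseq_poch b n k : bseq b n * poch (b + n%:R) k = poch b k * bseq (b + k%:R) n.
Proof.
rewrite /bseq mulrAC -pochD addnC pochD mulrA //.
Qed.

Lemma transforms_poly be d e b (q : nat) (P : {poly C}) :
  (forall k, (k <= q)%N -> transforms be d e (fun n => poch b k * bseq (b + k%:R) n)) ->
  (size P <= q.+1)%N -> transforms be d e (fun n => bseq b n * P.[n%:R]).
Proof.
move=> hk /(@poly_poch_basis _ _ _ b)[c hc].
apply: (eq_transforms (u := fun n => \sum_(k < q.+1)
   c k * (poch b k * bseq (b + k%:R) n))).
  move=> n; rewrite hc mulr_sumr; apply: eq_bigr => k _.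
  by rewrite -bseq_poch mulrCA.
by apply: transforms_sum => k; apply: transformsZ; apply: hk; rewrite -ltnS.
Qed.

(** Reduction to simple poles by (p + 1) / (z)_(p+2) = 1 / (z)_(p+1) - 1 / (z + 1)_(p+1), which
    avoids explicit residues. *)
Lemma transforms_inv_poch be d e b al p : ~ nonposint al ->
  (forall i, (i <= p)%N -> transforms be d e (fun n => bseq b n / (al + i%:R + n%:R))) ->
  transforms be d e (fun n => bseq b n / poch (al + n%:R) p.+1).
Proof.
elim: p al => [|p IHp] al Na hT.
  apply: eq_transforms (hT 0%N _) => // n.
  by rewrite pochS poch0 mul1r !addr0.
have p1 : p.+1%:R != 0 :> C by rewrite pnatr_eq0.
have Na1 : ~ nonposint (al + 1) by exact: (@nonposintD _ al 1).
have T1 := IHp al Na (fun i ip => hT i (leqW ip)).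
have T2 : transforms be d e (fun n => bseq b n / poch (al + 1 + n%:R) p.+1).
  by apply: IHp => // i ip; apply: eq_transforms (hT i.+1 ip) => n; rewrite -nat1r addrA.
apply: eq_transforms (transformsZ p.+1%:R^-1 (transformsD T1 (transformsZ (-1) T2))) => n.
have -> : poch (al + n%:R) p.+2 = (al + n%:R) * poch (al + 1 + n%:R) p * (al + n%:R + p.+1%:R).
  by rewrite pochS pochSl [al + 1 + _]addrAC.
have -> : poch (al + n%:R) p.+1 = (al + n%:R) * poch (al + 1 + n%:R) p.
  by rewrite pochSl [al + 1 + _]addrAC.
have -> : poch (al + 1 + n%:R) p.+1 = poch (al + 1 + n%:R) p * (al + n%:R + p.+1%:R).
  by rewrite pochS -[p.+1%:R]nat1r; congr (_ * _); ring.
have h1 := nonposint_bseq0 n Na.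
have h2 : al + n%:R + p.+1%:R != 0 by apply: nonposint_bseq0; exact: nonposintD.
have h3 : poch (al + 1 + n%:R) p != 0 by apply: poch_neq0; exact: nonposintD.
by field; rewrite ?nat1r; do ?[apply/andP; split => //].
Qed.

(** Dividing P by the last factor of (al + n)_p leaves a quotient over (al + n)_(p-1), covered by
    induction, and a constant over the full product. *)
Lemma transforms_frac be d e b al (q p : nat) (P : {poly C}) : ~ nonposint al ->
  (forall k, (k <= q)%N -> transforms be d e (fun n => poch b k * bseq (b + k%:R) n)) ->
  (forall i, (i < p)%N -> transforms be d e (fun n => bseq b n / (al + i%:R + n%:R))) ->
  (size P <= (p + q).+1)%N ->
  transforms be d e (fun n => bseq b n * P.[n%:R] / poch (al + n%:R) p).
Proof.
move=> Na hk; elim: p P => [|p IHp] P hi sP.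
  by apply: eq_transforms (transforms_poly hk sP) => n; rewrite poch0 divr1.
have [Q sQ hQ] := poly_linear_div (- (al + p%:R)) sP.
have T1 := IHp Q (fun i ip => hi i (leqW ip)) sQ.
have T2 := transformsZ P.[- (al + p%:R)] (transforms_inv_poch Na hi).
apply: eq_transforms (transformsD T1 T2) => n.
rewrite (hQ n%:R) pochS.
have h1 : al + n%:R + p%:R != 0 by apply: nonposint_bseq0; exact: nonposintD.
have h3 : poch (al + n%:R) p != 0 by apply: poch_neq0; exact: nonposintD.
by field; apply/andP.
Qed.

(** The sequence (- N)_n / n! has its last nonzero entry at n = N, so a finitely supported sequence
    can be eliminated from the top. *)
Lemma transforms_finite be d e M u :
  (forall N, (N < M)%N -> transforms be d e (bseq (- N%:R))) ->
  (forall n, (M <= n)%N -> u n = 0) -> transforms be d e u.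
Proof.
elim: M u => [|M IHM] u hT u0.
  by apply: eq_transforms (transforms0 _ _ _) => n; rewrite u0.
have hM : bseq (- M%:R : C) M != 0.
  rewrite mulf_neq0 ?invr_eq0 ?factR_neq0 // poch_eq0; apply/existsP => -[j].
  by rewrite eqr_opp eqr_nat => /eqP Mj; have := ltn_ord j; rewrite -Mj ltnn.
pose z := u M / bseq (- M%:R : C) M.
apply: (eq_transforms (u := fun n => (u n - z * bseq (- M%:R) n) + z * bseq (- M%:R) n)).
  by move=> n; rewrite subrK.
apply: transformsD; last by apply: transformsZ; exact: hT.
apply: IHM => [N NM|n]; first by apply: hT; rewrite ltnW.
rewrite leq_eqVlt => /orP[/eqP <-|ltMn]; first by rewrite /z divfK ?subrr.
by rewrite u0 // /bseq poch_natN // mul0r mulr0 subrr.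
Qed.

Theorem transforms_main a b d e (p q : nat) (P : {poly C}) :
  (0 < p)%N ->
  ~ nonposint (a + p%:R) ->
  (forall i, (i < p)%N -> a - b != - i%:R) ->
  ~ nonposint e -> ~ nonposint (e - b - d - q%:R) -> ~ nonposint (e - d) ->
  ~ nonposint (e - b - q%:R) ->
  (nonposint a \/ nonposint b \/ nonposint d) \/
    0 < complex.Re (e - b - d - q%:R) ->
  (nonposint (a - b + 1) \/ nonposint d) \/ 0 < complex.Re (e - d) ->
  (size P <= (p + q).+1)%N ->
  transforms (b + q%:R) d e (fun n => bseq b n * prat a (a + p%:R) n * P.[n%:R]).
Proof.
move=> p0 Nap abN Ne Nebdq Ned Nebq hL hR sP.
have eq1 : e - (b + q%:R) = e - b - q%:R by ring.
have eq2 : e - (b + q%:R) - d = e - b - d - q%:R by ring.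
(* If (a)_p = 0, then a = - M with M < p and some (a + n)_p vanishes, so partial fractions fail; but
   then u_n = 0 for n > M. *)
have [a0|a0] := eqVneq (poch a p) 0.
  have [M [Mp aM]] : exists M, (M < p)%N /\ a = - M%:R.
    by move/eqP: a0; rewrite poch_eq0 => /existsP[i /eqP ->]; exists i.
  apply: (@transforms_finite _ _ _ M.+1) => [N NM|n Mn]; last first.
    by rewrite /prat aM poch_natN // !(mul0r, mulr0).
  have -> : - N%:R = (b + q%:R) - (b + q%:R + N%:R) by ring.
  have e3 : e - (b + q%:R) + (b + q%:R + N%:R) = e + N%:R by ring.
  apply: transforms_bseq => //; rewrite ?eq2 ?e3 ?eq1 //.
  - exact: nonposintD.
  - by rewrite addrAC; exact: nonposintD.
  - by left; left; exists N; ring.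
  - case: hR => [[[N' hN']|hd]|hre]; last 1 first.
    + by right; move: hre; rewrite !cReE; have := ler0n R N; lra.
    (* From a - b + 1 = - N' and a = - M one gets b = N' + 1 - M. The excluded values of a - b force
       p <= N' + 1, so the natural subtraction is exact. *)
    + left; left; exists (q + N + (N'.+1 - M))%N.
      have pN : (p <= N'.+1)%N.
        rewrite leqNgt; apply/negP => lt; have := abN _ lt.
        by rewrite -natr1 opprD -hN' addrK eqxx.
      rewrite !natrD natrB; last by apply: leq_trans pN; exact: ltnW.
      have -> : b = a + 1 + N'%:R by rewrite -[N'%:R]opprK -hN'; ring.
      by rewrite aM -natr1; ring.
    + by left; right.
have Na : ~ nonposint a.
  move=> [M aM]; case: (ltnP M p) => Mp.
    by move/eqP: a0; apply; rewrite aM poch_natN.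
  by apply: Nap; exists (M - p)%N; rewrite natrB // aM; ring.
apply: (eq_transforms (u := fun n => poch a p * (bseq b n * P.[n%:R] / poch (a + n%:R) p))).
  move=> n; have h1 : poch (a + n%:R) p != 0 by apply: poch_neq0; exact: nonposintD.
  have h2 := poch_neq0 n Nap.
  have -> : prat a (a + p%:R) n = poch a p / poch (a + n%:R) p.
    rewrite /prat; apply/eqP; rewrite eqr_div //; apply/eqP.
    by rewrite -!pochD addnC.
  by field.
apply: transformsZ; apply: (transforms_frac Na) sP.
  move=> k kq.
  (* When convergence is due to b = - N, the parameter b + k still terminates the series for k <= N;
     for k > N the factor (b)_k kills the whole term. *)
  have [bk|bk] := eqVneq (poch b k) 0.
    by apply: eq_transforms (transforms0 _ _ _) => n; rewrite bk mul0r.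
  apply: transformsZ.
  have -> : b + k%:R = (b + q%:R) - (q - k)%N%:R by rewrite natrB //; ring.
  apply: transforms_bseq; rewrite ?eq2 ?eq1 //.
  - exact: nonposintD.
  - rewrite (_ : _ - d = e - b - d - q%:R + (q - k)%N%:R); first exact: nonposintD.
    by ring.
  - rewrite (_ : b + q%:R - (q - k)%N%:R = b + k%:R); last by rewrite natrB //; ring.
    case: hL => [[//|[[N bN]|hd]]|hre].
    + left; left; case: (leqP k N) => kN; last by rewrite bN poch_natN // eqxx in bk.
      by exists (N - k)%N; rewrite natrB // bN; ring.
    + by left; right.
    + right; apply: lt_le_trans hre _; rewrite !cReE.
      have kqR : k%:R <= q%:R :> R by rewrite ler_nat.
      lra.
  - by left; left; exists (q - k)%N.
move=> i ip.
have ed2 : e - b + 1 = e - b - q%:R + q.+1%:R by rewrite -natr1; ring.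
apply: transforms_pole; last first.
- by rewrite (_ : _ - d = e - b - d - q%:R) //; ring.
- by [].
(* Termination must hold for al = a + i and not only for a; the excluded values of a - b give i < p
   <= N + 1. *)
- case: hR => [[[N hN]|hd]|hre]; [left; left|by left; right|by right].
  have pN : (p <= N.+1)%N.
    rewrite leqNgt; apply/negP => lt; have := abN _ lt.
    by rewrite -natr1 opprD -hN addrK eqxx.
  have iN : (i <= N)%N by rewrite -ltnS; exact: leq_trans pN.
  by exists (N - i)%N; rewrite natrB // -[N%:R]opprK -hN; ring.
- case: hL => [[//|[hb|hd]]|hre]; [by left; left|by left; right|right].
  by apply: lt_le_trans hre _; rewrite !cReE; have := ler0n R q; lra.
- split=> //.
  + exact: nonposintD.
  + by rewrite ed2; exact: nonposintD.
  + rewrite (_ : _ - d = e - b - d - q%:R + q.+1%:R); first exact: nonposintD.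
    by rewrite -natr1; ring.
Qed.

End Span.

(** * Identification of the coefficients *)

Section PochNat.
Variable K : numFieldType.
Implicit Types (x : K).

Lemma poch_natN_bin (M i : nat) :
  poch (- M%:R : K) i = (-1) ^+ i * 'C(M, i)%:R * i`!%:R.
Proof.
elim: i => [|i IHi]; first by rewrite poch0 bin0 !mulr1.
rewrite pochS IHi exprS factS natrM.
have -> : (-1) * (-1) ^+ i * 'C(M, i.+1)%:R * (i.+1%:R * i`!%:R) =
    (-1) * (-1) ^+ i * (i.+1%:R * 'C(M, i.+1)%:R) * i`!%:R :> K by ring.
rewrite -natrM mul_bin_left.
case: (leqP i M) => [iM|Mi]; last by rewrite bin_small // muln0 !(mulr0, mul0r).
by rewrite natrM natrB //; ring.
Qed.

Lemma poch_natN_fact (l i : nat) : (i <= l)%N ->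
  poch (- l%:R : K) i = (-1) ^+ i * l`!%:R / (l - i)`!%:R.
Proof.
move=> il; rewrite poch_natN_bin -(bin_fact il) !natrM.
by have := factR_neq0 K (l - i) => h; field.
Qed.

Lemma poch_natS_fact (n i : nat) : poch (n.+1%:R : K) i = (n + i)`!%:R / n`!%:R.
Proof.
elim: i => [|i IHi]; first by rewrite poch0 addn0 divff ?factR_neq0.
by rewrite pochS IHi addnS factS natrM -natrD addSn mulrAC -!mulrA mulrC -!mulrA;
  congr (_ * _); rewrite mulrC.
Qed.

Lemma poch_split x (l i : nat) : (i <= l)%N -> poch x l = poch x i * poch (x + i%:R) (l - i).
Proof. by move=> il; rewrite -pochD subnKC. Qed.

Lemma conv_shift (w v : nat -> K) (k n : nat) :
  conv (fun j => if (k <= j)%N then w (j - k)%N else 0) v n =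
  if (k <= n)%N then conv w v (n - k)%N else 0.
Proof.
case: leqP => [kn|nk]; last first.
  by rewrite /conv big1 // => j _; rewrite leqNgt (leq_trans (ltn_ord j)) // mul0r.
rewrite /conv -(big_mkord xpredT (fun j => (if (k <= j)%N then w (j - k)%N else 0) * v (n - j)%N)).
rewrite (@big_cat_nat _ _ _ k) //=; last by apply: leqW.
rewrite [X in X + _]big_nat_cond [X in X + _]big1 ?add0r => [|j /andP[/andP[_ jk] _]]; last first.
  by rewrite leqNgt jk mul0r.
rewrite -{1}[k]add0n big_addn subSn // big_mkord; apply: eq_bigr => j _.
by rewrite leq_addl addnK subnDA subnAC.
Qed.

Lemma conv_sum (I : Type) (r : seq I) (F : I -> nat -> K) v n :
  conv (fun j => \sum_(i <- r) F i j) v n = \sum_(i <- r) conv (F i) v n.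
Proof.
by rewrite /conv exchange_big /=; apply: eq_bigr => j _; rewrite mulr_suml.
Qed.

End PochNat.

Section Coefficients.
Variable R : realType.
Local Notation C := (R[i] : numFieldType).
Variables (a b : C) (p q : nat) (Ck : nat -> C).
Hypotheses (p_gt0 : (0 < p)%N) (Nap : ~ nonposint (a + p%:R)).
Local Notation m := (p + q)%N.
Hypothesis abN : forall i, (i < m)%N -> a - b - q%:R + i%:R != 0.

(** The contribution of the k-th falling factorial of n, which shifts the series to 2F1(a + k, b +
    k; a + p + k; x). Euler's transformation with M = m - k and Q = q - k gives the exponent (b + k)
    + (q - k) = b + q for each k, so the transformed series add up. *)
Definition wterm (k j : nat) : C :=
  poch a k * poch b k / poch (a + p%:R) k *
  euler_coef (m - k) (q%:R - k%:R) (a + k%:R) (a + p%:R + k%:R) (b + q%:R) (j - k).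

Definition wcoef (j : nat) : C :=
  \sum_(k < m.+1) Ck k * (if (k <= j)%N then wterm k j else 0).

Lemma wcoef_conv (n : nat) :
  conv wcoef (bseq (b + q%:R)) n = bseq b n * prat a (a + p%:R) n *
    \sum_(k < m.+1) Ck k * (if (k <= n)%N then n`!%:R / (n - k)`!%:R else 0).
Proof.
rewrite /wcoef conv_sum mulr_sumr; apply: eq_bigr => k _.
rewrite convZ mulrCA; congr (_ * _).
have kM : (k <= m)%N by rewrite -ltnS.
set w := (X in conv X).
have -> : w = fun j => poch a k * poch b k / poch (a + p%:R) k * (if (k <= j)%N then
   euler_coef (m - k) (q%:R - k%:R) (a + k%:R) (a + p%:R + k%:R) (b + q%:R) (j - k) else 0).
  by apply/funext => j; rewrite /w /wterm; case: leqP => //; rewrite mulr0.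
rewrite convZ conv_shift; case: leqP => [kn|_]; last by rewrite !mulr0.
rewrite (@euler_transf _ _ _ (b + k%:R)); last first.
- by ring.
- by rewrite natrB // natrD; ring.
- by move=> i; apply: poch_neq0; exact: nonposintD.
rewrite /bseq /prat (poch_split a kn) (poch_split b kn) (poch_split (a + p%:R) kn).
have h1 := poch_neq0 k Nap; have h2 := poch_neq0 (n - k) (@nonposintD _ _ k Nap).
have h3 := factR_neq0 C n; have h4 := factR_neq0 C (n - k).
by field; do ?[apply/andP; split => //].
Qed.

Lemma wtermE (k j : nat) : (k <= j)%N -> wterm k j = poch a k * poch b k / poch (a + p%:R) j *
  \sum_(i < (j - k).+1) 'C(m - k, i)%:R * poch (- b - q%:R) i *
    (poch (i%:R + k%:R - q%:R) (j - k - i) *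
     poch (a - b - q%:R + k%:R + i%:R) (j - k - i) / (j - k - i)`!%:R).
Proof.
move=> kj; rewrite /wterm /euler_coef /eulerS (poch_split (a + p%:R) kj) !mulrA invfM !mulrA.
congr (_ * _); apply: eq_bigr => i _.
rewrite (_ : - (b + q%:R) = - b - q%:R); last by ring.
rewrite (_ : i%:R - (q%:R - k%:R) = i%:R + k%:R - q%:R); last by ring.
by rewrite (_ : a + k%:R + (- b - q%:R) + i%:R = a - b - q%:R + k%:R + i%:R); last by ring.
Qed.

Lemma poch_ab_neq0 (k i : nat) : (k + i <= m)%N -> poch (a - b - q%:R + k%:R) i != 0.
Proof.
move=> kim; rewrite poch_eq0; apply/existsP => -[j /eqP h].
have := abN (i := (k + j)%N); rewrite natrD addrA h addNr eqxx => H.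
have ji := ltn_ord j; have /H // : (k + j < m)%N.
by apply: leq_trans kim; rewrite ltn_add2l.
Qed.

Lemma wcoef_Qhat0 (j : nat) : Ck 0 = 1 -> (j <= q)%N ->
  wcoef j = poch (- q%:R) j * poch (a - b - q%:R) j /
    (poch (a + p%:R) j * j`!%:R) * Qhat0 a b m q Ck j.
Proof.
move=> Ck0 jq.
have pj := poch_neq0 j Nap.
have -> : wcoef j = \sum_(k < j.+1) Ck k * wterm k j.
  rewrite /wcoef -(big_mkord xpredT (fun k => Ck k * wterm k j)).
  rewrite -(big_mkord xpredT (fun k => Ck k * (if (k <= j)%N then wterm k j else 0))).
  rewrite (@big_cat_nat _ _ _ j.+1) //=; last by lia.
  rewrite [X in _ + X]big_nat_cond [X in _ + X]big1 ?addr0 => [|k]; last first.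
    by move=> /andP[/andP[jk _] _]; rewrite leqNgt jk mulr0.
  by apply: eq_big_nat => k /andP[_]; rewrite ltnS => ->.
(* The value 1 prescribed at 0 agrees with the general formula because C_0 = 1. *)
rewrite /Qhat0; case: eqP => [->|_].
  by rewrite big_ord1 Ck0 /wterm /euler_coef /eulerS big_ord1 bin0 !poch0; field.
rewrite big_mkord mulr_sumr; apply: eq_bigr => -[k /= kj] _; rewrite ltnS in kj.
rewrite wtermE // big_mkord !mulr_sumr.
apply: eq_bigr => -[i /= ij] _; rewrite ltnS in ij.
rewrite /hyper_coef !big_cons !big_nil !mulr1.
set l := (j - k)%N in ij *.
have El : j = (k + l)%N by rewrite /l subnKC.
have n1 : poch (- q%:R : C) j != 0.
  rewrite poch_natN_fact // !mulf_neq0 ?invr_eq0 ?factR_neq0 //.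
  by rewrite expf_neq0 // oppr_eq0 oner_neq0.
have n2 : poch (a - b - q%:R) j != 0.
  by have := @poch_ab_neq0 0 j; rewrite addr0; apply; lia.
move: n1 n2; rewrite (poch_split (- q%:R) kj) (poch_split (a - b - q%:R) kj) -/l.
rewrite (poch_split (- q%:R + k%:R) ij) (poch_split (a - b - q%:R + k%:R) ij).
rewrite !mulf_eq0 !negb_or => /andP[n1 /andP[n2 _]] /andP[n3 /andP[n4 _]].
rewrite (poch_natN_fact _ kj) -/l.
have -> : k%:R - m%:R = - (m - k)%N%:R :> C by rewrite natrB; [ring|lia].
have -> : k%:R - j%:R = - l%:R :> C by rewrite /l natrB; [ring|lia].
rewrite (poch_natN_bin _ (m - k)) (poch_natN_fact _ ij).
rewrite (_ : k%:R - q%:R = - q%:R + k%:R); last by ring.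
rewrite (_ : i%:R + k%:R - q%:R = - q%:R + k%:R + i%:R); last by ring.
have h1 := factR_neq0 C j; have h2 := factR_neq0 C l; have h3 := factR_neq0 C i.
have h4 := factR_neq0 C (l - i).
have hk : (-1) ^+ k * (-1) ^+ k = 1 :> C by rewrite -expr2 sqrr_sign.
have hi : (-1) ^+ i * (-1) ^+ i = 1 :> C by rewrite -expr2 sqrr_sign.
set X := poch (- q%:R + k%:R + i%:R) _; set Y := poch (a - b - q%:R + k%:R + i%:R) _.
(* Signs are gathered into squares, since [field] does not know that these equal 1. The same device
   recurs below. *)
transitivity (((-1) ^+ k * (-1) ^+ k) * ((-1) ^+ i * (-1) ^+ i) *
  (Ck k * (poch a k * poch b k / poch (a + p%:R) j *
   ('C(m - k, i)%:R * poch (- b - q%:R) i * (X * Y / (l - i)`!%:R))))).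
  by rewrite hk hi !mul1r.
by field; do ?[apply/andP; split => //].
Qed.

End Coefficients.

(** * The coefficients of index greater than q *)

Section RhatCoefficients.
Variable R : realType.
Local Notation C := (R[i] : numFieldType).

Lemma pFq_finite (us ls : seq C) N :
  (forall n, (N <= n)%N -> hyper_coef us ls n = 0) ->
  pFq us ls 1 = \sum_(i < N) hyper_coef us ls i.
Proof.
move=> h; rewrite /pFq.
have -> : (fun n => hyper_coef us ls n * 1 ^+ n) = hyper_coef us ls.
  by apply/funext => n; rewrite expr1n mulr1.
by rewrite (cvgC_lim (cvg_series_finite h)) big_mkord.
Qed.

Lemma hyper_coef_natN (us ls : seq C) N n :
  - N%:R \in us -> (N < n)%N -> hyper_coef us ls n = 0.
Proof.
move=> hu Nn; rewrite /hyper_coef (big_rem _ hu) /= poch_natN //.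
by rewrite mul0r mul0r.
Qed.

Variables (a b : C) (p q : nat) (Ck : nat -> C).
Hypotheses (p_gt0 : (0 < p)%N) (Nap : ~ nonposint (a + p%:R)).
Local Notation m := (p + q)%N.
Hypothesis abN : forall i, (i < m)%N -> a - b - q%:R + i%:R != 0.

Lemma poch_ba : poch (b - a) q.+1 = (-1) ^+ q.+1 * poch (a - b - q%:R) q.+1.
Proof.
rewrite -[b - a]opprB poch_opp; congr (_ * poch _ _).
by rewrite -natr1; ring.
Qed.

Lemma poch_ba_neq0 : poch (b - a) q.+1 != 0.
Proof.
rewrite poch_ba mulf_neq0 ?expf_neq0 ?oppr_eq0 ?oner_neq0 //.
have := @poch_ab_neq0 _ a b p q abN 0 q.+1; rewrite addr0; apply; lia.
Qed.

Lemma wcoef_low (k t : nat) : (k <= q)%N ->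
  wterm a b p q k (q.+1 + t) =
  poch (b - a) q.+1 * poch (a - b + 1) t / poch (a + p%:R) (q.+1 + t) *
  (poch b q.+1 / poch (b - a) q.+1 *
    (poch (- m%:R + k%:R) (q - k).+1 * poch a k / (q - k).+1`!%:R *
     pFq [:: 1 - m%:R + q%:R; - t%:R; 1 - b - k%:R]
         [:: a - b + 1; 2 - k%:R + q%:R] 1)).
Proof.
move=> kq; rewrite wtermE; last by lia.
have hN n : (t.+1 <= n)%N -> hyper_coef [:: 1 - m%:R + q%:R; - t%:R; 1 - b - k%:R]
         [:: a - b + 1; 2 - k%:R + q%:R] n = 0 :> C.
  by move=> tn; apply: (@hyper_coef_natN _ _ t); rewrite // !inE eqxx orbT.
rewrite (pFq_finite hN).
(* For i <= q - k the symbol with base i + k - q starts at a nonpositive integer and runs through 0.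
   Hence the sum really starts at i = q - k + 1, which accounts for the shifted parameters of the
   first 3F2 in [Rhat]. *)
have -> : ((q.+1 + t - k).+1 = (q - k).+1 + t.+1)%N by lia.
rewrite big_split_ord /= big1 ?add0r => [|[i /= ik] _]; last first.
  have -> : i%:R + k%:R - q%:R = - (q - k - i)%N%:R :> C.
    by rewrite !natrB; [ring|lia|lia].
  by rewrite poch_natN ?mul0r ?mulr0 //; lia.
rewrite !mulr_sumr; apply: eq_bigr => -[i /= it] _; rewrite ltnS in it.
have -> : (q.+1 + t - k - ((q - k).+1 + i) = t - i)%N by lia.
rewrite /hyper_coef !big_cons !big_nil !mulr1.
set s := (q - k).+1.
have Es : q%:R = k%:R + s%:R - 1 :> C by rewrite /s -natr1 natrB //; ring.
have -> : (s + i)%N%:R + k%:R - q%:R = i.+1%:R :> C by rewrite Es natrD -natr1; ring.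
have -> : a - b - q%:R + k%:R + (s + i)%N%:R = a - b + 1 + i%:R by rewrite Es natrD; ring.
have -> : - m%:R + k%:R = - (m - k)%N%:R :> C by rewrite natrB; [ring|lia].
have -> : 1 - m%:R + q%:R = - (m - k)%N%:R + s%:R :> C.
  by rewrite natrB; [rewrite Es; ring|lia].
have -> : 2 - k%:R + q%:R = s.+1%:R :> C by rewrite Es -natr1; ring.
have eb : poch b q.+1 = poch b k * poch (b + k%:R) s by rewrite -pochD /s; congr poch; lia.
have e1 : poch (- b - q%:R) (s + i) = (-1) ^+ s * poch (b + k%:R) s * poch (1 - b - k%:R) i.
  rewrite pochD -opprD poch_opp; congr (_ * poch _ _ * poch _ _); rewrite Es; ring.
have e2 : 'C(m - k, s + i)%:R = (-1) ^+ (s + i) * (poch (- (m - k)%N%:R) s *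
    poch (- (m - k)%N%:R + s%:R) i) / (s + i)`!%:R :> C.
  rewrite -pochD poch_natN_bin -!mulrA divff ?factR_neq0 // mulr1 mulrA.
  by rewrite -expr2 sqrr_sign mul1r.
rewrite eb e1 e2 exprD.
rewrite (poch_natS_fact _ s) (poch_natS_fact _ i) (poch_natN_fact _ it).
have -> : (i + (t - i) = t)%N by lia.
rewrite (poch_split (a - b + 1) it).
have ss : (-1) ^+ s * (-1) ^+ s = 1 :> C by rewrite -expr2 sqrr_sign.
have h1 := factR_neq0 C i; have h2 := factR_neq0 C s; have h3 := factR_neq0 C (s + i).
have h4 := factR_neq0 C (t - i); have h5 := factR_neq0 C t.
have h6 := poch_neq0 (q.+1 + t) Nap; have h7 := poch_ba_neq0.
(* Where the upper symbol (1 - m + q)_i is nonzero, i is small enough for the lower symbol (a - b +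
   1)_i to be nonzero; elsewhere both sides are 0. *)
have [e0|e0] := eqVneq (poch (- (m - k)%N%:R + s%:R) i : C) 0.
  by rewrite e0 !(mulr0, mul0r).
have h8 : poch (a - b + 1) i != 0.
  have im : (i + s <= m - k)%N.
    rewrite leqNgt; apply/negP => lt; move/eqP: e0; apply.
    case: (leqP s (m - k)) => sm.
      have -> : - (m - k)%N%:R + s%:R = - (m - k - s)%N%:R :> C by rewrite [(m - k - s)%N%:R]natrB //; ring.
      by rewrite poch_natN //; lia.
    by move: sm; rewrite /s; lia.
  have := @poch_ab_neq0 _ a b p q abN q.+1 i; rewrite -natr1 addrA subrK; apply.
  by move: im; rewrite /s; lia.
transitivity (((-1) ^+ s * (-1) ^+ s) * (poch a k * poch b k / poch (a + p%:R) (q.+1 + t) *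
  ((-1) ^+ i * (poch (- (m - k)%N%:R) s * poch (- (m - k)%N%:R + s%:R) i) / (s + i)`!%:R *
   (poch (b + k%:R) s * poch (1 - b - k%:R) i) *
   (t`!%:R / i`!%:R * poch (a - b + 1 + i%:R) (t - i) / (t - i)`!%:R)))).
  by ring.
rewrite ss mul1r.
by field; do ?[apply/andP; split => //].
Qed.

Lemma wcoef_high (k t : nat) : (q < k)%N -> (k <= m)%N ->
  poch (b - a) q.+1 * poch (a - b + 1) t / poch (a + p%:R) (q.+1 + t) *
  ((-1) ^+ k * poch a k * poch b k * poch (- t%:R) (k - q.+1) /
        (poch (a - b - q%:R) k * (k - q.+1)`!%:R) *
        pFq [:: - m%:R + k%:R; - (q.+1 + t)%N%:R + k%:R; - b - q%:R]
            [:: a - b - q%:R + k%:R; k%:R - q%:R] 1) =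
  if (k <= q.+1 + t)%N then wterm a b p q k (q.+1 + t) else 0.
Proof.
move=> qk km; case: leqP => kj; last first.
  by rewrite poch_natN ?(mulr0, mul0r) //; lia.
rewrite wtermE; last by lia.
set j := (q.+1 + t)%N; set l := (j - k)%N.
have El : j = (k + l)%N by rewrite /l subnKC.
have ej : - j%:R + k%:R = - l%:R :> C by rewrite El natrD; ring.
have hN n : (l.+1 <= n)%N -> hyper_coef [:: - m%:R + k%:R; - j%:R + k%:R; - b - q%:R]
            [:: a - b - q%:R + k%:R; k%:R - q%:R] n = 0 :> C.
  by move=> tn; apply: (@hyper_coef_natN _ _ l); rewrite // !inE ej eqxx orbT.
rewrite (pFq_finite hN) !mulr_sumr; apply: eq_bigr => -[i /= il] _; rewrite ltnS in il.
rewrite /hyper_coef !big_cons !big_nil !mulr1 ej.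
have -> : - m%:R + k%:R = - (m - k)%N%:R :> C by rewrite natrB //; ring.
rewrite poch_ba (_ : poch (a - b + 1) t = poch (a - b - q%:R + q.+1%:R) t); last first.
  by congr poch; rewrite -natr1; ring.
pose g := (k - q.+1)%N; rewrite -/g.
have Eg : k = (q.+1 + g)%N by rewrite /g subnKC.
have Et : t = (g + l)%N by move: El; rewrite /j Eg; lia.
have pj : poch (a - b - q%:R) q.+1 * poch (a - b - q%:R + q.+1%:R) t =
   poch (a - b - q%:R) k * poch (a - b - q%:R + k%:R) i *
   poch (a - b - q%:R + k%:R + i%:R) (l - i).
  rewrite (_ : a - b - q%:R + k%:R + i%:R = a - b - q%:R + (k + i)%N%:R); last by rewrite natrD addrA.
  by rewrite -!pochD; congr poch; lia.
rewrite poch_natN_fact; last by lia.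
have -> : (t - g = l)%N by lia.
rewrite (poch_natN_bin _ (m - k)) (poch_natN_fact _ il).
have -> : k%:R - q%:R = g.+1%:R :> C by rewrite Eg natrD -!natr1; ring.
have -> : i%:R + k%:R - q%:R = (g + i).+1%:R :> C by rewrite Eg -!natr1 !natrD -?natr1; ring.
rewrite !poch_natS_fact.
have -> : (g + i + (l - i) = t)%N by lia.
(* Beyond m - k both terms vanish; up to m - k the lower parameter a - b - q + k gives no zero. *)
have [im|im] := leqP i (m - k); last first.
  by rewrite bin_small // !(mulr0, mul0r).
have n1 : poch (a - b - q%:R + k%:R) i != 0 by apply: (poch_ab_neq0 abN); lia.
have n2 : poch (a - b - q%:R) k != 0.
  by have := @poch_ab_neq0 _ a b p q abN 0 k; rewrite addr0; apply; lia.
have sk : (-1) ^+ q.+1 * (-1) ^+ k * (-1) ^+ g = 1 :> C.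
  by rewrite {1}Eg exprD mulrA -expr2 sqrr_sign mul1r -expr2 sqrr_sign.
have si : (-1) ^+ i * (-1) ^+ i = 1 :> C by rewrite -expr2 sqrr_sign.
have h1 := factR_neq0 C i; have h2 := factR_neq0 C g; have h3 := factR_neq0 C (g + i).
have h4 := factR_neq0 C (l - i); have h5 := factR_neq0 C t; have h6 := factR_neq0 C l.
have h7 := poch_neq0 j Nap.
set X := poch (a - b - q%:R + k%:R + i%:R) (l - i) in pj *.
transitivity (((-1) ^+ q.+1 * (-1) ^+ k * (-1) ^+ g) * ((-1) ^+ i * (-1) ^+ i) *
  (poch (a - b - q%:R) q.+1 * poch (a - b - q%:R + q.+1%:R) t) / poch (a + p%:R) j *
  (poch a k * poch b k * t`!%:R / (poch (a - b - q%:R) k * g`!%:R) *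
   ('C(m - k, i)%:R * i`!%:R / (l - i)`!%:R * poch (- b - q%:R) i) /
   (poch (a - b - q%:R + k%:R) i * ((g + i)`!%:R / g`!%:R) * i`!%:R))).
  by field; do ?[apply/andP; split => //].
rewrite sk si pj.
by field; do ?[apply/andP; split => //].
Qed.

Lemma wcoef_Rhat (t : nat) :
  wcoef a b p q Ck (q.+1 + t) =
  poch (b - a) q.+1 * poch (a - b + 1) t / poch (a + p%:R) (q.+1 + t) *
  Rhat a b m q Ck (- (q.+1 + t)%N%:R).
Proof.
rewrite /Rhat mulrDr /wcoef.
rewrite -(big_mkord xpredT
  (fun k => Ck k * (if (k <= q.+1 + t)%N then wterm a b p q k (q.+1 + t) else 0))).
rewrite (@big_cat_nat _ _ _ q.+1) //=; last by lia.
have et : - (q.+1 + t)%N%:R + q%:R + 1 = - t%:R :> C by rewrite natrD -natr1; ring.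
congr (_ + _).
  rewrite !mulr_sumr; apply: eq_big_nat => k /andP[_]; rewrite ltnS => kq.
  rewrite ifT; last by lia.
  by rewrite wcoef_low // et; ring.
rewrite !mulr_sumr; apply: eq_big_nat => k /andP[qk]; rewrite ltnS => km.
by rewrite -wcoef_high // et; ring.
Qed.

(** At t = - q - 1 each 3F2 that matters has an upper parameter 0 and equals 1. In the second sum
    (0)_(k-q-1) leaves only k = q + 1, which supplies the last term of the single sum. *)
Lemma Rhat_value :
  Rhat a b m q Ck (- q%:R - 1) = poch b q.+1 / poch (b - a) q.+1 *
      \sum_(0 <= k < q.+2)
         poch (- m%:R + k%:R) (q.+1 - k) * poch a k * Ck k / (q.+1 - k)`!%:R.
Proof.
have et : - q%:R - 1 + q%:R + 1 = - 0%:R :> C by ring.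
have hN us ls n : (1 <= n)%N -> (- 0%:R : C) \in us -> hyper_coef us ls n = 0 :> C.
  by move=> n1 hu; apply: (hyper_coef_natN _ hu).
have h0 us ls : hyper_coef us ls 0 = 1 :> C.
  rewrite /hyper_coef !big1_seq => [|i _|i _]; rewrite ?poch0 //.
  by rewrite mulr1 divr1.
have p1 us ls : (- 0%:R : C) \in us -> pFq us ls 1 = 1 :> C.
  move=> hu; rewrite (@pFq_finite _ _ 1) => [|n n1]; last exact: hN.
  by rewrite big_ord1 h0.
rewrite /Rhat et [in RHS]big_nat_recr //= mulrDr; congr (_ + _).
  congr (_ * _); apply: eq_big_nat => k /andP[_]; rewrite ltnS => kq.
  by rewrite p1 ?mulr1 ?subSn // !inE eqxx orbT.
rewrite big_ltn; last by lia.
rewrite big_nat_cond big1 ?addr0 => [|k /andP[/andP[qk km] _]]; last first.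
  by rewrite poch_natN ?(mulr0, mul0r) //; lia.
rewrite p1; last first.
  by rewrite !inE (_ : - q%:R - 1 + q.+1%:R = - 0%:R) ?eqxx ?orbT // -natr1; ring.
rewrite !subnn !poch0 poch_ba.
have h := @poch_ab_neq0 _ a b p q abN 0 q.+1; rewrite addr0 in h.
have {}h : poch (a - b - q%:R) q.+1 != 0 by apply: h; lia.
have s1 : (-1) ^+ q.+1 * (-1) ^+ q.+1 = 1 :> C by rewrite -expr2 sqrr_sign.
have s0 : (-1) ^+ q.+1 != 0 :> C by rewrite expf_neq0 // oppr_eq0 oner_neq0.
apply: (mulfI s0); rewrite fact0 !mulr1 !mulrA s1.
by field; do ?[apply/andP; split => //].
Qed.

End RhatCoefficients.

(** * Newton interpolation of P and the coefficients C_k *)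

Section Interpolation.
Variable K : numFieldType.

(** This is exp(x) exp(- x) = 1. *)
Lemma conv_exp_inv (n : nat) :
  conv (fun i => i`!%:R^-1) (fun i => (-1) ^+ i / i`!%:R) n = (n == 0)%:R :> K.
Proof.
transitivity ((1 - 1) ^+ n / n`!%:R : K); last first.
  by rewrite subrr expr0n; case: n => [|n]; rewrite ?mul0r // divr1.
rewrite exprBn mulr_suml /conv (reindex_inj rev_ord_inj) /=.
apply: eq_bigr => -[i /= lti] _; have il : (i <= n)%N by rewrite -ltnS.
rewrite subSS subKn // !expr1n !mulr1 -mulr_natr -(bin_fact il) !natrM.
have h1 := factR_neq0 K i; have h2 := factR_neq0 K (n - i).
have h3 : 'C(n, i)%:R != 0 :> K by rewrite pnatr_eq0 -lt0n bin_gt0.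
by field; do ?[apply/andP; split => //].
Qed.

(** If c_k are the coordinates of P in the falling factorials, then the series of P(n) x^n / n! is
    exp(x) times that of c_k x^k; multiplying by exp(- x) recovers them. *)
Lemma newton_coef (P : {poly K}) (m : nat) : (size P <= m.+1)%N ->
  forall n : nat, P.[n%:R] = \sum_(k < m.+1)
    conv (fun i => P.[i%:R] / i`!%:R) (fun i => (-1) ^+ i / i`!%:R) k *
    (if (k <= n)%N then n`!%:R / (n - k)`!%:R else 0).
Proof.
move=> sP.
have sQ : (size (P \Po (- 'X))%R <= m.+1)%N by rewrite size_comp_poly2 // size_polyN size_polyX.
(* At - n, the Pochhammer basis for P(- x) becomes the falling factorials of n up to sign. *)
have [c hc] := poly_poch_basis 0 sQ.
have hP n : P.[n%:R] = \sum_(l < m.+1) (-1) ^+ l * c l *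
    (if (l <= n)%N then n`!%:R / (n - l)`!%:R else 0).
  have := hc (- n%:R); rewrite horner_comp !hornerE opprK => ->.
  apply: eq_bigr => l _; rewrite ?add0r; case: leqP => ln; last by rewrite poch_natN // !mulr0.
  by rewrite poch_natN_fact //; ring.
move=> n; rewrite {1}hP; apply: eq_bigr => k _; congr (_ * _).
have -> : (fun i => P.[i%:R] / i`!%:R) = fun i => \sum_(l < m.+1) ((-1) ^+ l * c l) *
     (if (l <= i)%N then (i - l)`!%:R^-1 else 0).
  apply/funext => i; rewrite hP mulr_suml; apply: eq_bigr => l _.
  case: leqP => _; last by rewrite !mulr0 mul0r.
  by have := factR_neq0 K i; have := factR_neq0 K (i - l) => ? ?; field; apply/andP.
rewrite conv_sum (bigD1 k) //= big1 ?addr0 => [|l lk].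
  rewrite convZ (conv_shift (fun i => i`!%:R^-1)) leqnn subnn.
  by rewrite conv_exp_inv mulr1.
rewrite convZ (conv_shift (fun i => i`!%:R^-1)); case: leqP => lek; last by rewrite mulr0.
rewrite conv_exp_inv; case: eqP => [/eqP|]; last by rewrite mulr0.
by rewrite subn_eq0 => kl; case/eqP: lk; apply/val_inj/eqP; rewrite eqn_leq lek kl.
Qed.

Variables (r : nat) (mm : 'I_r -> nat) (f : 'I_r -> K).

Definition shift_poly : {poly K} :=
  \prod_(j < r) ((poch (f j) (mm j))^-1 *: \prod_(i < mm j) ('X + (f j + i%:R)%:P)).

Lemma size_shift_poly : (size shift_poly <= (\sum_(j < r) mm j).+1)%N.
Proof.
rewrite /shift_poly; elim/big_ind2 : _ => [|P s Q t hP hQ|j _].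
- by rewrite size_poly1.
- apply: leq_trans (size_polyMleq _ _) _; lia.
apply: leq_trans (size_scale_leq _ _) _.
elim: (mm j) => [|k IHk]; first by rewrite big_ord0 size_poly1.
rewrite big_ord_recr /=; apply: leq_trans (size_polyMleq _ _) _.
by rewrite size_XaddC addn2 /= ltnS.
Qed.

Lemma shift_polyE (n : nat) :
  (forall j, poch (f j) (mm j) != 0) -> (forall j, poch (f j) n != 0) ->
  \prod_(u <- [seq f j + (mm j)%:R | j : 'I_r]) poch u n /
  \prod_(l <- [seq f j | j : 'I_r]) poch l n = shift_poly.[n%:R].
Proof.
move=> hm hn; rewrite !big_image /= -prodf_div horner_prod; apply: eq_bigr => j _.
rewrite hornerZ horner_prod.
have -> : \prod_(i < mm j) ('X + (f j + i%:R)%:P).[n%:R] = poch (f j + n%:R) (mm j).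
  by apply: eq_bigr => i _; rewrite hornerD hornerX hornerC addrCA addrA.
have e : poch (f j) (mm j) * poch (f j + (mm j)%:R) n =
   poch (f j) n * poch (f j + n%:R) (mm j) by rewrite -!pochD addnC.
rewrite [RHS]mulrC; apply/eqP; rewrite eqr_div //; apply/eqP.
by rewrite mulrC e mulrC.
Qed.

End Interpolation.

Section Final.
Variable R : realType.
Local Notation C := (R[i] : numFieldType).

(** The terminating series defining C_k is the k-th forward difference of P at 0 divided by k!, that
    is, a Newton coefficient. *)
Lemma CcoefE (r : nat) (mm : 'I_r -> nat) (f : 'I_r -> C) (m k : nat) :
  (forall j, poch (f j) m != 0) -> (forall j, (mm j <= m)%N) -> (k <= m)%N ->
  Ccoef f mm k = conv (fun i => (shift_poly mm f).[i%:R] / i`!%:R)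
                      (fun i => (-1) ^+ i / i`!%:R) k.
Proof.
move=> fm mmle km.
have fn n j : (n <= m)%N -> poch (f j) n != 0.
  by move=> nm; have := fm j; rewrite (poch_split _ nm) mulf_eq0 negb_or => /andP[].
rewrite /Ccoef (@pFq_finite _ _ _ k.+1) => [|n kn]; last first.
  by apply: (@hyper_coef_natN _ _ _ k); rewrite // inE eqxx.
rewrite mulr_sumr; apply: eq_bigr => -[i /= ik] _; rewrite ltnS in ik.
have im := leq_trans ik km.
rewrite -shift_polyE => [|j|j]; [|exact: fn|exact: fn].
rewrite /hyper_coef big_cons poch_natN_fact //.
have h0 : \prod_(l <- [seq f j | j : 'I_r]) poch l i != 0.
  by rewrite big_image /=; apply/prodf_neq0 => j _; exact: fn.
have h1 := factR_neq0 C i; have h2 := factR_neq0 C (k - i); have h3 := factR_neq0 C k.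
have -> : (-1) ^+ k = (-1) ^+ (k - i) * (-1) ^+ i :> C by rewrite -exprD subnK.
have hi : (-1) ^+ i * (-1) ^+ i = 1 :> C by rewrite -expr2 sqrr_sign.
set X := \prod_(_ <- _) _; set Y := \prod_(_ <- _) _ in h0 *.
transitivity (((-1) ^+ i * (-1) ^+ i) * (X / Y / i`!%:R * ((-1) ^+ (k - i) / (k - i)`!%:R))).
  by field; do ?[apply/andP; split => //].
by rewrite hi mul1r.
Qed.

End Final.

Theorem theorem6 (R : realType) (a b d e : R[i]) (r : nat)
    (mm : 'I_r -> nat) (m : nat) (f : 'I_r -> R[i]) (q : nat)
    (gamma : seq R[i])
    (r_gt0 : (0 < r)%N)
    (mm_gt0 : forall j, (0 < mm j)%N)
    (def_m : m = (\sum_(j < r) mm j)%N)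
    (q_lt_m : (q < m)%N)
    (a_ok : ~ nonposint (a + m%:R - q%:R))
    (ab_ok : forall z : int, q%:Z + 1 - m%:Z <= z <= q%:Z -> a - b != z%:~R)
    (fa_ok : forall (j : 'I_r) (z : int),
        m%:Z - q%:Z - (mm j)%:Z <= z <= 0 -> f j - a != z%:~R)
    (* the coefficients C_{k,r}, 0 <= k <= m, are defined *)
    (C_def : forall j, poch (f j) m != 0)
    (* the values of Gamma are defined *)
    (e_ok : ~ nonposint e)
    (ebdq_ok : ~ nonposint (e - b - d - q%:R))
    (ed_ok : ~ nonposint (e - d))
    (ebq_ok : ~ nonposint (e - b - q%:R))
    (eb_ok : ~ nonposint (e - b + 1))
    (* the series on the left is defined *)
    (lhs_lower : forall j, lower_ok [:: a; b; d] (f j))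
    (lhs_cvg : has_nonposint [:: a; b; d] \/
               0 < complex.Re (e - b - d - q%:R))
    (* gamma lists the roots of the polynomial Rhat of degree m - q - 1 *)
    (gamma_size : size gamma = (m - q - 1)%N)
    (gamma_roots : exists2 kappa : R[i], kappa != 0 &
        forall t : R[i], Rhat a b m q (Ccoef f mm) t =
                         kappa * \prod_(g <- gamma) (t - g))
    (* the series on the right is defined *)
    (rhs_lower : forall g, g \in gamma ->
        lower_ok [:: a - b + 1; d + q%:R + 1] (g + q%:R + 1))
    (rhs_cvg : has_nonposint [:: a - b + 1; d + q%:R + 1] \/
               0 < complex.Re (e - d)) :
  pFq ([:: a; b; d] ++ [seq f j + (mm j)%:R | j : 'I_r])
      ([:: a + m%:R - q%:R; e] ++ [seq f j | j : 'I_r]) 1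
  = Gamma e * Gamma (e - b - d - q%:R) / (Gamma (e - d) * Gamma (e - b - q%:R)) *
      (\sum_(0 <= j < q.+1)
         poch (- q%:R) j * poch (a - b - q%:R) j * poch d j *
         Qhat0 a b m q (Ccoef f mm) j /
         (poch (a + m%:R - q%:R) j * poch (e - b - q%:R) j * j`!%:R))
    + Gamma e * Gamma (e - b - d - q%:R) * poch (b - a) q.+1 * poch d q.+1 *
      Rhat a b m q (Ccoef f mm) (- q%:R - 1) /
      (Gamma (e - d) * Gamma (e - b + 1) * poch (a + m%:R - q%:R) q.+1) *
      pFq ([:: 1; a - b + 1; d + q%:R + 1] ++ [seq g + q%:R + 2 | g <- gamma])
          ([:: a + m%:R + 1; e - b + 1] ++ [seq g + q%:R + 1 | g <- gamma]) 1
  /\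
  Rhat a b m q (Ccoef f mm) (- q%:R - 1)
  = poch b q.+1 / poch (b - a) q.+1 *
      \sum_(0 <= k < q.+2)
         poch (- m%:R + k%:R) (q.+1 - k) * poch a k * Ccoef f mm k /
         (q.+1 - k)`!%:R.
Proof.
have [p Em] : exists p, m = (p + q)%N by exists (m - q)%N; rewrite subnK // ltnW.
have mmle j : (mm j <= m)%N by rewrite def_m (bigD1 j) //= leq_addr.
have {}def_m : (p + q)%N = (\sum_(j < r) mm j)%N by rewrite -Em.
subst m; have p_gt0 : (0 < p)%N by move: q_lt_m; rewrite -{1}[q]add0n ltn_add2r.
have eap : a + (p + q)%N%:R - q%:R = a + p%:R by rewrite natrD; ring.
rewrite eap in a_ok *.
(* The excluded integers are the values of a - b for which some factor of (a - b - q)_m vanishes. *)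
have abN i : (i < p + q)%N -> a - b - q%:R + i%:R != 0.
  move=> im; have := ab_ok (q%:Z - i%:Z); rewrite rmorphB /= !pmulrn => h.
  by rewrite -addrA addr_eq0 opprD opprK; apply: h; lia.
split; last exact: Rhat_value.
set Ck := Ccoef f mm.
have fmm j : poch (f j) (mm j) != 0.
  by have := C_def j; rewrite (poch_split _ (mmle j)) mulf_eq0 negb_or => /andP[].
pose P := shift_poly mm f.
have sP : (size P <= (p + q).+1)%N by rewrite def_m; exact: size_shift_poly.
have hP n : P.[n%:R] = \sum_(k < (p + q).+1)
    Ck k * (if (k <= n)%N then n`!%:R / (n - k)`!%:R else 0).
  rewrite (newton_coef sP); apply: eq_bigr => -[k /= km] _; congr (_ * _).
  by rewrite -(@CcoefE _ _ _ _ (p + q)%N).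
have Ck0 : Ck 0%N = 1.
  have := hP 0%N; rewrite big_ord_recl big1 => [|k _]; last by rewrite mulr0.
  rewrite subnn divr1 mulr1 addr0 => <-; rewrite -shift_polyE // => [|j]; last first.
    by rewrite poch0 oner_neq0.
  by rewrite !big_image /= !big1 ?divr1 // => j _; rewrite poch0.
pose u n := bseq b n * prat a (a + p%:R) n * P.[n%:R].
have ebdq : e - (b + q%:R) - d = e - b - d - q%:R by ring.
have ebq : e - (b + q%:R) = e - b - q%:R by ring.
have hL : (nonposint a \/ nonposint b \/ nonposint d) \/
    0 < complex.Re (e - b - d - q%:R).
  case: lhs_cvg => [[x xin hx]|h]; [left|by right].
  by move: xin hx; rewrite !inE => /or3P[] /eqP->; auto.
have hR : (nonposint (a - b + 1) \/ nonposint d) \/ 0 < complex.Re (e - d).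
  case: rhs_cvg => [[x xin hx]|h]; [left|by right].
  move: xin hx; rewrite !inE => /orP[] /eqP-> [n hn]; [by left; exists n|right].
  exists (n + q.+1)%N.
  by rewrite natrD -natr1 -[n%:R]opprK -hn; ring.
have abN' i : (i < p)%N -> a - b != - i%:R.
  move=> ip; have := ab_ok (- i%:Z); rewrite rmorphN /= => h; apply: h; lia.
have [W [S [hW hS hT]]] : transforms (b + q%:R) d e u.
  exact: transforms_main.
have EW : W = wcoef a b p q Ck.
  apply/funext; apply: (@conv_inj _ _ _ (bseq (b + q%:R))); first by rewrite bseq0 oner_neq0.
  by move=> n; rewrite hW wcoef_conv // /u hP.
rewrite EW ebq in hS.
have eF : tfac (b + q%:R) d e =
    Gamma e * Gamma (e - b - d - q%:R) / (Gamma (e - d) * Gamma (e - b - q%:R)).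
  by rewrite /tfac ebdq ebq.
rewrite eF in hT.
set F := Gamma e * _ / _ in hT *.
have lhsE : pFq ([:: a; b; d] ++ [seq f j + (mm j)%:R | j : 'I_r])
      ([:: a + p%:R; e] ++ [seq f j | j : 'I_r]) 1 = F * S.
  rewrite /pFq; apply: cvgC_lim; apply: cvgC_ext hT => N; apply: eq_bigr => n _.
  rewrite expr1n mulr1 /hyper_coef !big_cat !big_cons !big_nil /= !mulr1 /u.
  have pan := poch_neq0 n a_ok; have pen := poch_neq0 n e_ok.
  have fn0 := factR_neq0 (R[i] : numFieldType) n.
  set X := \prod_(_ <- _) _; set Y := \prod_(_ <- _) _.
  (* Once an upper symbol vanishes, some (f_j)_n may vanish too and P(n) is no longer the quotient
     of products, but both terms are 0. *)
  have [h0|h0] := boolP [&& poch a n != 0, poch b n != 0 & poch d n != 0]; last first.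
    have -> : prat d e n = poch d n / poch e n by [].
    have -> : bseq b n * prat a (a + p%:R) n = poch a n * poch b n / (poch (a + p%:R) n * n`!%:R).
      by rewrite /bseq /prat; field; apply/andP.
    move: h0; rewrite !negb_and !negbK => /or3P[] /eqP->; by rewrite !(mul0r, mulr0).
  have fn j : poch (f j) n != 0.
    case/and3P: h0 => ha hb hd; apply: lhs_lower => x.
    by rewrite !inE => /or3P[] /eqP->.
  rewrite -(shift_polyE fmm fn) -/X -/Y /bseq /prat.
  have Y0 : Y != 0 by rewrite /Y big_image /=; apply/prodf_neq0 => j _.
  by field; do ?[apply/andP; split => //].
rewrite lhsE.
have eb1 : e - b + 1 = e - b - q%:R + q.+1%:R by rewrite -natr1; ring.
(* The constant before the second series divided by F: (e - b - q)_(q+1) turns Gamma(e - b - q) into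
   Gamma(e - b + 1). *)
pose kap := poch (b - a) q.+1 * poch d q.+1 * Rhat a b (p + q) q Ck (- q%:R - 1) /
   (poch (a + p%:R) q.+1 * poch (e - b - q%:R) q.+1).
set rhsF := pFq (_ ++ [seq g + q%:R + 2 | g <- gamma]) _ 1.
have tailE t : wcoef a b p q Ck (q.+1 + t) * prat d (e - b - q%:R) (q.+1 + t) =
   kap * hyper_coef ([:: 1; a - b + 1; d + q%:R + 1] ++ [seq g + q%:R + 2 | g <- gamma])
          ([:: a + (p + q)%N%:R + 1; e - b + 1] ++ [seq g + q%:R + 1 | g <- gamma]) t.
  rewrite wcoef_Rhat // /hyper_coef !big_cat !big_cons !big_nil /= !mulr1 /prat /kap.
  rewrite !big_map.
  have e1 : poch (a + p%:R) (q.+1 + t) = poch (a + p%:R) q.+1 * poch (a + (p + q)%N%:R + 1) t.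
    by rewrite pochD; congr (_ * poch _ _); rewrite natrD -natr1; ring.
  have e2 : poch d (q.+1 + t) = poch d q.+1 * poch (d + q%:R + 1) t.
    by rewrite pochD; congr (_ * poch _ _); rewrite -natr1 addrA.
  have e3 : poch (e - b - q%:R) (q.+1 + t) = poch (e - b - q%:R) q.+1 * poch (e - b + 1) t.
    by rewrite pochD eb1.
  have e4 : poch 1 t = t`!%:R :> R[i].
    by have := poch_natS_fact (R[i] : numFieldType) 0 t; rewrite divr1.
  have n1 := poch_neq0 (q.+1 + t) a_ok; have n2 := poch_neq0 (q.+1 + t) ebq_ok.
  have n3 := factR_neq0 (R[i] : numFieldType) t.
  rewrite e1 in n1 *; rewrite e3 in n2 *; rewrite e2 e4.
  move: n1 n2; rewrite !mulf_eq0 !negb_or => /andP[n1 n4] /andP[n2 n5].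
  set X := \prod_(_ <- _) _; set Y := \prod_(_ <- _) _.
  have [h0|h0] := boolP ((poch (a - b + 1) t != 0) && (poch (d + q%:R + 1) t != 0)); last first.
    move: h0 (Rhat a b (p + q) q Ck (- (q.+1 + t)%N%:R)) (Rhat a b (p + q) q Ck (- q%:R - 1)).
    rewrite negb_and !negbK => /orP[] /eqP-> R1 R2.
      by rewrite !(mul0r, mulr0).
    by rewrite !(mul0r, mulr0).
  have Y0 : Y != 0.
    rewrite /Y prodf_seq_neq0; apply/allP => g hg /=.
    case/andP: h0 => h1 h2; apply: (rhs_lower g hg) => x.
    by rewrite !inE => /orP[] /eqP->.
  (* Each root contributes (gamma + q + 1 + t) / (gamma + q + 1), a quotient of two Pochhammer
     symbols of length t; the signs and [kappa] cancel. *)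
  have -> : Rhat a b (p + q) q Ck (- (q.+1 + t)%N%:R) =
     Rhat a b (p + q) q Ck (- q%:R - 1) * (X / Y).
    case: gamma_roots => ka _ hka; rewrite !hka -mulrA; congr (_ * _).
    apply: (mulIf Y0); rewrite -mulrA divfK // /X /Y -!big_split /=.
    apply: eq_bigr => g _.
    have := pochS (g + q%:R + 1) t; rewrite pochSl.
    rewrite (_ : g + q%:R + 1 + 1 = g + q%:R + 2); last by ring.
    move=> eg; rewrite natrD -natr1.
    transitivity (- (poch (g + q%:R + 1) t * (g + q%:R + 1 + t%:R))); first by ring.
    by rewrite -eg; ring.
  by field; do ?[apply/andP; split => //].
have htail := cvg_series_shift (n := q.+1) hS.
set S1 := \sum_(0 <= k < q.+1) _ in htail.
have kapE : kap * rhsF = S - S1.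
  (* If the constant is 0, the tail says nothing about the series [rhsF], but its product with 0
     still equals the vanishing tail. *)
  have [k0|k0] := eqVneq kap 0.
    have h0 := @cvg_series_finite R (fun=> 0) 0 (fun _ _ => erefl).
    rewrite big_nil in h0; rewrite k0 mul0r; apply: cvgC_unique htail.
    by apply: cvgC_ext h0 => N; apply: eq_bigr => t _; rewrite tailE k0 mul0r.
  have : rhsF = kap^-1 * (S - S1).
    rewrite /rhsF /pFq; apply: cvgC_lim.
    apply: cvgC_ext (@cvg_seriesZ _ kap^-1 _ _ htail) => N; apply: eq_bigr => t _.
    by rewrite tailE mulKf // expr1n mulr1.
  by move=> ->; rewrite mulVKf.
have -> : S = S1 + kap * rhsF by rewrite kapE addrC subrK.
rewrite mulrDr; congr (_ + _).
  congr (_ * _); apply: eq_big_nat => j /andP[_]; rewrite ltnS => jq.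
  rewrite wcoef_Qhat0 // /prat.
  have n1 := poch_neq0 j a_ok; have n2 := poch_neq0 j ebq_ok.
  have n3 := factR_neq0 (R[i] : numFieldType) j.
  by field; do ?[apply/andP; split => //].
rewrite mulrA; congr (_ * _).
have GE n : Gamma (e - b - q%:R + n%:R) = poch (e - b - q%:R) n * Gamma (e - b - q%:R).
  elim: n => [|n IHn]; first by rewrite addr0 poch0 mul1r.
  rewrite -natr1 addrA GammaS; last exact: nonposintD.
  by rewrite IHn pochS mulrCA mulrA.
rewrite eb1 GE /F /kap.
have n1 := poch_neq0 q.+1 a_ok; have n2 := poch_neq0 q.+1 ebq_ok.
have n3 := Gamma_neq0 ed_ok; have n4 := Gamma_neq0 ebq_ok.
by field; do ?[apply/andP; split => //].
Qed.
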